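(* Let $(R,\mathfrak m,\mathsf k)$ be a commutative Noetherian local Gorenstein ring with maximal ideal $\mathfrak m$ and residue field $\mathsf k=R/\mathfrak m$, such that $\mathfrak m^3=0\ne\mathfrak m^2$, and set $e=\operatorname{rank}_{\mathsf k}(\mathfrak m/\mathfrak m^2)$. If $e>2$ and $M$, $N$ are finitely generated $R$-modules, then the following hold: (1) $(1-et+t^2)\cdot\sum_{i=0}^\infty l\left(\operatorname{Ext}^i_R(M,N)\right)t^i\in\mathbb Z[t]$; (2) $(1-et+t^2)\cdot\sum_{i=0}^\infty l\left(\operatorname{Tor}_i^R(M,N)\right)t^i\in\mathbb Z[t]$.
   Context: Here $l(-)$ denotes the length of an $R$-module. Products are taken in the ring of formal power series $\mathbb Z[[t]]$. *)

(* Defs.v *)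
From HB Require Import structures.
From mathcomp Require Import all_boot all_order all_algebra.
From mathcomp Require Import finmap boolp functions.
From mathcomp.multinomials Require Import monalg.

Set Implicit Arguments.
Unset Strict Implicit.
Unset Printing Implicit Defensive.
Set Warnings "-redundant-canonical-projection".

Import GRing.Theory.
Local Open Scope ring_scope.
Local Open Scope quotient_scope.

(* Submodules of V are the bundled predicates [submodClosed V]; in particular
   an ideal of R is a [submodClosed R^o]. *)

Section Submodules.
Variables (R : comNzRingType) (V W : lmodType R).

Definition submod (S : submodClosed V) : Type := {x : V | x \in S}.

HB.instance Definition _ (S : submodClosed V) :=
  SubChoice.copy (submod S) {x : V | x \in S}.
HB.instance Definition _ (S : submodClosed V) :=
  [SubChoice_isSubLmodule of submod S by <:].

Lemma submod_zmod_closed (S : submodClosed V) : zmod_closed S.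
Proof.
split=> [|x y xS yS]; first exact: rpred0.
by rewrite rpredD // -scaleN1r rpredZ.
Qed.

Definition kerp (f : {linear V -> W}) : {pred V} := [pred x | f x == 0].

Lemma kerp_submod (f : {linear V -> W}) : submod_closed (kerp f).
Proof.
split=> [|a x y]; rewrite !inE ?linear0 // => /eqP fx /eqP fy.
by rewrite linearP fx fy scaler0 addr0.
Qed.

HB.instance Definition _ (f : {linear V -> W}) :=
  GRing.isSubmodClosed.Build R V (kerp f) (kerp_submod f).

Definition ker (f : {linear V -> W}) : submodClosed V := kerp f.

Definition imp (f : {linear V -> W}) : {pred W} :=
  [pred y | `[< exists x, f x = y >]].

Lemma imp_submod (f : {linear V -> W}) : submod_closed (imp f).
Proof.
split=> [|a x y].
  by apply/asboolP; exists 0; rewrite linear0.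
move=> /asboolP[u <-] /asboolP[v <-].
by apply/asboolP; exists (a *: u + v); rewrite linearP.
Qed.

HB.instance Definition _ (f : {linear V -> W}) :=
  GRing.isSubmodClosed.Build R W (imp f) (imp_submod f).

Definition im (f : {linear V -> W}) : submodClosed W := imp f.

Definition sub_spanp (G : V -> Prop) : {pred V} :=
  [pred x | `[< exists s : seq (R * V),
     (forall p, p \in s -> G p.2) /\ x = \sum_(p <- s) p.1 *: p.2 >]].

Lemma sub_spanp_submod (G : V -> Prop) : submod_closed (sub_spanp G).
Proof.
split=> [|a x y].
  by apply/asboolP; exists [::]; split=> //; rewrite big_nil.
move=> /asboolP[s [sG ->]] /asboolP[t [tG ->]]; apply/asboolP.
exists ([seq (a * p.1, p.2) | p <- s] ++ t); split=> [p|].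
  by rewrite mem_cat => /orP[/mapP[q qs ->]|/tG //]; exact: (sG q qs).
rewrite big_cat big_map scaler_sumr /=; congr (_ + _).
by apply: eq_bigr => p _; rewrite scalerA.
Qed.

HB.instance Definition _ (G : V -> Prop) :=
  GRing.isSubmodClosed.Build R V (sub_spanp G) (sub_spanp_submod G).

Definition sub_span (G : V -> Prop) : submodClosed V := sub_spanp G.

Lemma mem_sub_span (G : V -> Prop) x : G x -> x \in sub_span G.
Proof.
move=> Gx; apply/asboolP; exists [:: (1, x)]; split=> [p|].
  by rewrite inE => /eqP ->.
by rewrite big_seq1 scale1r.
Qed.

Definition finitely_generated (S : submodClosed V) : Prop :=
  exists s : seq V, sub_span (fun x => x \in s) =i S.

Definition fg_module : Prop :=
  exists s : seq V, forall x : V, x \in sub_span (fun y => y \in s).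

Definition strict_sub (S T : submodClosed V) : Prop :=
  {subset S <= T} /\ exists2 x, x \in T & x \notin S.

Definition submod_chain (n : nat) : Prop :=
  exists c : nat -> submodClosed V,
    forall i, (i < n)%N -> strict_sub (c i) (c i.+1).

(* The length is finite and equal to n. *)
Definition has_length (n : nat) : Prop :=
  submod_chain n /\ forall p, submod_chain p -> (p <= n)%N.

End Submodules.

Section QuotientModule.
Variables (R : comNzRingType) (V : lmodType R) (S : submodClosed V).

Definition zmod_of_submodp : {pred V} := S.

HB.instance Definition _ :=
  GRing.isZmodClosed.Build V zmod_of_submodp (submod_zmod_closed S).

Definition quotmod : Type := Quotient.quot (zmod_of_submodp : zmodClosed V).

HB.instance Definition _ := GRing.Zmodule.on quotmod.

Definition qpi (x : V) : quotmod :=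
  \pi_(Quotient.quot (zmod_of_submodp : zmodClosed V)) x.

Definition qrepr (x : quotmod) : V := repr x.

Lemma qreprK x : qpi (qrepr x) = x.
Proof. exact: reprK. Qed.

Lemma qpiP x y : reflect (qpi x = qpi y) (x - y \in S).
Proof.
rewrite -[x - y \in S]/(x - y \in (zmod_of_submodp : zmodClosed V)).
by rewrite Quotient.idealrBE; exact: eqP.
Qed.

Lemma qpi_is_zmod_morphism : zmod_morphism qpi.
Proof. by move=> x y; rewrite /qpi; exact: raddfB. Qed.

HB.instance Definition _ :=
  GRing.isZmodMorphism.Build V quotmod qpi qpi_is_zmod_morphism.

Definition qscale (a : R) (x : quotmod) : quotmod := qpi (a *: qrepr x).

Lemma qscale_pi a x : qscale a (qpi x) = qpi (a *: x).
Proof. by apply/qpiP; rewrite -scalerBr rpredZ //; apply/qpiP/qreprK. Qed.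

Fact qscaleA a b x : qscale a (qscale b x) = qscale (a * b) x.
Proof. by rewrite -[x]qreprK !qscale_pi scalerA. Qed.

Fact qscale1 : left_id 1 qscale.
Proof. by move=> x; rewrite -[x]qreprK qscale_pi scale1r. Qed.

Fact qscaleDr : right_distributive qscale +%R.
Proof.
move=> a x y; rewrite -[x]qreprK -[y]qreprK.
by rewrite -raddfD !qscale_pi scalerDr raddfD.
Qed.

Fact qscaleDl x : {morph qscale^~ x : a b / a + b}.
Proof. by move=> a b; rewrite -[x]qreprK !qscale_pi scalerDl raddfD. Qed.

HB.instance Definition _ :=
  GRing.Zmodule_isLmodule.Build R quotmod qscaleA qscale1 qscaleDr qscaleDl.

Fact qpi_scalable : scalable qpi.
Proof. by move=> a x; rewrite -qscale_pi. Qed.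

HB.instance Definition _ := GRing.isScalable.Build R V quotmod *:%R qpi
  qpi_scalable.

End QuotientModule.

Section Subquotient.
Variables (R : comNzRingType) (V : lmodType R) (S T : submodClosed V).

Definition trace_inp : {pred submod S} := [pred x | val x \in T].

Lemma trace_inp_submod : submod_closed trace_inp.
Proof.
split=> [|a x y]; rewrite !inE ?raddf0 ?rpred0 // => xT yT.
by rewrite linearP rpredD ?rpredZ.
Qed.

HB.instance Definition _ :=
  GRing.isSubmodClosed.Build R (submod S) trace_inp trace_inp_submod.

(* S / (S :&: T); in all uses below T is contained in S. *)
Definition subquot : lmodType R :=
  quotmod (trace_inp : submodClosed (submod S)).

End Subquotient.

Definition homology (R : comNzRingType) (U V W : lmodType R)
  (f : {linear U -> V}) (g : {linear V -> W}) : lmodType R :=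
  subquot (ker g) (im f).

Section FreeModule.
Variables (R : comNzRingType) (K : choiceType) (V : lmodType R).

(* The free module on K: finitely supported functions K -> R. *)
Definition free_mod (R : comNzRingType) (K : choiceType) : lmodType R :=
  {malg R[K]}.

Definition basis_elt (k : K) : free_mod R K := << (1 : R) *g k >>.

Definition free_lift (h : K -> V) (g : free_mod R K) : V :=
  \sum_(k <- msupp g) g@_k *: h k.

Lemma free_liftEw h (g : free_mod R K) (d : {fset K}) :
  fsubset (msupp g) d -> free_lift h g = \sum_(k <- d) g@_k *: h k.
Proof.
move=> sgd; rewrite /free_lift; apply: big_fset_incl => // k _ kg.
by rewrite mcoeff_outdom // scale0r.
Qed.

Lemma free_lift_linear h : linear (free_lift h).
Proof.
move=> a x y; pose d := fsetU (msupp (a *: x + y)) (fsetU (msupp x) (msupp y)).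
rewrite (@free_liftEw _ _ d) ?fsubsetUl //.
rewrite (@free_liftEw _ x d); last first.
  by rewrite /d fsetUA fsetUAC fsubsetUr.
rewrite (@free_liftEw _ y d); last by rewrite /d fsetUA fsubsetUr.
rewrite scaler_sumr -big_split /=; apply: eq_bigr => k _.
by rewrite mcoeffD mcoeffZ scalerDl scalerA.
Qed.

HB.instance Definition _ h :=
  GRing.isLinear.Build R (free_mod R K) V *:%R (free_lift h)
    (free_lift_linear h).

Lemma free_lift_basis h k : free_lift h (basis_elt k) = h k.
Proof.
rewrite /free_lift msuppU oner_eq0 big_seq_fset1 mcoeffUU.
by rewrite scale1r.
Qed.

End FreeModule.

Section Hom.
Variable R : comNzRingType.

Definition homp (U V : lmodType R) : {pred U -> V} :=
  [pred f : U -> V | `[< linear f >]].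

Lemma homp_submod (U V : lmodType R) : submod_closed (@homp U V).
Proof.
split=> [|a f g /asboolP lf /asboolP lg]; apply/asboolP => b x y /=.
  by rewrite scaler0 addr0.
rewrite !fctE lf lg !scalerDr !scalerA mulrC -!addrA; congr (_ + _).
by rewrite addrCA.
Qed.

HB.instance Definition _ (U V : lmodType R) :=
  GRing.isSubmodClosed.Build R (U -> V) (@homp U V) (@homp_submod U V).

Definition Hom (U V : lmodType R) : lmodType R :=
  submod (@homp U V : submodClosed (U -> V)).

Lemma hom_map_subproof (U U' V : lmodType R) (f : {linear U -> U'})
  (h : Hom U' V) : (val h \o f : U -> V) \in @homp U V.
Proof.
have /asboolP lh := valP h.
by apply/asboolP => a x y /=; rewrite linearP lh.
Qed.

Definition hom_map (U U' V : lmodType R) (f : {linear U -> U'})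
  (h : Hom U' V) : Hom U V := Sub (val h \o f) (hom_map_subproof f h).

Lemma hom_map_linear (U U' V : lmodType R) (f : {linear U -> U'}) :
  linear (@hom_map U U' V f).
Proof. by move=> a g h; apply/val_inj. Qed.

HB.instance Definition _ (U U' V : lmodType R) (f : {linear U -> U'}) :=
  GRing.isLinear.Build R (Hom U' V) (Hom U V) *:%R (@hom_map U U' V f)
    (@hom_map_linear U U' V f).

End Hom.

Section Tensor.
Variable R : comNzRingType.

Inductive bilinear_relation (U V : lmodType R) :
    free_mod R (U * V)%type -> Prop :=
  | BilinDl (x x' : U) (y : V) : bilinear_relation
      (basis_elt R (x + x', y) - basis_elt R (x, y) - basis_elt R (x', y))
  | BilinDr (x : U) (y y' : V) : bilinear_relation
      (basis_elt R (x, y + y') - basis_elt R (x, y) - basis_elt R (x, y'))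
  | BilinZl (a : R) (x : U) (y : V) : bilinear_relation
      (basis_elt R (a *: x, y) - a *: basis_elt R (x, y))
  | BilinZr (a : R) (x : U) (y : V) : bilinear_relation
      (basis_elt R (x, a *: y) - a *: basis_elt R (x, y)).

Definition tensor (U V : lmodType R) : lmodType R :=
  quotmod (sub_span (@bilinear_relation U V)).

Definition tens (U V : lmodType R) (x : U) (y : V) : tensor U V :=
  qpi _ (basis_elt R (x, y)).

Lemma tensDl (U V : lmodType R) (x x' : U) (y : V) : tens (x + x') y = tens x y + tens x' y.
Proof.
rewrite /tens -raddfD; apply/qpiP; rewrite opprD addrA.
exact/mem_sub_span/BilinDl.
Qed.

Lemma tensDr (U V : lmodType R) (x : U) (y y' : V) : tens x (y + y') = tens x y + tens x y'.
Proof.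
rewrite /tens -raddfD; apply/qpiP; rewrite opprD addrA.
exact/mem_sub_span/BilinDr.
Qed.

Lemma tensZl (U V : lmodType R) a (x : U) (y : V) : tens (a *: x) y = a *: tens x y.
Proof. by rewrite /tens -linearZ; apply/qpiP/mem_sub_span/BilinZl. Qed.

Lemma tensZr (U V : lmodType R) a (x : U) (y : V) : tens x (a *: y) = a *: tens x y.
Proof. by rewrite /tens -linearZ; apply/qpiP/mem_sub_span/BilinZr. Qed.

Definition tensor_map_free (U U' V : lmodType R) (f : {linear U -> U'}) :
    {linear free_mod R (U * V)%type -> tensor U' V} :=
  free_lift (fun p : U * V => tens (f p.1) p.2).

(* The map induced by f on the quotient; [qrepr] picks a representative. *)
Definition tensor_map (U U' V : lmodType R) (f : {linear U -> U'})
  (t : tensor U V) : tensor U' V := tensor_map_free V f (qrepr t).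

Lemma tensor_map_free_basis (U U' V : lmodType R) (f : {linear U -> U'})
  (x : U) (y : V) :
  tensor_map_free V f (basis_elt R (x, y)) = tens (f x) y.
Proof. by rewrite /tensor_map_free /= free_lift_basis. Qed.

Lemma tensor_map_free_rel (U U' V : lmodType R) (f : {linear U -> U'}) x :
  x \in sub_span (@bilinear_relation U V) -> tensor_map_free V f x = 0.
Proof.
move=> /asboolP[s [sG ->]]; rewrite linear_sum big_seq big1 // => p /sG rel_p.
rewrite linearZZ; suff -> : tensor_map_free V f p.2 = 0 by rewrite scaler0.
case: rel_p => [u u' v|u v v'|a u v|a u v].
- rewrite 2!linearB !tensor_map_free_basis linearD tensDl.
  by rewrite addrAC addrK subrr.
- by rewrite 2!linearB !tensor_map_free_basis tensDr addrAC addrK subrr.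
- rewrite linearB linearZZ !tensor_map_free_basis linearZZ tensZl.
  exact: subrr.
- by rewrite linearB linearZZ !tensor_map_free_basis tensZr subrr.
Qed.

Lemma tensor_map_pi (U U' V : lmodType R) (f : {linear U -> U'}) x :
  tensor_map f (qpi (sub_span (@bilinear_relation U V)) x) =
  tensor_map_free V f x.
Proof.
apply/eqP; rewrite -subr_eq0 /tensor_map -raddfB /=.
by apply/eqP/tensor_map_free_rel/qpiP/qreprK.
Qed.

Lemma tensor_map_linear (U U' V : lmodType R) (f : {linear U -> U'}) :
  linear (@tensor_map U U' V f).
Proof.
move=> a x y; rewrite -[x]qreprK -[y]qreprK -linearP !tensor_map_pi.
exact: linearP.
Qed.

HB.instance Definition _ (U U' V : lmodType R) (f : {linear U -> U'}) :=
  GRing.isLinear.Build R (tensor U V) (tensor U' V) *:%R (@tensor_map U U' V f)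
    (@tensor_map_linear U U' V f).

Lemma tensor_map_tens (U U' V : lmodType R) (f : {linear U -> U'}) x (y : V) :
  tensor_map f (tens x y) = tens (f x) y.
Proof. by rewrite tensor_map_pi tensor_map_free_basis. Qed.

End Tensor.

Section FreeResolution.
Variables (R : comNzRingType) (M : lmodType R).

Definition free_cover (V : lmodType R) : {linear free_mod R V -> V} :=
  free_lift (@id V).

Fixpoint syz (i : nat) : lmodType R :=
  if i is j.+1 then submod (ker (free_cover (syz j))) else M.

(* The standard free resolution of M: the i-th term is the free module on the
   elements of the i-th syzygy module [syz i]. *)
Definition res (i : nat) : lmodType R := free_mod R (syz i).

Definition res_aug : {linear res 0 -> M} := free_cover M.

Definition res_incl (i : nat) : {linear syz i.+1 -> res i} :=
  (val : submod (ker (free_cover (syz i))) -> res i).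

Definition res_d (i : nat) : {linear res i.+1 -> res i} :=
  res_incl i \o free_cover (syz i.+1).

Lemma free_cover_surj (V : lmodType R) (x : V) : exists y, free_cover V y = x.
Proof. by exists (basis_elt R x); rewrite /free_cover /= free_lift_basis. Qed.

Lemma res_incl_exact i (x : res i) :
  free_cover (syz i) x = 0 <-> exists y, res_d i y = x.
Proof.
split=> [/eqP x0|[y <-]]; last first.
  by apply/eqP; exact: (valP (free_cover (syz i.+1) y)).
have xk : x \in ker (free_cover (syz i)) by [].
have [y yx] := @free_cover_surj (syz i.+1) (Sub x xk).
by exists y; rewrite /res_d /= yx.
Qed.

Lemma res_exact0 (x : res 0) : res_aug x = 0 <-> exists y, res_d 0 y = x.
Proof. exact: (@res_incl_exact 0). Qed.

Lemma res_exact i (x : res i.+1) :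
  res_d i x = 0 <-> exists y, res_d i.+1 y = x.
Proof.
rewrite -res_incl_exact; split=> [|x0]; last by rewrite /res_d /= x0.
by move=> dx; apply: val_inj; rewrite /= -[RHS]dx.
Qed.

End FreeResolution.

Section ExtTor.
Variables (R : comNzRingType) (M N : lmodType R).

Definition Ext (i : nat) : lmodType R :=
  if i is j.+1 then
    homology (hom_map (V := N) (res_d M j)) (hom_map (V := N) (res_d M j.+1))
  else
    homology (\0 : {linear Hom (res M 0) N -> Hom (res M 0) N})
             (hom_map (V := N) (res_d M 0)).

Definition Tor (i : nat) : lmodType R :=
  if i is j.+1 then
    homology (tensor_map (V := N) (res_d M j.+1))
             (tensor_map (V := N) (res_d M j))
  else
    homology (tensor_map (V := N) (res_d M 0))
             (\0 : {linear tensor (res M 0) N -> tensor (res M 0) N}).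

End ExtTor.

Section Rings.
Variable R : comNzRingType.

Definition noetherian : Prop :=
  forall I : submodClosed R^o, finitely_generated I.

Definition is_proper (I : submodClosed R^o) : Prop := (1 : R^o) \notin I.

Definition maximal_ideal (I : submodClosed R^o) : Prop :=
  is_proper I /\
  forall J : submodClosed R^o, is_proper J -> {subset I <= J} -> J =i I.

Definition local_ring (m : submodClosed R^o) : Prop :=
  maximal_ideal m /\ forall I, maximal_ideal I -> I =i m.

Definition ideal_mul (I J : submodClosed R^o) : submodClosed R^o :=
  sub_span (fun x : R^o => exists a b : R, [/\ a \in I, b \in J & x = a * b]).

(* The rank over R/m of a module V killed by m: v is a basis of the R/m-vector
   space V, the scalars in R/m being represented by elements of R. *)
Definition residue_rank (m : submodClosed R^o) (V : lmodType R) (e : nat) :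
    Prop :=
  exists v : 'I_e -> V,
    (forall x, exists r : 'I_e -> R, x = \sum_i r i *: v i) /\
    (forall r : 'I_e -> R, \sum_i r i *: v i = 0 -> forall i, r i \in m).

Definition injective_module (E : lmodType R) : Prop :=
  forall (A B : lmodType R) (i : {linear A -> B}) (f : {linear A -> E}),
    injective i -> exists g : {linear B -> E}, forall a, g (i a) = f a.

(* There is an exact sequence 0 -> M -> I 0 -> ... -> I n -> 0 with every I j
   injective. *)
Definition inj_dim_le (M : lmodType R) (n : nat) : Prop :=
  exists (I : nat -> lmodType R) (eta : {linear M -> I 0%N})
    (d : forall j, {linear I j -> I j.+1}),
    [/\ forall j, injective_module (I j),
        injective eta,
        forall x, d 0%N x = 0 <-> exists y, eta y = x,
        forall j x, d j.+1 x = 0 <-> exists y, d j y = x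
      & forall j (x : I j), (n < j)%N -> x = 0].

(* A Noetherian local ring is Gorenstein when it has finite injective dimension
   over itself. *)
Definition gorenstein : Prop := exists n, inj_dim_le R^o n.

End Rings.

(* Z[[t]]: a power series is its sequence of coefficients. *)
Definition zseries := nat -> int.

Definition zseries_mul (f g : zseries) : zseries :=
  fun n => \sum_(i < n.+1) f i * g (n - i)%N.

Definition zseries_of_poly (p : {poly int}) : zseries := fun n => p`_n.

(* Main.v *)
(* Since [m ^ 3 = 0] and [R] is Gorenstein, [R] is self-injective with socle
   [m ^ 2 = x R], of length one, and multiplication [m / m ^ 2 * m / m ^ 2 -> m ^ 2]
   is a perfect pairing.  Let [D] and [C] be minimal free resolutions of [M] and
   [N], of ranks [b i] and [n j].

   If [L] is a matrix, not zero modulo [m], with [D i *m L *m (C 0)^T = 0], then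
   [L] lifts to a chain of matrices, the last of which bounds by [b 0] the
   colength of a submodule of [R ^ (n i)].  When the syzygies of [N] have no
   summand [R / m], pulling this submodule back along [C] gives proper submodules
   whose colengths [q j] satisfy [e q (j + 1) <= q j + q (j + 2)].  As [e > 2], they
   are strictly convex, so [i < n 0 + b 0].

   Applied to the resolution of [R / m] this shows that the syzygies of any module
   eventually have no summand [R / m], whence [e b (i + 1) = b i + b (i + 2)] for
   large [i].  Applied to high syzygies it gives [(D i)^T 'M (C j) = x 'M] for large
   [i] and [j], by duality; with dimension shifting, [Tor_(i + j + 2)] then has length
   [b (i + 1) n (j + 1) - b i n j], and the recursion for [b] passes to these lengths.
   Finally [Ext^i(M, N)] has the length of [Tor_i(M, Hom(N, R))], by duality. *)

Require Import Defs.
From HB Require Import structures.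
From mathcomp Require Import all_boot all_order all_algebra.
From mathcomp Require Import finmap boolp functions.
From mathcomp.multinomials Require Import monalg.
From mathcomp Require Import zify ring.

Set Implicit Arguments.
Unset Strict Implicit.
Unset Printing Implicit Defensive.
Set Warnings "-redundant-canonical-projection".

Import GRing.Theory.
Local Open Scope ring_scope.

(** * Submodules and relative length *)

(** All modules are replaced by free modules and matrices over R: in a matrix A, [D] acts on the
    left through its transpose and [C] on the right, so Tor is read off from both resolutions at
    once. A functional on matrices is the trace form with a fixed matrix, so self-injectivity is
    mostly used as a separation property: a matrix outside a submodule is detected by a matrix
    orthogonal to the submodule. Exactness of the transposed resolution, the double annihilator and
    the filling of the socle by products all come from it. The factor e in the colength inequality
    arises because an element of m R^n is, up to the socle, a combination of the e generators of m
    with coefficients in R^n; the dual basis recovers each coefficient modulo m. The inequality 3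
    q_1 <= q_0 + q_2 leaves a spare q_1 >= 1 at each step, whereas 2 q_1 <= q_0 + q_2 would only
    propagate the bound without growth. Minimality is imposed only from the second differential on,
    since the first free module is given from outside; hence the index shifts in the final
    recursions. *)

Section MkSubmodule.
Variables (R : comNzRingType) (V : lmodType R).

Definition submod_prop (P : V -> Prop) :=
  P 0 /\ forall a x y, P x -> P y -> P (a *: x + y).

Definition propp (P : V -> Prop) (h : submod_prop P) : {pred V} :=
  [pred x | `[< P x >]].

Lemma propp_closed (P : V -> Prop) (h : submod_prop P) :
  submod_closed (propp h).
Proof.
case: (h) => P0 PD; split=> [|a x y]; first by apply/asboolP.
by move=> /asboolP Px /asboolP Py; apply/asboolP/PD.
Qed.

HB.instance Definition _ (P : V -> Prop) (h : submod_prop P) :=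
  GRing.isSubmodClosed.Build R V (propp h) (propp_closed h).

Definition mksub (P : V -> Prop) (h : submod_prop P) : submodClosed V :=
  propp h.

Lemma mksubP (P : V -> Prop) (h : submod_prop P) x :
  reflect (P x) (x \in mksub h).
Proof. exact: asboolP. Qed.

Lemma submod_subr (S : submodClosed V) x y : x \in S -> y \in S -> x - y \in S.
Proof. by move=> xS yS; have [_] := submod_zmod_closed S; apply. Qed.

Fact zerosub_prop : submod_prop (fun x : V => x = 0).
Proof. by split=> // a x y -> ->; rewrite scaler0 addr0. Qed.
Definition zerosub := mksub zerosub_prop.

Fact fullsub_prop : submod_prop (fun _ : V => True).
Proof. by []. Qed.
Definition fullsub := mksub fullsub_prop.

Lemma in_fullsub x : x \in fullsub. Proof. exact/mksubP. Qed.

Fact capsub_prop (S T : submodClosed V) :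
  submod_prop (fun x => x \in S /\ x \in T).
Proof.
split=> [|a x y [xS xT] [yS yT]]; first by rewrite !rpred0.
by split; rewrite rpredD ?rpredZ.
Qed.
Definition capsub S T := mksub (capsub_prop S T).

Fact addsub_prop (S T : submodClosed V) :
  submod_prop (fun x => exists s t, [/\ s \in S, t \in T & x = s + t]).
Proof.
split=> [|a _ _ [s [t [sS tT ->]]] [s' [t' [sS' tT' ->]]]].
  by exists 0, 0; rewrite !rpred0 addr0.
exists (a *: s + s'), (a *: t + t'); rewrite !rpredD ?rpredZ //; split=> //.
by rewrite scalerDr addrACA.
Qed.
Definition addsub S T := mksub (addsub_prop S T).

Lemma addsubl (S T : submodClosed V) : {subset S <= addsub S T}.
Proof.
by move=> x xS; apply/mksubP; exists x, 0; rewrite rpred0 addr0.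
Qed.

Lemma addsubr (S T : submodClosed V) : {subset T <= addsub S T}.
Proof.
by move=> x xS; apply/mksubP; exists 0, x; rewrite rpred0 add0r.
Qed.

Lemma addsub_sub (S T U : submodClosed V) :
  {subset S <= U} -> {subset T <= U} -> {subset addsub S T <= U}.
Proof.
move=> SU TU x /mksubP[s [t [sS tT ->]]].
by apply: rpredD; [exact: SU | exact: TU].
Qed.

End MkSubmodule.
Arguments zerosub {R V}.
Arguments fullsub {R V}.

Section SubmoduleType.
Variables (R : comNzRingType) (V : lmodType R) (S : submodClosed V).

Definition submod_mk v (h : v \in S) : submod S := Sub v h.
Definition submod_val : {linear submod S -> V} := (val : submod S -> V).

Lemma submod_mkK v (h : v \in S) : submod_val (submod_mk h) = v.
Proof. by []. Qed.

Lemma submod_val_inj : injective submod_val. Proof. exact: val_inj. Qed.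

Lemma submod_valP (u : submod S) : submod_val u \in S.
Proof. exact: valP. Qed.

End SubmoduleType.
Arguments submod_val {R V}.

Section ImagePreimage.
Variables (R : comNzRingType) (V W : lmodType R) (f : {linear V -> W}).

Fact imsub_prop (S : submodClosed V) :
  submod_prop (fun y : W => exists2 x, x \in S & y = f x).
Proof.
split=> [|a _ _ [x xS ->] [y yS ->]].
  by exists 0; rewrite ?rpred0 ?linear0.
by exists (a *: x + y); rewrite ?linearP ?rpredD ?rpredZ.
Qed.
Definition imsub S := mksub (imsub_prop S).

Fact presub_prop (S : submodClosed W) :
  submod_prop (fun x : V => f x \in S).
Proof.
split=> [|a x y xS yS]; first by rewrite linear0 rpred0.
by rewrite linearP rpredD ?rpredZ.
Qed.
Definition presub S := mksub (presub_prop S).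

Lemma mem_imsub (S : submodClosed V) x : x \in S -> f x \in imsub S.
Proof. by move=> xS; apply/mksubP; exists x. Qed.

Lemma kerP x : reflect (f x = 0) (x \in ker f).
Proof. exact: eqP. Qed.

Lemma imP y : reflect (exists x, f x = y) (y \in im f).
Proof. exact: asboolP. Qed.

End ImagePreimage.

Section RelativeLength.
Variables (R : comNzRingType).
Implicit Types (V W : lmodType R).

(** Chains are kept inside V, between T and S, so that lengths of subquotients S / T are compared
    without forming quotient modules; [has_length_subquot] makes the link. *)
Definition rchain V (T S : submodClosed V) n :=
  exists c : nat -> submodClosed V,
    (forall i, (i <= n)%N -> {subset T <= c i} /\ {subset c i <= S}) /\
    (forall i, (i < n)%N -> strict_sub (c i) (c i.+1)).

Definition rlen V (T S : submodClosed V) n :=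
  rchain T S n /\ forall p, rchain T S p -> (p <= n)%N.

Definition finlen V (T S : submodClosed V) := exists n, rlen T S n.

(** The value 0 stands for infinite length; with it [len_iso] holds without any finiteness
    hypothesis. *)
Definition len V (T S : submodClosed V) : nat :=
  if pselect (finlen T S) is left h then projT1 (cid h) else 0%N.

Lemma rlen_uniq V (T S : submodClosed V) n p :
  rlen T S n -> rlen T S p -> n = p.
Proof.
move=> [c1 b1] [c2 b2]; apply/eqP; rewrite eqn_leq.
by rewrite b2 // b1.
Qed.

Lemma lenP V (T S : submodClosed V) : finlen T S -> rlen T S (len T S).
Proof.
move=> h0; rewrite /len; case: pselect => [h|/(_ h0)//].
exact: projT2 (cid h).
Qed.

Lemma len_rlen V (T S : submodClosed V) n : rlen T S n -> len T S = n.
Proof. move=> h; have f : finlen T S by exists n. exact: rlen_uniq (lenP f) h. Qed.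

Lemma rchain0 V (T S : submodClosed V) : {subset T <= S} -> rchain T S 0.
Proof. by move=> TS; exists (fun=> T); split=> // i _; split. Qed.

Lemma rchain_sub V (T S : submodClosed V) n : rchain T S n -> {subset T <= S}.
Proof. by move=> [c [h _]] x xT; have [h1 h2] := h 0%N isT; apply/h2/h1. Qed.

Lemma finlen_bound V (T S : submodClosed V) N : {subset T <= S} ->
  (forall p, rchain T S p -> (p <= N)%N) -> finlen T S.
Proof.
move=> TS bnd; have ex : exists n, `[< rchain T S n >].
  by exists 0%N; apply/asboolP/rchain0.
have bnd' n : `[< rchain T S n >] -> (n <= N)%N by move/asboolP/bnd.
case: (ex_maxnP ex bnd') => n /asboolP cn mx.
by exists n; split=> // p /asboolP/mx.
Qed.

Lemma strict_sub_trans V (S T U : submodClosed V) :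
  strict_sub S T -> {subset T <= U} -> strict_sub S U.
Proof.
move=> [ST [x xT xS]] TU; split; first by move=> y /ST/TU.
by exists x => //; apply: TU.
Qed.

Lemma rchain_widen V (T S T' S' : submodClosed V) n :
  {subset T' <= T} -> {subset S <= S'} -> rchain T S n -> rchain T' S' n.
Proof.
move=> TT SS [c [h s]]; exists c; split=> // i /h[h1 h2].
by split=> x; [move/TT/h1 | move/h2/SS].
Qed.

Lemma rchain_rcons V (T S S' : submodClosed V) n :
  rchain T S n -> strict_sub S S' -> rchain T S' n.+1.
Proof.
move=> cn [SS [x xS' xS]]; have TS := rchain_sub cn.
case: cn => c [h s].
exists (fun i => if (i <= n)%N then c i else S'); split=> i.
  case: ifP => [/h[h1 h2] _|_ _]; split=> //; move=> y; first by move/h2/SS.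
  by move/TS/SS.
move=> li; have /orP[/eqP ->|lin] : (i == n) || (i < n)%N.
- by rewrite -leq_eqVlt -ltnS.
  rewrite leqnn ltnn; have [_ h2] := h n (leqnn n); split.
    by move=> y /h2/SS.
  by exists x => //; apply: contra xS; exact: h2.
by rewrite (ltnW lin) lin; exact: s.
Qed.

Lemma rchain_map V W (T S : submodClosed V) (T' S' : submodClosed W)
    (F : submodClosed V -> submodClosed W) n :
  (forall U : submodClosed V, {subset T <= U} -> {subset U <= S} ->
     {subset T' <= F U} /\ {subset F U <= S'}) ->
  (forall U U' : submodClosed V, {subset T <= U} -> {subset U' <= S} -> strict_sub U U' ->
     strict_sub (F U) (F U')) ->
  rchain T S n -> rchain T' S' n.
Proof.
move=> h s [c [ch cs]]; exists (F \o c); split=> i lin.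
  by have [? ?] := ch i lin; apply: h.
have [? _] := ch i (ltnW lin); have [_ ?] := ch i.+1 lin.
by apply: s => //; apply: cs.
Qed.

Lemma rchain_cat V (T U S : submodClosed V) a b :
  rchain T U a -> rchain U S b -> rchain T S (a + b).
Proof.
move=> [c [ch cs]] cd; have US := rchain_sub cd; case: cd => [d [dh ds]].
have TU x : x \in T -> x \in U.
  by have [h1 h2] := ch 0%N isT; move=> /h1/h2.
exists (fun i => if (i < a)%N then c i else d (i - a)%N); split=> i.
  move=> lin; case: ltnP => [lia_|lai].
    have [h1 h2] := ch i (ltnW lia_); split=> // x; first by move/h2/US.
  have [|h1 h2] := dh (i - a)%N; first lia.
  by split=> // x /TU/h1.
move=> lin; case: (ltnP i a) => lia_; last first.
  rewrite ifF; last lia.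
  have -> : (i.+1 - a = (i - a).+1)%N by lia.
  by apply: ds; lia.
case: (ltnP i.+1 a) => lia2; first exact: cs.
have ea : a = i.+1 by lia.
rewrite ea subnn; apply: (@strict_sub_trans _ _ (c i.+1)).
  by apply: cs.
have [h1 _] := dh 0%N isT; have [_ h2] := ch i.+1 lia_.
by move=> x /h2/h1.
Qed.

(** By the modular law, each strict step of a chain strictly enlarges its trace on U or its sum with
    U, so the steps can be shared out between the two. *)
Lemma rchain_split V (T U S : submodClosed V) p :
  {subset T <= U} -> {subset U <= S} -> rchain T S p ->
  exists a b, [/\ p = (a + b)%N, rchain T U a & rchain U S b].
Proof.
move=> TU US [c [ch cs]].
suff main n : (n <= p)%N -> exists a b, [/\ n = (a + b)%N,
    rchain T (capsub U (c n)) a & rchain U (addsub U (c n)) b].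
  have [a [b [ep ca cb]]] := main p (leqnn p); exists a, b; split=> //.
    by apply: rchain_widen ca => // x /mksubP[].
  apply: rchain_widen cb => //; apply: addsub_sub => //.
  by have [_] := ch p (leqnn p).
elim: n => [_|n IH lnp].
  exists 0%N, 0%N; split=> //; apply: rchain0.
    have [h _] := ch 0%N isT.
    by move=> x xT; apply/mksubP; split; [apply: TU | apply: h].
  exact: addsubl.
have [a [b [en ca cb]]] := IH (ltnW lnp).
have [sn [x xc xnc]] := cs n lnp.
have capS : {subset capsub U (c n) <= capsub U (c n.+1)}.
  by move=> y /mksubP[yU yc]; apply/mksubP; split=> //; apply: sn.
have addS : {subset addsub U (c n) <= addsub U (c n.+1)}.
  apply: addsub_sub; first exact: addsubl.
  by move=> y /sn; exact: addsubr.
have [xa|xa] := boolP (x \in addsub U (c n)); last first.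
  exists a, b.+1; split; first lia.
    exact: rchain_widen ca.
  by apply: (rchain_rcons cb); split=> //; exists x => //; apply: addsubr.
exists a.+1, b; split; [lia| |exact: rchain_widen cb].
apply: (rchain_rcons ca); split=> //.
move/mksubP: xa => [u [v [uU vc ex]]]; exists u.
  apply/mksubP; split=> //; have -> : u = x - v by rewrite ex addrK.
  by apply: submod_subr => //; apply: sn.
apply: contra xnc => /mksubP[_ uc].
by rewrite ex rpredD.
Qed.

Lemma rlen_add V (T U S : submodClosed V) a b :
  rlen T U a -> rlen U S b -> rlen T S (a + b).
Proof.
move=> [ca ba] [cb bb]; split; first exact: rchain_cat cb.
move=> p /(rchain_split (rchain_sub ca) (rchain_sub cb))[a' [b' [-> /ba la /bb]]].
exact: leq_add.
Qed.

Lemma finlen_add V (T U S : submodClosed V) :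
  finlen T U -> finlen U S -> finlen T S.
Proof. by move=> [a ha] [b hb]; exists (a + b)%N; apply: rlen_add hb. Qed.

Lemma finlen_sub V (T S T' S' : submodClosed V) :
  finlen T S -> {subset T <= T'} -> {subset S' <= S} -> {subset T' <= S'} ->
  finlen T' S'.
Proof.
move=> [n [_ bnd]] TT SS TS'; apply: (@finlen_bound _ _ _ n) => // p cp.
by apply/bnd/(rchain_widen _ _ cp).
Qed.

Lemma lenD V (T U S : submodClosed V) :
  finlen T S -> {subset T <= U} -> {subset U <= S} ->
  len T S = (len T U + len U S)%N.
Proof.
move=> TS TU US; apply: len_rlen; apply: rlen_add; apply: lenP.
  exact: finlen_sub TS _ _ _.
by apply: finlen_sub TS _ _ _.
Qed.

Section Transfer.
Variables (V W : lmodType R) (f : {linear V -> W}).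
Variables (T S : submodClosed V) (T' S' : submodClosed W).
Hypotheses (TS : {subset T <= S}) (TS' : {subset T' <= S'}).

(** The hypotheses make f induce an injection of S / T into S' / T'. Images are enlarged by T' so
    that the new chain starts above T'. *)
Lemma rchain_inj n :
  (forall v, v \in S -> f v \in S') ->
  (forall v, v \in S -> f v \in T' -> v \in T) ->
  rchain T S n -> rchain T' S' n.
Proof.
move=> fS fT.
apply: (rchain_map (F := fun U => addsub (imsub f (capsub U S)) T')).
  move=> U TU US; split; first exact: addsubr.
  by apply: addsub_sub => // _ /mksubP[x /mksubP[_ xS] ->]; apply: fS.
move=> U U' TU US [UU [x xU' xU]]; split.
  apply: addsub_sub; last exact: addsubr.
  move=> _ /mksubP[z /mksubP[zU zS] ->]; apply/addsubl/mem_imsub/mksubP.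
  by split=> //; apply: UU.
exists (f x).
  by apply/addsubl/mem_imsub/mksubP; split=> //; apply: US.
apply: contra xU => /mksubP[_ [t [/mksubP[u /mksubP[uU uS] ->] tT' fx]]].
have : x - u \in T.
  apply: fT; first by apply: submod_subr => //; apply: US.
  by rewrite linearB fx [f u + t]addrC addrK.
by move/TU => xu; rewrite -[x](subrK u) rpredD.
Qed.

(** Here f induces a surjection of S / T onto S' / T', and a chain is pulled back by inverse
    images. *)
Lemma rchain_surj n :
  (forall v, v \in T -> f v \in T') ->
  (forall w, w \in S' -> exists2 v, v \in S & f v - w \in T') ->
  rchain T' S' n -> rchain T S n.
Proof.
move=> fT fS.
apply: (rchain_map (F := fun U => capsub (presub f U) S)).
  move=> U TU US; split; last by move=> x /mksubP[].
  by move=> x xT; apply/mksubP; split; [apply/mksubP/TU/fT | apply: TS].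
move=> U U' TU US [UU [y yU' yU]]; split.
  by move=> x /mksubP[/mksubP xU xS]; apply/mksubP; split=> //; apply/mksubP/UU.
have [v vS vy] := fS y (US y yU').
exists v.
  apply/mksubP; split=> //; apply/mksubP.
  by rewrite -[f v](subrK y) rpredD // ; apply/UU/TU.
apply: contra yU => /mksubP[/mksubP vU _].
by rewrite -[y](subKr (f v)) submod_subr //; apply: TU.
Qed.

Lemma len_inj :
  (forall v, v \in S -> f v \in S') ->
  (forall v, v \in S -> f v \in T' -> v \in T) ->
  finlen T' S' -> finlen T S /\ (len T S <= len T' S')%N.
Proof.
move=> fS fT [n hn].
have F : finlen T S.
  apply: (@finlen_bound _ _ _ n) => // p cp.
  by apply: hn.2; apply: rchain_inj cp.
split=> //; rewrite (len_rlen hn); apply: hn.2.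
by apply: rchain_inj (proj1 (lenP F)).
Qed.

Lemma len_surj :
  (forall v, v \in T -> f v \in T') ->
  (forall w, w \in S' -> exists2 v, v \in S & f v - w \in T') ->
  finlen T S -> finlen T' S' /\ (len T' S' <= len T S)%N.
Proof.
move=> fT fS [n hn].
have F : finlen T' S'.
  apply: (@finlen_bound _ _ _ n) => // p cp.
  by apply: hn.2; apply: rchain_surj cp.
split=> //; rewrite (len_rlen hn); apply: hn.2.
by apply: rchain_surj (proj1 (lenP F)).
Qed.

Lemma rlen_iso n :
  (forall v, v \in S -> f v \in S') ->
  (forall v, v \in S -> (f v \in T') = (v \in T)) ->
  (forall w, w \in S' -> exists2 v, v \in S & f v - w \in T') ->
  rlen T S n <-> rlen T' S' n.
Proof.
move=> fS fT sf.
have i p : rchain T S p <-> rchain T' S' p.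
  split; first by apply: rchain_inj => // v /fT ->.
  by apply: rchain_surj => // v vT; rewrite fT ?TS.
by split=> -[/i c b]; split=> // p /i/b.
Qed.

Lemma len_iso :
  (forall v, v \in S -> f v \in S') ->
  (forall v, v \in S -> (f v \in T') = (v \in T)) ->
  (forall w, w \in S' -> exists2 v, v \in S & f v - w \in T') ->
  len T S = len T' S'.
Proof.
move=> fS fT sf; have i n := @rlen_iso n fS fT sf.
rewrite /len; case: pselect => [h|nh]; case: pselect => [h'|nh'] //.
- by apply: (rlen_uniq (projT2 (cid h))); apply/i; apply: projT2 (cid h').
- by case: nh'; case: h => n /i; exists n.
- by case: nh; case: h' => n /i; exists n.
Qed.

End Transfer.

Lemma has_length_subquot V (T S : submodClosed V) n : {subset T <= S} ->
  rlen T S n <-> has_length (subquot S T) n.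
Proof.
move=> TS.
have c1 p : rchain T S p -> submod_chain (subquot S T) p.
  move=> [c [ch cs]].
  pose P i (z : subquot S T) :=
    exists2 x : submod S, val x \in c i & z = qpi _ x.
  have hP i : submod_prop (P i).
    split=> [|a _ _ [x xc ->] [y yc ->]].
      by exists 0; rewrite ?raddf0 ?rpred0.
    exists (a *: x + y); last by rewrite linearP.
    by rewrite linearP rpredD ?rpredZ.
  exists (fun i => mksub (hP i)) => i lin.
  have [ss [x xc xnc]] := cs i lin.
  have [h1 _] := ch i (ltnW lin); have [_ h2] := ch i.+1 lin.
  split.
    move=> _ /mksubP[y yc ->]; apply/mksubP; exists y => //; exact: ss.
  have xS := h2 x xc.
  exists (qpi _ (Sub x xS : submod S)).
    by apply/mksubP; exists (Sub x xS) => //; rewrite SubK.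
  apply: contra xnc => /mksubP[y yc /qpiP xy].
  have {xy} /h1 xy : x - val y \in T.
    by have := xy : val (Sub x xS - y) \in T; rewrite raddfB.
  by rewrite -[x](subrK (val y)) rpredD.
have c2 p : submod_chain (subquot S T) p -> rchain T S p.
  move=> [d ds].
  pose P i (x : V) := exists2 y : submod S, qpi _ y \in d i & x = val y.
  have hP i : submod_prop (P i).
    split=> [|a _ _ [x xc ->] [y yc ->]].
      by exists 0; rewrite ?raddf0 ?rpred0.
    exists (a *: x + y); last by rewrite linearP.
    by rewrite linearP rpredD ?rpredZ.
  exists (fun i => mksub (hP i)); split=> i lin.
    split; last by move=> _ /mksubP[y _ ->]; exact: valP.
    move=> x xT; apply/mksubP; exists (Sub x (TS x xT)); last by rewrite SubK.
    suff -> : qpi (trace_inp T : submodClosed (submod S)) (Sub x (TS x xT)) = 0.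
      exact: rpred0.
    rewrite -[RHS](raddf0 (qpi (trace_inp T : submodClosed (submod S)))).
    by apply/qpiP; rewrite subr0.
  have [ss [z zc znc]] := ds i lin; split.
    by move=> _ /mksubP[y yc ->]; apply/mksubP; exists y => //; exact: ss.
  exists (val (qrepr z)).
    by apply/mksubP; exists (qrepr z) => //; rewrite qreprK.
  apply: contra znc => /mksubP[y yc /val_inj e].
  by rewrite -[z]qreprK e.
by split=> -[c b]; split; [exact: c1|move=> p /c2/b|exact: c2|move=> p /c1/b].
Qed.

End RelativeLength.

Definition mklin (R : comNzRingType) (U V : lmodType R) (f : U -> V)
  (lf : linear f) : {linear U -> V} :=
  HB.pack f (GRing.isLinear.Build R U V *:%R f lf).

Lemma mklinE (R : comNzRingType) (U V : lmodType R) (f : U -> V)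
  (lf : linear f) : mklin lf =1 f.
Proof. by []. Qed.

(** * Self-injectivity of a short Gorenstein ring *)

Section IdealMembership.
Variables (R : comNzRingType) (I : submodClosed R^o).

Lemma mem_ideal0 : (0 : R) \in I. Proof. exact: rpred0. Qed.

Lemma mem_idealD (a b : R) : a \in I -> b \in I -> a + b \in I.
Proof. exact: rpredD. Qed.

Lemma mem_mull (a b : R) : b \in I -> a * b \in I.
Proof. by move=> bI; exact: (@rpredZ R R^o I a b bI). Qed.

Lemma mem_mulr (a b : R) : a \in I -> a * b \in I.
Proof. by rewrite mulrC; apply: mem_mull. Qed.

Lemma mem_idealN (a : R) : a \in I -> - a \in I.
Proof. by move=> aI; rewrite -mulN1r mem_mull. Qed.

Lemma mem_idealB (a b : R) : a \in I -> b \in I -> a - b \in I.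
Proof. by move=> aI bI; rewrite mem_idealD ?mem_idealN. Qed.

Lemma mem_ideal_sum (J : finType) (F : J -> R) :
  (forall j, F j \in I) -> \sum_j F j \in I.
Proof.
by move=> h; elim/big_ind: _ => // [|a b]; [exact: mem_ideal0|exact: mem_idealD].
Qed.

End IdealMembership.

Lemma scaler_subDr (R : comNzRingType) (V : lmodType R) (t a b : R) (u v y : V) :
  t *: u + v - (t * a + b) *: y = t *: (u - a *: y) + (v - b *: y).
Proof. by rewrite scalerBr scalerDl scalerA opprD addrACA. Qed.

Section MaximalIdeal.
Variables (R : comNzRingType) (m : submodClosed R^o).
Hypothesis localR : local_ring m.
Hypothesis m3_eq0 : ideal_mul m (ideal_mul m m) =i pred1 0.

Lemma mem_ideal_mul (I J : submodClosed R^o) (a b : R) :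
  a \in I -> b \in J -> a * b \in ideal_mul I J.
Proof. by move=> aI bJ; apply: mem_sub_span; exists a, b. Qed.

Lemma m_m2 (a b : R) : a \in m -> b \in ideal_mul m m -> a * b = 0.
Proof.
by move=> am bm; apply/eqP; rewrite -[_ == 0]/(_ \in pred1 0) -m3_eq0 mem_ideal_mul.
Qed.

Lemma m_mul3 (a b c : R) : a \in m -> b \in m -> c \in m -> a * (b * c) = 0.
Proof. by move=> am bm cm; apply: m_m2 => //; apply: mem_ideal_mul. Qed.

Lemma m_proper : (1 : R^o) \notin m. Proof. exact: localR.1.1. Qed.

Lemma m_unit (r : R) : r \notin m -> exists s, s * r = 1.
Proof.
move=> rm; pose P (y : R^o) := exists a s : R, a \in m /\ y = a + s * r.
have hP : submod_prop P.
  split=> [|t _ _ [a [s [am ->]]] [b [s' [bm ->]]]].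
    by exists 0, 0; rewrite mem_ideal0 mul0r addr0.
  exists (t * a + b), (t * s + s'); rewrite mem_idealD ?mem_mull //; split=> //.
  by rewrite /GRing.scale /=; ring.
have mJ : {subset m <= mksub hP}.
  by move=> a am; apply/mksubP; exists a, 0; rewrite mul0r addr0.
have rJ : (r : R^o) \in mksub hP.
  by apply/mksubP; exists 0, 1; rewrite mem_ideal0 mul1r add0r.
have [prJ|] := boolP ((1 : R^o) \in mksub hP); last first.
  by move=> prJ; rewrite (localR.1.2 _ prJ mJ) (negPf rm) in rJ.
(* Here s r = 1 - a with a in m, and m^3 = 0 cuts the geometric series inverting 1 - a after a^2. *)
move/mksubP: prJ => [a [s [am e1]]]; exists ((1 + a + a * a) * s).
rewrite -mulrA; have -> : s * r = 1 - a by rewrite e1 addrC addKr.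
have <- : 1 - a * (a * a) = (1 + a + a * a) * (1 - a) by ring.
by rewrite m_mul3 // subr0.
Qed.

End MaximalIdeal.

(* [P] is propagated along a filtration with successive quotients generated by
   one element that is killed by the maximal ideal. *)
Section RadicalInduction.
Variables (R : comNzRingType) (m : submodClosed R^o) (e : nat) (xs : 'I_e -> R).
Hypothesis xsm : forall c, xs c \in m.
Hypothesis mul3 :
  forall a b c : R, a \in m -> b \in m -> c \in m -> a * (b * c) = 0.
Hypothesis mgen : forall a : R, a \in m -> exists (r : 'I_e -> R)
  (t : 'I_e -> 'I_e -> R),
  a = \sum_c r c * xs c + \sum_c \sum_d t c d * (xs c * xs d).
Variable V : lmodType R.

Fact addelt_prop (S : submodClosed V) (y : V) :
  submod_prop (fun v => exists a : R, v - a *: y \in S).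
Proof.
split=> [|t u v [a ua] [b vb]]; first by exists 0; rewrite scale0r subr0 rpred0.
exists (t * a + b).
by rewrite scaler_subDr rpredD ?rpredZ.
Qed.
Definition addelt S y := mksub (addelt_prop S y).

Lemma addelt_sub (S : submodClosed V) y : {subset S <= addelt S y}.
Proof. by move=> v vS; apply/mksubP; exists 0; rewrite scale0r subr0. Qed.

Lemma mem_addelt (S : submodClosed V) y : y \in addelt S y.
Proof. by apply/mksubP; exists 1; rewrite scale1r subrr rpred0. Qed.

Variable P : submodClosed V -> Prop.
Hypothesis Padd : forall S y, P S ->
  (forall a : R, a \in m -> a *: y \in S) -> P (addelt S y).

Lemma radical_fold (l : seq V) S : P S ->
  (forall z, z \in l -> forall a : R, a \in m -> a *: z \in S) ->
  exists S', [/\ P S', {subset S <= S'} & {subset l <= S'}].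
Proof.
elim: l S => [|y l IH] S PS h; first by exists S; split.
have [|S' [PS' SS' lS']] := IH S PS.
  by move=> z zl; apply: h; rewrite inE zl orbT.
exists (addelt S' y); split.
- apply: Padd => // a am; apply/SS'/h => //; exact: mem_head.
- by move=> v /SS'; apply: addelt_sub.
- move=> z; rewrite inE => /orP[/eqP ->|/lS']; first exact: mem_addelt.
  exact: addelt_sub.
Qed.

Lemma radical_step S y : P S ->
  exists S', [/\ P S', {subset S <= S'} & y \in S'].
Proof.
move=> PS.
(* The layers m^2 y, m y and y are adjoined in this order: as m^3 = 0, each is killed by m modulo
   the preceding ones. *)
pose l1 := [seq (xs cd.1 * xs cd.2) *: y | cd : 'I_e * 'I_e].
pose l2 := [seq xs c *: y | c : 'I_e].
have [|S1 [P1 SS1 l1S]] := @radical_fold l1 S PS.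
  move=> _ /mapP[[c d] _ ->] a am.
  by rewrite scalerA mul3 // scale0r rpred0.
have xx c d : (xs c * xs d) *: y \in S1.
  by apply: l1S; apply/mapP; exists (c, d); rewrite // mem_enum.
have [|S2 [P2 SS2 l2S]] := @radical_fold l2 S1 P1.
  move=> _ /mapP[c _ ->] a /mgen[r [t ->]]; rewrite scalerA mulrDl.
  have -> : (\sum_c0 \sum_d t c0 d * (xs c0 * xs d)) * xs c = 0.
    rewrite mulr_suml big1 // => c0 _; rewrite mulr_suml big1 // => d _.
    by rewrite -!mulrA (mul3 (xsm c0) (xsm d) (xsm c)) mulr0.
  rewrite addr0 mulr_suml scaler_suml rpred_sum // => d _.
  by rewrite -mulrA -scalerA rpredZ.
have x1 c : xs c *: y \in S2.
  by apply: l2S; apply/mapP; exists c; rewrite // mem_enum.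
have [|S3 [P3 SS3 l3S]] := @radical_fold [:: y] S2 P2.
  move=> z; rewrite inE => /eqP -> a /mgen[r [t ->]].
  rewrite scalerDl rpredD //.
    by rewrite scaler_suml rpred_sum // => c _; rewrite -scalerA rpredZ.
  rewrite scaler_suml rpred_sum // => c _; rewrite scaler_suml rpred_sum // => d _.
  by rewrite -scalerA rpredZ // SS2.
exists S3; split=> //; last by apply: l3S; rewrite mem_head.
by move=> v /SS1/SS2/SS3.
Qed.

Lemma radical_ind (s : seq V) S : P S ->
  exists S', [/\ P S', {subset S <= S'} & {subset s <= S'}].
Proof.
elim: s S => [|y s IH] S PS; first by exists S; split.
have [S1 [P1 SS1 yS1]] := @radical_step S y PS.
have [S2 [P2 SS2 sS2]] := IH S1 P1.
exists S2; split=> //; first by move=> v /SS1/SS2.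
by move=> z; rewrite inE => /orP[/eqP ->|/sS2] //; apply: SS2.
Qed.

Lemma radical_gen (s : seq V) S :
  (forall v : V, v \in Defs.sub_span (fun y : V => y \in s)) -> P S ->
  exists S', [/\ P S', {subset S <= S'} & forall v, v \in S'].
Proof.
move=> gs PS; have [S' [PS' SS' sS']] := radical_ind s PS.
exists S'; split=> // v; have /asboolP[l [ls ->]] := gs v.
by rewrite big_seq rpred_sum // => p /ls/sS' ?; rewrite rpredZ.
Qed.

End RadicalInduction.

(** * A Baer criterion that tests only the maximal ideal *)

Section Baer.
Variables (R : comNzRingType) (m : submodClosed R^o) (e : nat) (xs : 'I_e -> R).
Hypothesis xsm : forall c, xs c \in m.
Hypothesis mul3 :
  forall a b c : R, a \in m -> b \in m -> c \in m -> a * (b * c) = 0.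
Hypothesis mgen : forall a : R, a \in m -> exists (r : 'I_e -> R)
  (t : 'I_e -> 'I_e -> R),
  a = \sum_c r c * xs c + \sum_c \sum_d t c d * (xs c * xs d).
Hypothesis m_unit : forall r : R, r \notin m -> exists s, s * r = 1.

(* Ext^1(R/m, C) = 0 *)
Definition extends_from_m (C : lmodType R) := forall g : R -> C,
  (forall r a b : R, a \in m -> b \in m -> g (r * a + b) = r *: g a + g b) ->
  exists c, forall a : R, a \in m -> g a = a *: c.

(** Such a G is the graph of a linear map to C from a submodule of V, namely the first projection of
    G. *)
Definition functional_graph (V C : lmodType R) (G : submodClosed (V * C)%type) :=
  forall c, (0, c) \in G -> c = 0.

Lemma functional_graph_uniq (V C : lmodType R) (G : submodClosed (V * C)%type) v c c' :
  functional_graph G -> (v, c) \in G -> (v, c') \in G -> c = c'.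
Proof.
move=> fG h h'; apply/eqP; rewrite -subr_eq0; apply/eqP/fG.
by have := submod_subr h h'; rewrite -[_ - _]/(v - v, c - c') subrr.
Qed.

Lemma graph_lin (V C : lmodType R) (G : submodClosed (V * C)%type) a v w c d :
  (v, c) \in G -> (w, d) \in G -> (a *: v + w, a *: c + d) \in G.
Proof.
move=> h h'; rewrite -[(_, _)]/(a *: (v, c) + (w, d)).
by rewrite rpredD ?rpredZ.
Qed.

(** V is reached from the domain of the partial map by adjoining elements y with m y already
    covered; Ext^1(R/m, C) = 0 is exactly what extends the map by one such y. *)
Lemma baer_extension (V C : lmodType R) (G : submodClosed (V * C)%type) :
  extends_from_m C -> fg_module V -> functional_graph G ->
  exists f : {linear V -> C}, forall v c, (v, c) \in G -> f v = c.
Proof.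
move=> DC [s gs] fG.
pose P (S : submodClosed V) := exists G' : submodClosed (V * C)%type,
  [/\ {subset G <= G'}, functional_graph G' &
      forall v, v \in S -> exists c, (v, c) \in G'].
have P0 : P zerosub.
  exists G; split=> // v /mksubP ->; exists 0.
  by rewrite -[(0, 0)]/(0 : V * C) rpred0.
have PS S y : P S -> (forall a : R, a \in m -> a *: y \in S) -> P (addelt S y).
  move=> [G1 [GG1 fG1 domS]] my.
  have [[c0 yc0]|ndom] := pselect (exists c, (y, c) \in G1).
    exists G1; split=> // v /mksubP[a /domS[c vc]]; exists (a *: c0 + c).
    by rewrite -[v](subrKC (a *: y)) graph_lin.
  have ex (a : R) : exists c, a \in m -> (a *: y, c) \in G1.
    have [am|] := boolP (a \in m); last by exists 0.
    by have [c ?] := domS _ (my a am); exists c.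
  pose g a := projT1 (cid (ex a)).
  have gP a : a \in m -> (a *: y, g a) \in G1 := projT2 (cid (ex a)).
  (* The map [g] sends a in m to the value of the partial map at a y; extending it to R supplies the
     value c' to be given to y. *)
  have [r a b am bm|c' gc'] := DC g.
    have rab : r * a + b \in m by rewrite mem_idealD ?mem_mull.
    apply: (functional_graph_uniq fG1 (gP _ rab)).
    by rewrite scalerDl -scalerA graph_lin ?gP.
  pose Q (p : V * C) := exists r : R, (p.1 - r *: y, p.2 - r *: c') \in G1.
  have hQ : submod_prop Q.
    split=> [|a [v1 c1] [v2 c2] [r1 h1] [r2 h2]].
      by exists 0; rewrite !scale0r !subr0 -[(_, _)]/(0 : V * C) rpred0.
    by exists (a * r1 + r2); have := graph_lin a h1 h2; rewrite /= !scaler_subDr.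
  exists (mksub hQ); split.
  - move=> [v c] /GG1 vc; apply/mksubP; exists 0.
    by rewrite !scale0r !subr0.
  - move=> c /mksubP[r] /=; rewrite sub0r => h.
    (* A unit r would put y in the domain of G1, which [ndom] excludes; for r in m the choice of c'
       agrees with G1. *)
    have [rm|/m_unit[t tr]] := boolP (r \in m); last first.
      case: ndom; exists ((- t) *: (c - r *: c') + 0).
      have := graph_lin (- t) h (rpred0 G1 : (0, 0) \in G1).
      by rewrite scaleNr scalerN opprK scalerA tr scale1r addr0.
    apply: fG1; have := graph_lin 1 h (gP r rm).
    by rewrite gc' // !scale1r addNr subrK.
  - move=> v /mksubP[r /domS[c vc]]; exists (c + r *: c'); apply/mksubP.
    by exists r; rewrite /= addrK.
have [S [[G1 [GG1 fG1 dom]] _ Sall]] := radical_gen xsm mul3 mgen PS gs P0.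
pose f v := projT1 (cid (dom v (Sall v))).
have fP v : (v, f v) \in G1 := projT2 (cid (dom v (Sall v))).
have lf : linear f.
  by move=> a u v; apply: (functional_graph_uniq fG1 (fP _)); rewrite graph_lin.
exists (mklin lf) => v c vc; rewrite mklinE.
by apply: (functional_graph_uniq fG1 (fP _)); apply: GG1.
Qed.

Lemma fg_regular : fg_module (R^o : lmodType R).
Proof.
exists [:: 1] => v; apply/asboolP; exists [:: (v, 1)]; split=> [p|].
  by rewrite inE => /eqP ->; rewrite mem_head.
by rewrite big_seq1 /GRing.scale /= mulr1.
Qed.

Variable x : R.
Hypothesis xm : x \in m.
Hypothesis xsoc : forall a : R, a \in m -> a * x = 0.
Hypothesis xann : forall a : R, a * x = 0 -> a \in m.

(** R x is a copy of R/m, so r x -> r c is well defined on it; d is the value at 1 of an extension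
    to R. *)
Lemma divisible_by_soc (C : lmodType R) (c : C) : extends_from_m C ->
  (forall a : R, a \in m -> a *: c = 0) -> exists d, x *: d = c.
Proof.
move=> DC mc.
pose Q (p : R^o * C) := exists r : R, p.1 = r * x /\ p.2 = r *: c.
have hQ : submod_prop Q.
  split=> [|a [v1 c1] [v2 c2] [r1 [/= -> ->]] [r2 [/= -> ->]]].
    by exists 0; rewrite mul0r scale0r.
  exists (a * r1 + r2); rewrite /= mulrDl scalerDl -scalerA -mulrA.
  by split.
have [|f fP] := @baer_extension R^o C (mksub hQ) DC fg_regular.
  move=> d /mksubP[r [/= /esym rx ->]]; apply: mc; exact: xann.
exists (f 1); rewrite -linearZZ.
apply: fP; apply/mksubP; exists 1; rewrite mul1r scale1r; split=> //=.
by rewrite /GRing.scale /= mulr1.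
Qed.

(** The vanishing of Ext^1(R/m, -) is carried down the cosyzygies [C j] = ker (d j) of a finite
    injective resolution, from zero modules beyond n to [C 0], a copy of R. *)
Lemma gorenstein_selfinj : gorenstein R -> extends_from_m R^o.
Proof.
move=> [n [I [eta [d [injI ieta ex0 ex triv]]]]].
pose C j : lmodType R := submod (ker (d j)).
have step j : extends_from_m (C j.+1) -> extends_from_m (C j).
  move=> DC g lg.
  pose vC k : {linear C k -> I k} := submod_val (ker (d k)).
  have lh : linear (fun a : submod m => vC j (g (submod_val m a))).
    move=> r a b; rewrite linearP [_ *: submod_val m a]/(_ * _).
    by rewrite lg ?linearP //; exact: submod_valP.
  have [F hF] := injI j (submod m) R^o (submod_val m) (mklin lh)
    (@submod_val_inj _ _ m).
  pose i := F 1.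
  have gi (a : R) : a \in m -> vC j (g a) = a *: i.
    move=> am; have <- : F a = vC j (g a) := hF (submod_mk am).
    by rewrite -linearZZ /GRing.scale /= mulr1.
  have dik : d j i \in ker (d j.+1) by apply/kerP/ex; exists i.
  (* Since a i is a cycle for a in m, d i is killed by m and hence divisible by x, say d i = d (x
     w). Replacing i by i - x w changes no a i, because a x = 0. *)
  have [a am|c' xc'] := @divisible_by_soc (C j.+1) (submod_mk dik) DC.
    apply: submod_val_inj; rewrite linearZZ submod_mkK -linearZZ -gi // linear0.
    by apply/kerP; exact: submod_valP.
  have [w dw] := proj1 (ex j (vC _ c')) (elimT (kerP _ _) (submod_valP c')).
  have ik : i - x *: w \in ker (d j).
    apply/kerP; rewrite linearB linearZZ dw; apply/eqP; rewrite subr_eq0.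
    by move/(congr1 (vC _)): xc'; rewrite linearZZ => ->.
  exists (submod_mk ik) => a am; apply: submod_val_inj.
  rewrite linearZZ submod_mkK [LHS]gi // scalerBr scalerA xsoc // scale0r.
  by rewrite subr0.
have base j : (n < j)%N -> extends_from_m (C j).
  move=> nj g _; exists 0 => a _; apply: submod_val_inj.
  by rewrite [LHS](triv j) // [RHS](triv j).
have D0 : extends_from_m (C 0%N).
  have : extends_from_m (C n.+1) by apply: base.
  by elim: n.+1 => // k IH /step/IH.
move=> g lg.
have ek (a : R) : eta (g a) \in ker (d 0%N) by apply/kerP/ex0; exists (g a).
have [r a b am bm|c gc] := D0 (fun a => submod_mk (ek a)).
  by apply: submod_val_inj; rewrite linearP !submod_mkK lg // linearP.
have [y ey] := proj1 (ex0 (submod_val _ c)) (elimT (kerP _ _) (submod_valP c)).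
exists y => a am; apply: ieta; rewrite linearZZ ey.
by have := congr1 (submod_val _) (gc a am); rewrite linearZZ.
Qed.

End Baer.

Section TraceForm.
Variable R : comNzRingType.

(** The standard symmetric form on R^(p q). Multiplications by a matrix and by its transpose are
    adjoint for it, and every functional on matrices is the form with a fixed matrix. *)
Definition trform p q (A B : 'M[R]_(p, q)) : R := \tr (A^T *m B).

Lemma trform_sym p q (A B : 'M[R]_(p, q)) : trform A B = trform B A.
Proof. by rewrite /trform -mxtrace_tr trmx_mul trmxK. Qed.

Lemma trformMl p q n (P : 'M[R]_(n, p)) (A : 'M[R]_(p, q)) B :
  trform (P *m A) B = trform A (P^T *m B).
Proof. by rewrite /trform trmx_mul mulmxA. Qed.

Lemma trformMr p q n (A : 'M[R]_(p, q)) (Q : 'M[R]_(q, n)) B :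
  trform (A *m Q) B = trform A (B *m Q^T).
Proof. by rewrite /trform trmx_mul -mulmxA mxtrace_mulC mulmxA. Qed.

Lemma trformE p q (A B : 'M[R]_(p, q)) :
  trform A B = \sum_i \sum_j A i j * B i j.
Proof.
rewrite /trform /mxtrace exchange_big /=; apply: eq_bigr => j _.
by rewrite mxE; apply: eq_bigr => i _; rewrite mxE.
Qed.

Lemma trform_linl p q (a : R) (A A' B : 'M[R]_(p, q)) :
  trform (a *: A + A') B = a * trform A B + trform A' B.
Proof. by rewrite /trform linearP mulmxDl -scalemxAl linearP. Qed.

Lemma trform_linr p q (a : R) (A A' B : 'M[R]_(p, q)) :
  trform B (a *: A + A') = a * trform B A + trform B A'.
Proof. by rewrite !(trform_sym B) trform_linl. Qed.

Lemma trform_delta p q (A : 'M[R]_(p, q)) i j : trform A (delta_mx i j) = A i j.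
Proof.
rewrite trformE (bigD1 i) //= (bigD1 j) //= mxE !eqxx mulr1 !big1 ?addr0 //.
  move=> k /negPf ki; rewrite big1 // => l _.
  by rewrite mxE ki mulr0.
by move=> l /negPf lj; rewrite mxE lj andbF mulr0.
Qed.

Lemma trform_eq0 p q (A : 'M[R]_(p, q)) : (forall B, trform B A = 0) -> A = 0.
Proof.
by move=> h; apply/matrixP => i j; rewrite mxE -trform_delta trform_sym h.
Qed.

Lemma trform0r p q (A : 'M[R]_(p, q)) : trform A 0 = 0.
Proof. by rewrite trformE big1 // => i _; rewrite big1 // => j _; rewrite mxE mulr0. Qed.

Lemma trform_scale p q (a : R) (A B : 'M[R]_(p, q)) :
  trform (a *: A) B = trform A (a *: B).
Proof.
rewrite !trformE; apply: eq_bigr => i _; apply: eq_bigr => j _.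
by rewrite !mxE mulrCA mulrA.
Qed.

Lemma fg_matrix p q : fg_module ('M[R]_(p, q)).
Proof.
exists [seq delta_mx ij.1 ij.2 | ij : 'I_p * 'I_q] => v.
rewrite (matrix_sum_delta v) rpred_sum // => i _; rewrite rpred_sum // => j _.
rewrite rpredZ //; apply: mem_sub_span; apply/mapP.
by exists (i, j); rewrite // mem_enum.
Qed.

End TraceForm.

(* [m] is the maximal ideal and [x] spans the socle [m ^ 2]; [xs] lifts a basis
   of [m / m ^ 2] and [xd] its dual basis for the pairing
   [m / m ^ 2 * m / m ^ 2 -> m ^ 2]. *)
Record short_gorenstein (R : comNzRingType) (m : submodClosed R^o) (e : nat)
    (xs xd : 'I_e -> R) (x : R) : Prop := ShortGorenstein {
  sg_xs : forall c, xs c \in m;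
  sg_xd : forall c, xd c \in m;
  sg_x : x \in m;
  sg_mx : forall a : R, a \in m -> a * x = 0;
  sg_ann : forall a : R, a * x = 0 -> a \in m;
  sg_mm : forall a b : R, a \in m -> b \in m -> exists r, a * b = r * x;
  sg_soc : forall a : R, (forall b : R, b \in m -> b * a = 0) ->
    exists r, a = r * x;
  sg_dual : forall c d, xs c * xd d = (c == d)%:R * x;
  sg_gen : forall a : R, a \in m -> exists (r : 'I_e -> R) t,
    a = \sum_c r c * xs c + t * x;
  sg_unit : forall r : R, r \notin m -> exists s, s * r = 1;
  sg_proper : (1 : R^o) \notin m;
  sg_sep : forall p q (S : submodClosed 'M[R]_(p, q)) v, v \notin S ->
    exists2 w, (forall s, s \in S -> trform s w = 0) & trform v w != 0;
  sg_finlen : forall V : lmodType R, fg_module V ->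
    finlen (zerosub : submodClosed V) fullsub;
  sg_e : (2 < e)%N }.

(** * Finite length, separation by functionals, and the socle *)

Section FiniteLength.
Variables (R : comNzRingType) (m : submodClosed R^o).
Hypothesis m_unit : forall r : R, r \notin m -> exists s, s * r = 1.

(** (S + R y) / S is a quotient of R/m, whose nonzero elements all generate it. *)
Lemma addelt_rchain (V : lmodType R) (S : submodClosed V) y p :
  (forall a : R, a \in m -> a *: y \in S) -> rchain S (addelt S y) p ->
  (p <= 1)%N.
Proof.
move=> my [c [ch cs]]; rewrite leqNgt; apply/negP => p1.
have [h0 _] := ch 0%N isT; have [h1 _] := ch 1%N (ltnW p1).
have [_ h2] := ch 2 p1.
have [s01 [u u1 u0]] := cs 0%N (ltnW p1).
have [s12 [v v2 v1]] := cs 1%N p1.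
have /mksubP[a ua] : u \in addelt S y by apply/h2/s12.
have am : a \notin m.
  apply: contra u0 => /my ay; apply: h0.
  by rewrite -[u](subrK (a *: y)) rpredD.
have [t ta] := m_unit am.
have y1 : y \in c 1%N.
  have -> : y = t *: u - t *: (u - a *: y).
    by rewrite scalerBr scalerA ta scale1r subKr.
  by apply: submod_subr; apply: rpredZ => //; exact: h1.
have /mksubP[b vb] := h2 v v2.
case/negP: v1; rewrite -[v](subrK (b *: y)) rpredD ?rpredZ //.
exact: h1.
Qed.

Lemma addelt_finlen (V : lmodType R) (S : submodClosed V) y :
  (forall a : R, a \in m -> a *: y \in S) -> finlen S (addelt S y).
Proof.
move=> my; apply: (@finlen_bound _ _ _ _ 1); first exact: addelt_sub.
by move=> p; exact: addelt_rchain.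
Qed.

End FiniteLength.

Section SocleGenerator.
Variables (R : comNzRingType) (m : submodClosed R^o) (e : nat) (xs : 'I_e -> R).
Hypothesis xsm : forall c, xs c \in m.
Hypothesis mul3 :
  forall a b c : R, a \in m -> b \in m -> c \in m -> a * (b * c) = 0.
Hypothesis mgen : forall a : R, a \in m -> exists (r : 'I_e -> R)
  (t : 'I_e -> 'I_e -> R),
  a = \sum_c r c * xs c + \sum_c \sum_d t c d * (xs c * xs d).
Hypothesis m_unit : forall r : R, r \notin m -> exists s, s * r = 1.
Variable x : R.
Hypothesis xsoc : forall a : R, a \in m -> a * x = 0.
Hypothesis xn0 : x <> 0.
Hypothesis selfinj : extends_from_m m R^o.

Lemma finlen_fg (V : lmodType R) : fg_module V ->
  finlen (zerosub : submodClosed V) fullsub.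
Proof.
move=> [s gs].
have [||S [fS _ all]] := radical_gen (P := fun S => finlen zerosub S)
    xsm mul3 mgen _ gs (S := zerosub).
- move=> S y fS my; apply: finlen_add fS _; exact: (addelt_finlen m_unit).
- exists 0%N; split; first exact: rchain0.
  move=> [|p] // [c [ch cs]]; have [_ [v v1 v0]] := cs 0%N isT.
  have [h0 _] := ch 0%N isT; have [_ h1] := ch 1%N isT.
  by case/negP: v0; apply: h0; apply: h1.
apply: finlen_sub fS _ _ _ => // v /mksubP ->; exact: rpred0.
Qed.

Lemma ann_soc (a : R) : a * x = 0 -> a \in m.
Proof.
move=> ax; apply/negPn/negP => /m_unit[s sa]; apply: xn0.
by rewrite -[x]mul1r -sa -mulrA ax mulr0.
Qed.

(** A multiple u = a v spans a copy of R/m modulo S. The map S + R u -> R x that kills S and sends u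
    to x extends to all matrices by [baer_extension], and its values on the matrix units form w. *)
Lemma separation p q (S : submodClosed 'M[R]_(p, q)) v : v \notin S ->
  exists2 w, (forall s, s \in S -> trform s w = 0) & trform v w != 0.
Proof.
move=> vS.
(* As m^3 = 0, it is enough to multiply v by 1, by an element of m, or by a product of two such
   elements. *)
have [a avS mav] : exists2 a : R, a *: v \notin S &
    forall b : R, b \in m -> b *: (a *: v) \in S.
  have [h|/existsNP[a /not_implyP[am /negP av]]] :=
      pselect (forall a : R, a \in m -> a *: v \in S).
    by exists 1; rewrite scale1r.
  have [h|/existsNP[b /not_implyP[bm /negP bv]]] :=
      pselect (forall b : R, b \in m -> b *: (a *: v) \in S).
    by exists a.
  exists (b * a); first by rewrite -scalerA.
  by move=> c cm; rewrite scalerA mul3 // scale0r rpred0.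
pose V : lmodType R := 'M[R]_(p, q); pose u : V := a *: v.
pose Q (z : V * R^o) := exists r : R, z.1 - r *: u \in S /\ z.2 = r * x.
have hQ : submod_prop Q.
  split=> [|t [v1 c1] [v2 c2] [r1 [/= h1 ->]] [r2 [/= h2 ->]]].
    by exists 0; rewrite scale0r subr0 mul0r rpred0.
  exists (t * r1 + r2); rewrite /= scaler_subDr mulrDl -mulrA.
  by rewrite rpredD ?rpredZ.
have [|f fP] := baer_extension xsm mul3 mgen m_unit selfinj (fg_matrix R p q)
    (G := mksub hQ).
  move=> c /mksubP[r [/=]]; rewrite sub0r => ru ->; apply: xsoc.
  apply/negPn/negP => /m_unit[s sr]; case/negP: avS; rewrite -/u.
  have -> : u = (- s) *: - (r *: u).
    by rewrite scaleNr scalerN opprK scalerA sr scale1r.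
  by rewrite rpredZ.
pose w : 'M[R]_(p, q) := \matrix_(i, j) f (delta_mx i j).
have fE B : f B = trform B w.
  rewrite {1}(matrix_sum_delta B) linear_sum trformE; apply: eq_bigr => i _.
  by rewrite linear_sum; apply: eq_bigr => j _; rewrite linearZZ mxE.
exists w => [s sS|].
  rewrite -fE; apply: fP; apply/mksubP; exists 0.
  by rewrite scale0r subr0 mul0r.
have : f u = x.
  by apply: fP; apply/mksubP; exists 1; rewrite scale1r subrr mul1r rpred0.
move=> fu; apply/eqP => vw; apply: xn0.
by rewrite -fu linearZZ fE vw /GRing.scale /= mulr0.
Qed.

(** Otherwise separation from R x gives w with w x = 0 and a w nonzero; the first puts w in m, which
    kills a. *)
Lemma socle_gen (a : R) : (forall b : R, b \in m -> b * a = 0) ->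
  exists r, a = r * x.
Proof.
move=> ma; apply: contrapT => nex.
have hP : submod_prop (fun A : 'M[R]_(1, 1) => exists r, A = (r * x)%:M).
  split=> [|t _ _ [r ->] [s ->]]; first by exists 0; rewrite mul0r raddf0.
  exists (t * r + s); rewrite mulrDl raddfD -mulrA; congr (_ + _).
  by rewrite scale_scalar_mx.
have [|w hw] := @separation 1 1 (mksub hP) a%:M.
  apply/mksubP => -[r /matrixP/(_ ord0 ord0)]; rewrite !mxE eqxx !mulr1n => ar.
  by apply: nex; exists r.
have tr1 (b : R) : trform b%:M w = b * w ord0 ord0.
  by rewrite trformE !big_ord1 mxE eqxx mulr1n.
rewrite tr1 mulrC ma ?eqxx //; apply: ann_soc.
rewrite mulrC -tr1; apply: hw; apply/mksubP; exists 1.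
by rewrite mul1r.
Qed.

End SocleGenerator.

Section ShortGorensteinRing.
Variables (R : comNzRingType) (m : submodClosed R^o) (e : nat).
Hypothesis localR : local_ring m.
Hypothesis gorR : gorenstein R.
Hypothesis m3_eq0 : ideal_mul m (ideal_mul m m) =i pred1 0.
Hypothesis m2_neq0 : ~ (ideal_mul m m =i pred1 0).
Hypothesis rank_e : residue_rank m (subquot m (ideal_mul m m)) e.
Hypothesis e_gt2 : (2 < e)%N.

Let m2 := ideal_mul m m.

Lemma short_gorensteinP : exists xs xd x, @short_gorenstein R m e xs xd x.
Proof.
have mul3 := m_mul3 m3_eq0; have m_unit := m_unit localR m3_eq0.
have [v [vgen vfree]] := rank_e.
pose xs c : R := submod_val m (qrepr (v c)).
have xsm c : xs c \in m by exact: submod_valP.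
pose qp : {linear submod m -> subquot m m2} :=
  qpi (trace_inp m2 : submodClosed (submod m)).
have sumE (r : 'I_e -> R) : \sum_c r c *: v c = qp (\sum_c r c *: qrepr (v c)).
  rewrite linear_sum; apply: eq_bigr => c _; rewrite linearZZ.
  by rewrite [qp _]qreprK.
have valE (r : 'I_e -> R) :
    submod_val m (\sum_c r c *: qrepr (v c)) = \sum_c r c * xs c.
  by rewrite linear_sum; apply: eq_bigr => c _; rewrite linearZZ.
have gen1 (a : R) : a \in m -> exists r : 'I_e -> R, a - \sum_c r c * xs c \in m2.
  move=> am; have [r hr] := vgen (qp (submod_mk am)).
  exists r; rewrite sumE in hr; move/qpiP: hr => h.
  have : submod_val m (submod_mk am - \sum_c r c *: qrepr (v c)) \in m2 by [].
  by rewrite linearB valE.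
have free (r : 'I_e -> R) : \sum_c r c * xs c \in m2 -> forall c, r c \in m.
  move=> h; apply: vfree; rewrite sumE -[RHS](raddf0 qp).
  by apply/qpiP; rewrite subr0 -[_ \in _]/(submod_val m _ \in m2) valE.
have m2_0 (a b : R) : a \in m -> b \in m2 -> a * b = 0 by exact: m_m2.
have prodE (a b : R) : a \in m -> b \in m -> exists t : 'I_e -> 'I_e -> R,
    a * b = \sum_c \sum_d t c d * (xs c * xs d).
  move=> am bm; have [r hr] := gen1 a am; have [s hs] := gen1 b bm.
  exists (fun c d => r c * s d).
  have -> : a * b = (\sum_c r c * xs c) * (\sum_c s c * xs c).
    have e1 : (a - \sum_c r c * xs c) * b = 0 by rewrite mulrC m2_0.
    have e2 : (\sum_c r c * xs c) * (b - \sum_c s c * xs c) = 0.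
      by rewrite m2_0 // mem_ideal_sum // => c; rewrite mem_mull.
    by move: e1 e2; rewrite mulrBl mulrBr => /subr0_eq -> /subr0_eq ->.
  rewrite big_distrlr /=; apply: eq_bigr => c _; apply: eq_bigr => d _.
  by rewrite mulrACA.
have m2E (b : R) : b \in m2 -> exists t : 'I_e -> 'I_e -> R,
    b = \sum_c \sum_d t c d * (xs c * xs d).
  move=> /asboolP[l [lG ->]].
  elim: l lG => [_|[a p] l IH lG].
    exists (fun _ _ => 0); rewrite big_nil [RHS]big1 // => c _.
    by rewrite big1 // => d _; rewrite mul0r.
  have [t1 e1] : exists t : 'I_e -> 'I_e -> R, (p : R) = \sum_c \sum_d t c d * (xs c * xs d).
    have [u [w [um wm /= ->]]] := lG (a, p) (mem_head _ _).
    exact: prodE.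
  have [|t2 e2] := IH; first by move=> q ql; apply: lG; rewrite inE ql orbT.
  exists (fun c d => a * t1 c d + t2 c d); rewrite big_cons e2 /= e1.
  rewrite /GRing.scale /= mulr_sumr -big_split; apply: eq_bigr => c _.
  rewrite mulr_sumr -big_split; apply: eq_bigr => d _ /=.
  by rewrite mulrDl -[in RHS]mulrA.
have mgen (a : R) : a \in m -> exists (r : 'I_e -> R) (t : 'I_e -> 'I_e -> R),
    a = \sum_c r c * xs c + \sum_c \sum_d t c d * (xs c * xs d).
  move=> /gen1[r /m2E[t ht]]; exists r, t.
  by rewrite -ht subrKC.
(* Any nonzero element of m^2 will do: [soc] below shows that it generates the whole socle. *)
have [x xm2 xn0] : exists2 x : R, x \in m2 & x <> 0.
  apply: contrapT => nex; apply: m2_neq0 => z; apply/idP/eqP => [zm|->].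
    by apply: contrapT => zn0; apply: nex; exists z.
  exact: rpred0.
have xm : x \in m.
  have [t ->] := m2E x xm2; rewrite mem_ideal_sum // => c.
  by rewrite mem_ideal_sum // => d; rewrite !mem_mull.
have mx (a : R) : a \in m -> a * x = 0 by move=> am; rewrite m2_0.
have ann := ann_soc m_unit xn0.
have inj : extends_from_m m R^o.
  by apply: (gorenstein_selfinj xsm mul3 mgen m_unit mx ann gorR).
have soc := socle_gen xsm mul3 mgen m_unit mx xn0 inj.
(* Coordinates modulo m^2 are determined only modulo m, so [rr] is a mere choice, but its products
   with x are canonical by [rr_uniq]. *)
have gen2 (a : R) : exists r : 'I_e -> R,
    a \in m -> a - \sum_c r c * xs c \in m2.
  have [am|] := boolP (a \in m); last by exists (fun=> 0).
  by have [r hr] := gen1 a am; exists r.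
pose rr a := projT1 (cid (gen2 a)).
have rrP a : a \in m -> a - \sum_c rr a c * xs c \in m2 := projT2 (cid (gen2 a)).
have rr_uniq (a : R) (r : 'I_e -> R) d : a \in m -> a - \sum_c r c * xs c \in m2 ->
    rr a d * x = r d * x.
  move=> am ha; have : \sum_c (rr a c - r c) * xs c \in m2.
    have -> : \sum_c (rr a c - r c) * xs c =
        (a - \sum_c r c * xs c) - (a - \sum_c rr a c * xs c).
      rewrite opprB addrC subrKA -sumrB.
      by apply: eq_bigr => c _; rewrite mulrBl.
    by rewrite mem_idealB ?rrP.
  move=> /free/(_ d)/mx; rewrite mulrBl => /eqP.
  by rewrite subr_eq0 => /eqP.
(* Sending a to x times its d-th coordinate is linear from m to R; self-injectivity makes it
   multiplication by an element, the d-th dual basis vector. *)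
have dual d : exists y : R, forall a : R, a \in m -> rr a d * x = a * y.
  have [r a b am bm|y hy] := inj (fun a => rr a d * x); last by exists y.
  rewrite (rr_uniq _ (fun c => r * rr a c + rr b c)).
  - by rewrite mulrDl /GRing.scale /= mulrA.
  - by rewrite mem_idealD ?mem_mull.
  have -> : r * a + b - \sum_c (r * rr a c + rr b c) * xs c =
      r * (a - \sum_c rr a c * xs c) + (b - \sum_c rr b c * xs c).
    rewrite mulrBr addrACA -opprD mulr_sumr -big_split /=; congr (_ - _).
    by apply: eq_bigr => c _; rewrite mulrDl mulrA.
  by rewrite mem_idealD ?mem_mull ?rrP.
pose xd d := projT1 (cid (dual d)).
have xdP d (a : R) : a \in m -> rr a d * x = a * xd d := projT2 (cid (dual d)) a.
exists xs, xd, x; split=> //.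
(* If xd c had inverse s, then x = s (x xd c) would vanish, because x lies in m^2 and has zero
   coordinates modulo m^2. *)
- move=> c; apply/negPn/negP => /m_unit[s sx]; apply: xn0.
  rewrite -[x]mulr1 -sx mulrCA -xdP // (rr_uniq _ (fun=> 0)) ?mul0r ?mulr0 //.
  by rewrite big1 ?subr0 // => d _; rewrite mul0r.
- move=> a b am bm; apply: soc => c cm; exact: mul3.
- move=> c d; rewrite -xdP // (rr_uniq _ (fun d => (c == d)%:R)) //.
  rewrite (bigD1 c) //= eqxx mul1r big1 ?addr0 ?subrr ?mem_ideal0 //.
  by move=> i /negPf ic; rewrite eq_sym ic mul0r.
- move=> a am; have [r hr] := gen1 a am.
  have [|t ht] := soc (a - \sum_c r c * xs c); first by move=> b bm; apply: m2_0.
  by exists r, t; rewrite -ht subrKC.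
- exact: m_proper.
- exact: (separation xsm mul3 mgen m_unit mx xn0 inj).
- exact: (finlen_fg xsm mul3 mgen m_unit).
Qed.

End ShortGorensteinRing.

Lemma len_ext (R : comNzRingType) (V : lmodType R) (T S T' S' : submodClosed V) :
  {subset T <= S} -> T =i T' -> S =i S' -> len T S = len T' S'.
Proof.
move=> TS eT eS; apply: (len_iso (f := idfun)) => //.
- by move=> v; rewrite -eT -eS; apply: TS.
- by move=> v; rewrite -eS.
- by move=> w wS'; exists w; rewrite ?eS //= subrr rpred0.
Qed.

(** * Matrices over the maximal ideal *)

Section IdealMatrices.
Variables (R : comNzRingType) (m : submodClosed R^o).

Fact mmx_prop p q : submod_prop (fun A : 'M[R]_(p, q) => forall i j, A i j \in m).
Proof.
split=> [i j|a A B hA hB i j]; first by rewrite mxE mem_ideal0.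
by rewrite !mxE mem_idealD ?mem_mull.
Qed.
Definition mmx p q := mksub (@mmx_prop p q).

Lemma mmxP p q (A : 'M[R]_(p, q)) :
  reflect (forall i j, A i j \in m) (A \in mmx p q).
Proof. exact: mksubP. Qed.

Lemma mmx_mull p q n (P : 'M[R]_(n, p)) (A : 'M[R]_(p, q)) :
  A \in mmx p q -> P *m A \in mmx n q.
Proof.
move=> /mmxP h; apply/mmxP => i j; rewrite mxE mem_ideal_sum // => k.
by rewrite mem_mull.
Qed.

Lemma mmx_mulr p q n (P : 'M[R]_(q, n)) (A : 'M[R]_(p, q)) :
  A \in mmx p q -> A *m P \in mmx p n.
Proof.
move=> /mmxP h; apply/mmxP => i j; rewrite mxE mem_ideal_sum // => k.
by rewrite mem_mulr.
Qed.

Lemma mmx_scale p q (a : R) (A : 'M[R]_(p, q)) : a \in m -> a *: A \in mmx p q.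
Proof. by move=> am; apply/mmxP => i j; rewrite mxE mem_mulr. Qed.

Lemma mmx_tr p q (A : 'M[R]_(p, q)) : (A^T \in mmx q p) = (A \in mmx p q).
Proof. by apply/mmxP/mmxP => h i j; have := h j i; rewrite mxE. Qed.

Lemma mmx_rows p q (A : 'M[R]_(p, q)) :
  (forall i, row i A \in mmx 1 q) -> A \in mmx p q.
Proof. by move=> h; apply/mmxP => i j; have /mmxP/(_ ord0 j) := h i; rewrite mxE. Qed.

Fact rows_in_prop p q (K : submodClosed 'rV[R]_q) :
  submod_prop (fun A : 'M[R]_(p, q) => forall i, row i A \in K).
Proof.
split=> [i|a A B hA hB i]; first by rewrite row0 rpred0.
by rewrite linearP rpredD ?rpredZ ?hA ?hB.
Qed.
Definition rows_in p q (K : submodClosed 'rV[R]_q) := mksub (@rows_in_prop p q K).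

Fact rows_in_from_prop p q (K : submodClosed 'rV[R]_q) t :
  submod_prop (fun A : 'M[R]_(p, q) => forall i : 'I_p, (t <= i)%N -> row i A \in K).
Proof.
split=> [i _|a A B hA hB i ti]; first by rewrite row0 rpred0.
by rewrite linearP rpredD ?rpredZ ?hA ?hB.
Qed.

Lemma len_rows_in p q (K : submodClosed 'rV[R]_q) :
  finlen (zerosub : submodClosed 'M[R]_(p, q)) fullsub ->
  len (rows_in p K) fullsub = (p * len K fullsub)%N.
Proof.
(* S t constrains only the rows of index at least t, so passing from t to t + 1 frees row t and adds
   the length of R^q / K. *)
move=> fin; pose S t := mksub (@rows_in_from_prop p q K t).
have SS t u : (t <= u)%N -> {subset S t <= S u}.
  by move=> tu A /mksubP h; apply/mksubP => i ui; apply/h/(leq_trans tu ui).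
have fS t u : (t <= u)%N -> finlen (S t) (S u).
  move=> tu; apply: finlen_sub fin _ _ _ => [v /mksubP -> | v _ |].
  - exact: rpred0.
  - exact: in_fullsub.
  - exact: SS.
have main t : (t <= p)%N -> len (S 0%N) (S t) = (t * len K fullsub)%N.
  elim: t => [_|t IH tp].
    by rewrite mul0n; apply: len_rlen; split; [exact: rchain0 |
       case=> [|k] // [c [ch cs]]; have [h0 _] := ch 0%N isT;
       have [_ h1] := ch 1%N isT; have [_ [v /h1/h0 v0]] := cs 0%N isT;
       rewrite v0].
  rewrite (@lenD _ _ _ (S t)) ?IH ?(ltnW tp) //; last exact: SS.
  - rewrite mulSn addnC; congr (_ + _)%N.
    apply: (len_iso (f := row (Ordinal tp))); first exact: SS.
    + by move=> v _; exact: in_fullsub.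
    + by move=> v _; exact: in_fullsub.
    + move=> A /mksubP hA; apply/idP/mksubP => [h i ti|->//].
      have [->//|nit] := eqVneq i (Ordinal tp).
      by apply: hA; rewrite ltn_neqAle ti andbT eq_sym; apply: contra nit.
    move=> w _; exists (\matrix_(i, j) if i == Ordinal tp then w ord0 j else 0).
      apply/mksubP => i ti; rewrite (_ : row _ _ = 0) ?rpred0 //.
      apply/rowP => j; rewrite !mxE ifF //.
      by apply/negP => /eqP ei; rewrite ei ltnn in ti.
    rewrite (_ : _ - w = 0) ?rpred0 //.
    by apply/rowP => j; rewrite !mxE eqxx subrr.
  - exact: fS.
  - exact: SS.
rewrite -(main p (leqnn p)); apply: len_ext => v.
- by move=> _; exact: in_fullsub.
- by apply/mksubP/mksubP => h i; [move=> _; exact: h | exact: h].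
- rewrite in_fullsub; apply/esym/mksubP => i; by rewrite leqNgt ltn_ord.
Qed.

End IdealMatrices.

Section ShortGorensteinMatrices.
Variables (R : comNzRingType) (m : submodClosed R^o) (e : nat).
Variables (xs xd : 'I_e -> R) (x : R).
Hypothesis H : short_gorenstein m xs xd x.

Local Notation mmx := (mmx m).

Lemma mmx_of_x0 p q (A : 'M[R]_(p, q)) : x *: A = 0 -> A \in mmx p q.
Proof.
move=> /matrixP h; apply/mmxP => i j; apply: (sg_ann H).
by have := h i j; rewrite !mxE mulrC.
Qed.

Lemma mmx_x0 p q (A : 'M[R]_(p, q)) : A \in mmx p q -> x *: A = 0.
Proof.
by move=> /mmxP h; apply/matrixP => i j; rewrite !mxE mulrC (sg_mx H).
Qed.

Lemma mmx_mulxr p q n (A : 'M[R]_(p, q)) (B : 'M[R]_(q, n)) :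
  B \in mmx q n -> (x *: A) *m B = 0.
Proof. by move=> h; rewrite -scalemxAl scalemxAr mmx_x0 // mulmx0. Qed.

Lemma scale_x_mxP p q (A : 'M[R]_(p, q)) :
  (forall i j, exists r, A i j = r * x) -> exists C, A = x *: C.
Proof.
move=> h; exists (\matrix_(i, j) projT1 (cid (h i j))).
by apply/matrixP => i j; rewrite !mxE mulrC -(projT2 (cid (h i j))).
Qed.

Lemma sg_mul3 (a b c : R) : a \in m -> b \in m -> c \in m -> a * (b * c) = 0.
Proof.
by move=> am bm cm; have [r ->] := sg_mm H bm cm; rewrite mulrCA (sg_mx H) // mulr0.
Qed.

Lemma mmx_mm p q n (A : 'M[R]_(p, q)) (B : 'M[R]_(q, n)) :
  A \in mmx p q -> B \in mmx q n -> exists C, A *m B = x *: C.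
Proof.
move=> /mmxP hA /mmxP hB; apply: scale_x_mxP => i j.
rewrite mxE; elim/big_ind: _ => [|_ _ [r ->] [s ->]|k _].
- by exists 0; rewrite mul0r.
- by exists (r + s); rewrite mulrDl.
- exact: (sg_mm H).
Qed.

Definition genrow : 'rV[R]_e := \row_c xs c.

Lemma genrow_m : genrow \in mmx 1 e.
Proof. by apply/mmxP => i j; rewrite mxE (sg_xs H). Qed.

Lemma sg_e0 : (0 < e)%N. Proof. by have := sg_e H; lia. Qed.

Definition ord_c0 : 'I_e := Ordinal sg_e0.

Lemma x_prod : x = xs ord_c0 * xd ord_c0.
Proof. by rewrite (sg_dual H) eqxx mul1r. Qed.

(** The dual basis reads off the rows: X W determines each row of W modulo m. *)
Lemma xd_genrow q (d : 'I_e) (W : 'M[R]_(e, q)) :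
  xd d *: (genrow *m W) = x *: row d W.
Proof.
apply/rowP => j; rewrite !mxE mulr_sumr (bigD1 d) //= big1 => [|c /negPf cd].
  by rewrite mxE mulrA [xd d * _]mulrC (sg_dual H) eqxx mul1r addr0.
by rewrite mxE mulrA [xd d * _]mulrC (sg_dual H) cd !mul0r.
Qed.

Lemma genrowE q (W : 'M[R]_(e, q)) : genrow *m W = \sum_c xs c *: row c W.
Proof. by rewrite mulmx_sum_row; apply: eq_bigr => c _; rewrite mxE. Qed.

Lemma mmx_gen q (v : 'rV[R]_q) : v \in mmx 1 q ->
  exists (W : 'M[R]_(e, q)) t, v = genrow *m W + x *: t.
Proof.
move=> /mmxP/(_ ord0) h; have g j := sg_gen H (h j).
pose r j := projT1 (cid (g j)); pose t j := projT1 (cid (projT2 (cid (g j)))).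
have E j : v ord0 j = \sum_c r j c * xs c + t j * x :=
  projT2 (cid (projT2 (cid (g j)))).
exists (\matrix_(c, j) r j c), (\row_j t j); apply/rowP => j.
rewrite E !mxE [x * _]mulrC; congr (_ + _); apply: eq_bigr => c _.
by rewrite !mxE mulrC.
Qed.

Lemma killed_xs p q (A : 'M[R]_(p, q)) :
  (forall c, xs c *: A = 0) -> exists C, A = x *: C.
Proof.
move=> h; apply: scale_x_mxP => i j; apply: (sg_soc H) => b bm.
have hc c : xs c * A i j = 0 by have /matrixP/(_ i j) := h c; rewrite !mxE.
have [r [t ->]] := sg_gen H bm; rewrite mulrDl mulr_suml big1 => [|c _].
  rewrite add0r x_prod.
  have -> : t * (xs ord_c0 * xd ord_c0) * A i j = t * xd ord_c0 * (xs ord_c0 * A i j) by ring.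
  by rewrite hc mulr0.
by rewrite -mulrA hc mulr0.
Qed.

Lemma finlen_mx p q (T S : submodClosed 'M[R]_(p, q)) :
  {subset T <= S} -> finlen T S.
Proof.
move=> TS; apply: finlen_sub (sg_finlen H (fg_matrix R p q)) _ _ _ => // v.
  by move/mksubP->; rewrite rpred0.
by move=> _; exact: in_fullsub.
Qed.

Lemma sub_full (V : lmodType R) (S : submodClosed V) : {subset S <= fullsub}.
Proof. by move=> v _; exact: in_fullsub. Qed.

Lemma len_full_gt0 p q (S : submodClosed 'M[R]_(p, q)) v :
  v \notin S -> (0 < len S fullsub)%N.
Proof.
move=> vS; have [_ h] := lenP (finlen_mx (@sub_full _ S)); apply: h.
exists (fun i => if i == 0%N then S else fullsub); split=> [[|i] _|[|i] // _] /=.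
- by split=> //; exact: sub_full.
- by split=> //; exact: sub_full.
- by split; [exact: sub_full | exists v; rewrite // in_fullsub].
Qed.

Lemma len_mmx p q : len (mmx p q) fullsub = (p * q)%N.
Proof.
have fin i j : finlen (zerosub : submodClosed 'M[R]_(i, j)) fullsub.
  exact: finlen_mx (@sub_full _ _).
have rows i j : len (mmx i j) fullsub = (i * len (mmx 1 j) fullsub)%N.
  rewrite -(len_rows_in (mmx 1 j) (fin i j)); apply: len_ext; first exact: sub_full.
    move=> A; apply/idP/mksubP => [/mmxP h k|]; last exact: mmx_rows.
    by apply/mmxP => a b; rewrite mxE.
  by [].
have one : len (mmx 1 1) fullsub = 1%N.
  have n1 : (1%:M : 'M[R]_1) \notin mmx 1 1.
    by apply/negP => /mmxP/(_ ord0 ord0); rewrite mxE eqxx (negPf (sg_proper H)).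
  apply/eqP; rewrite eqn_leq (len_full_gt0 n1) andbT.
  have [cn _] := lenP (finlen_mx (@sub_full _ (mmx 1 1))).
  apply: (addelt_rchain (sg_unit H) (S := mmx 1 1) (y := 1%:M)).
    by move=> a am; apply: mmx_scale.
  apply: rchain_widen cn => // A _; apply/mksubP; exists (A ord0 ord0).
  rewrite (_ : _ - _ = 0) ?rpred0 //.
  by apply/matrixP => i j; rewrite !ord1 !mxE eqxx mulr1 subrr.
rewrite rows; congr (p * _)%N.
rewrite -[RHS]muln1 -[in RHS]one -rows.
apply: (len_iso (f := trmx)); first exact: sub_full.
- exact: sub_full.
- by move=> v _; exact: in_fullsub.
- by move=> v _; rewrite mmx_tr.
move=> w _; exists w^T; first exact: in_fullsub.
by rewrite /= trmxK subrr rpred0.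
Qed.

End ShortGorensteinMatrices.

Section MatrixMaps.
Variable R : comNzRingType.

Definition mullin p q n (P : 'M[R]_(n, p)) :
  {linear 'M[R]_(p, q) -> 'M[R]_(n, q)} := mulmx P.

Lemma mullinE p q n (P : 'M[R]_(n, p)) (A : 'M[R]_(p, q)) : mullin q P A = P *m A.
Proof. by []. Qed.

Fact mulrlin_subproof p q n (Q : 'M[R]_(q, n)) :
  linear (fun A : 'M[R]_(p, q) => A *m Q).
Proof. by move=> a A B; rewrite mulmxDl scalemxAl. Qed.
Definition mulrlin p q n (Q : 'M[R]_(q, n)) := mklin (@mulrlin_subproof p q n Q).

Fact scalelin_subproof (V : lmodType R) (a : R) : linear (fun v : V => a *: v).
Proof. by move=> b u v; rewrite scalerDr !scalerA mulrC. Qed.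
Definition scalelin (V : lmodType R) a := mklin (@scalelin_subproof V a).

(* A free resolution, with maps acting on row vectors by right
   multiplication; the augmentation is left out. *)
Definition resolution (n : nat -> nat) (C : forall j, 'M[R]_(n j.+1, n j)) :=
  (forall j, C j.+1 *m C j = 0) /\
  (forall j (v : 'rV_(n j.+1)), v *m C j = 0 -> exists w, v = w *m C j.+1).

Lemma resolution_mx n C (resC : @resolution n C) j p (A : 'M[R]_(p, n j.+1)) :
  A *m C j = 0 -> exists B, A = B *m C j.+1.
Proof.
move=> AC; have ex i : exists w, row i A = w *m C j.+1.
  by apply: resC.2; rewrite -row_mul AC row0.
exists (\matrix_i projT1 (cid (ex i))).
by apply/row_matrixP => i; rewrite row_mul rowK -(projT2 (cid (ex i))).
Qed.

Lemma resolution_shift n C : @resolution n C ->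
  @resolution (fun j => n j.+1) (fun j => C j.+1).
Proof. by case=> h1 h2; split=> j; [exact: h1 | exact: h2]. Qed.

End MatrixMaps.

(** * Colengths along a linear resolution *)

Section Colengths.
Variables (R : comNzRingType) (m : submodClosed R^o) (e : nat).
Variables (xs xd : 'I_e -> R) (x : R).
Hypothesis H : short_gorenstein m xs xd x.

Local Notation mmx := (mmx m).
Local Notation X := (genrow xs).

(* Says [x R^n = m * im C]; when the rows of [C] span a syzygy module, this
   forbids direct summands isomorphic to the residue field in it. *)
Definition koszul n n' (C : 'M[R]_(n', n)) :=
  forall u : 'rV[R]_n, exists W : 'M_(e, n'), x *: u = X *m W *m C.

(** With the socle x R^n seen as (R/m)^n through u -> x u, [pull] moves K one step down the
    resolution: x u must be a combination of the [xs c] with coefficients in the image of K under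
    C. *)
Fact pull_prop n n' (C : 'M[R]_(n', n)) (K : submodClosed 'rV[R]_n') :
  submod_prop (fun u : 'rV[R]_n =>
    exists W : 'M_(e, n'), (forall c, row c W \in K) /\ x *: u = X *m W *m C).
Proof.
split=> [|a u v [W [hW eW]] [W' [hW' eW']]].
  by exists 0; split=> [c|]; rewrite ?row0 ?rpred0 // scaler0 mulmx0 mul0mx.
exists (a *: W + W'); split=> [c|].
  by rewrite linearP rpredD ?rpredZ ?hW ?hW'.
rewrite scalerDr scalerA mulrC -scalerA eW eW'.
by rewrite mulmxDr mulmxDl -scalemxAr scalemxAl.
Qed.
Definition pull n n' (C : 'M[R]_(n', n)) K := mksub (pull_prop C K).

Lemma mmx_pull n n' (C : 'M[R]_(n', n)) K : {subset mmx 1 n <= pull C K}.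
Proof.
move=> u um; apply/mksubP; exists 0; split=> [c|]; first by rewrite row0 rpred0.
by rewrite (mmx_x0 H um) mulmx0 mul0mx.
Qed.

Lemma pull_full n n' (C : 'M[R]_(n', n)) (K : submodClosed 'rV[R]_n') u :
  koszul C -> (forall v, v \in K) -> u \in pull C K.
Proof. by move=> kC hK; have [W eW] := kC u; apply/mksubP; exists W. Qed.

(** Write q_2, q_1, q_0 for the colengths of K and its two pullbacks. The e x n1 matrices modulo
    those with rows in K1 have length e q_1. The map W -> X W C0 cuts this in two: its image
    contributes at most q_0, its kernel at most q_2. *)
Lemma colength_pull n0 n1 n2 (C0 : 'M[R]_(n1, n0)) (C1 : 'M[R]_(n2, n1))
    (K : submodClosed 'rV[R]_n2) :
  C0 \in mmx n1 n0 -> C1 \in mmx n2 n1 ->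
  (forall v : 'rV_n1, v *m C0 = 0 -> exists w, v = w *m C1) ->
  (e * len (pull C1 K) fullsub <=
     len (pull C0 (pull C1 K)) fullsub + len K fullsub)%N.
Proof.
move=> hC0 hC1 ex0; pose K1 := pull C1 K; pose K0 := pull C0 K1.
rewrite -/K1 -/K0.
pose P : lmodType R := 'M[R]_(e, n1).
pose Ke : submodClosed P := rows_in e K1.
have lth : linear (fun W : P => X *m W *m C0).
  by move=> a W W'; rewrite mulmxDr mulmxDl -scalemxAr -scalemxAl.
pose th : {linear P -> 'rV[R]_n0} := mklin lth.
pose Z : submodClosed P := ker th.
pose XW : {linear P -> 'rV[R]_n1} := mullin n1 X.
pose T0 := capsub Z (presub XW (imsub (mulrlin 1 C1) K)).
have T0Z : {subset T0 <= Z} by move=> W /mksubP[].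
(* If X W = u C1 with u in K, multiplying by xd d gives x (row d W) = xd d u C1; xd d is a
   combination of the [xs c] up to a socle term, which C1 kills. *)
have T0K : {subset T0 <= Ke}.
  move=> W /mksubP[_ /mksubP/mksubP[u uK eu]]; apply/mksubP => d; apply/mksubP.
  have [r [t xdE]] := sg_gen H (sg_xd H d).
  exists (\matrix_c (r c *: u)); split=> [c|]; first by rewrite rowK rpredZ.
  rewrite -(xd_genrow H) [X *m W]eu mklinE xdE scalerDl -scalerA.
  rewrite (mmx_x0 H) ?mmx_mull // scaler0 addr0 genrowE mulmx_suml scaler_suml.
  by apply: eq_bigr => c _; rewrite rowK scalerA scalemxAl mulrC.
have ZA : {subset Z <= addsub Ke Z} by exact: addsubr.
have KA : {subset Ke <= addsub Ke Z} by exact: addsubl.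
rewrite -(len_rows_in K1 (finlen_mx H (@sub_full _ _ _))).
rewrite (@lenD _ _ _ (addsub Ke Z)) ?(finlen_mx H) //; try exact: sub_full.
rewrite addnC; apply: leq_add.
  (* P / (Ke + Z) embeds through [th] in x R^n0 / x K0, a quotient of R^n0 / K0. *)
  pose xl : {linear 'rV[R]_n0 -> 'rV[R]_n0} := scalelin 'rV[R]_n0 x.
  have s1 : {subset imsub xl K0 <= imsub xl fullsub}.
    by move=> _ /mksubP[u _ ->]; apply/mem_imsub/in_fullsub.
  apply: leq_trans (_ : len (imsub xl K0) (imsub xl fullsub) <= _)%N.
    apply: (len_inj (f := th) _ _ _ _ (finlen_mx H s1)).2 => //.
    - exact: sub_full.
    - move=> W _; have [] := mmx_mm H (mmx_mulr W (genrow_m H)) hC0.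
      by move=> C eC; rewrite mklinE eC; apply: mem_imsub (in_fullsub _).
    - move=> W _ /mksubP[u /mksubP[W' [hW' eW']] eu].
      apply/mksubP; exists W', (W - W'); rewrite subrKC; split=> //.
        by apply/mksubP.
      apply/kerP; rewrite linearB eu; apply/eqP; rewrite subr_eq0.
      by apply/eqP.
  apply: (len_surj (f := xl) _ _ _ _ (finlen_mx H (@sub_full _ _ _))).2 => //.
  - exact: sub_full.
  - by move=> v vK; apply: mem_imsub.
  - move=> _ /mksubP[u _ ->]; exists u; rewrite ?subrr ?rpred0 //.
    exact: in_fullsub.
have s1 : {subset imsub (mulrlin 1 C1) K <= imsub (mulrlin 1 C1) fullsub}.
  by move=> _ /mksubP[u _ ->]; apply/mem_imsub/in_fullsub.
(* (Ke + Z) / Ke is a quotient of Z / T0, which W -> X W embeds in im C1 modulo the image of K, a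
   quotient of R^n2 / K. *)
apply: leq_trans (_ : len T0 Z <= _)%N.
  apply: (len_surj (f := idfun) _ _ _ _ (finlen_mx H T0Z)).2 => //.
  move=> _ /mksubP[s [z [sK zZ ->]]]; exists z => //.
  by rewrite /= opprD addrCA subrr addr0 rpredN.
apply: leq_trans (_ : len (imsub (mulrlin 1 C1) K) (imsub (mulrlin 1 C1) fullsub) <= _)%N.
  apply: (len_inj (f := XW) _ _ _ _ (finlen_mx H s1)).2 => //.
  - move=> W /kerP; rewrite mklinE => /ex0[w ew].
    by apply/mksubP; exists w; rewrite ?in_fullsub.
  - by move=> W WZ h; apply/mksubP; split=> //; apply/mksubP.
apply: (len_surj (f := mulrlin 1 C1) _ _ _ _ (finlen_mx H (@sub_full _ _ _))).2 => //.
- exact: sub_full.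
- by move=> v vK; apply: mem_imsub.
- move=> _ /mksubP[u _ ->]; exists u; rewrite ?subrr ?rpred0 //.
  exact: in_fullsub.
by apply: (finlen_mx H); exact: sub_full.
Qed.

(* [K0 = pull (C 0) K1] and [K1] are the members of index 0 and 1 of a sequence
   of submodules [K_j] of [R^(n j)], whose colengths [q_j] satisfy
   [e q_(j+1) <= q_j + q_(j+2)] with [e >= 3]: hence they are strictly convex,
   and the bound [b 0] on the colength at the far end limits [i]. *)
Lemma colength_growth i : (0 < i)%N ->
  forall (b : nat -> nat) (E : forall t, 'M[R]_(b t, b t.+1)) (n : nat -> nat)
    (C : forall j, 'M[R]_(n j.+1, n j)) (L : 'M[R]_(n 0%N, b i)),
  (forall t, (t < i)%N -> forall p (V : 'M_(p, b t.+1)), V *m E t.+1 = 0 ->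
     exists W, V = W *m E t) ->
  (forall t, E t \in mmx _ _) ->
  resolution C -> (forall j, C j \in mmx _ _) ->
  (forall j, (j < i)%N -> koszul (C j)) ->
  C 0%N *m L *m E i = 0 -> L \notin mmx _ _ ->
  exists K1 : submodClosed 'rV[R]_(n 1%N),
    [/\ forall u, u \in pull (C 0%N) K1 -> u *m L \in mmx _ _,
        (0 < len K1 fullsub)%N &
        (len K1 fullsub + i <= len (pull (C 0%N) K1) fullsub + b 0%N)%N].
Proof.
(* x u L0 = X W C0 L0 = X (W L1) E is a product of three matrices over m, hence zero. *)
have pullL n0 n1 b0 b1 (C0 : 'M[R]_(n1, n0)) (L0 : 'M_(n0, b1)) (L1 : 'M_(n1, b0))
    (E : 'M_(b0, b1)) (K1 : submodClosed 'rV[R]_n1) : E \in mmx b0 b1 ->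
    C0 *m L0 = L1 *m E -> (forall u, u \in K1 -> u *m L1 \in mmx _ _) ->
    forall u, u \in pull C0 K1 -> u *m L0 \in mmx _ _.
  move=> hE e0 hK u /mksubP[W [hW eW]]; apply: (mmx_of_x0 H).
  rewrite scalemxAl eW -!mulmxA e0 !mulmxA -(mulmxA X).
  have WL : W *m L1 \in mmx _ _.
    by apply: mmx_rows => c; rewrite row_mul; apply: hK.
  have [D ->] := mmx_mm H (genrow_m H) WL.
  exact: (mmx_mulxr H).
have nfull n0 (K : submodClosed 'rV[R]_n0) : ~ (forall v, v \in K) ->
    (0 < len K fullsub)%N.
  by move=> /existsNP[v /negP vK]; exact: (len_full_gt0 H vK).
have fullL n0 b0 (K : submodClosed 'rV[R]_n0) (L : 'M[R]_(n0, b0)) :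
    (forall u, u \in K -> u *m L \in mmx _ _) -> L \notin mmx _ _ ->
    ~ (forall v, v \in K).
  move=> hK /negP Lm h; apply: Lm; apply: mmx_rows => k.
  by rewrite rowE; apply: hK.
case: i => // i _; elim: i => [|i IH] b E n C L texE hE resC hC kC CLE Lm.
  have [L1 eL1] : exists L1, C 0%N *m L = L1 *m E 0%N by apply: texE.
  pose K1 : submodClosed 'rV[R]_(n 1%N) := presub (mulrlin 1 L1) (mmx 1 (b 0%N)).
  have hK1 u : u \in K1 -> u *m L1 \in mmx _ _ by move=> /mksubP.
  have hK0 := pullL _ _ _ _ _ _ _ _ K1 (hE 0%N) eL1 hK1.
  have K0n := fullL _ _ _ _ hK0 Lm.
  exists K1; split=> //.
    apply: nfull => hf; apply: K0n => v; apply: pull_full => //; exact: kC.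
  (* At the far end L1 embeds R^(n 1) / K1 in (R/m)^(b 0), so q_1 <= b 0, while q_0 >= 1. *)
  apply: leq_trans (_ : b 0%N + 1 <= _)%N; last by rewrite addnC leq_add2r nfull.
  rewrite leq_add2r.
  have := @len_mmx _ _ _ _ _ _ H 1 (b 0%N); rewrite mul1n => <-.
  apply: (len_inj (f := mulrlin 1 L1) _ _ _ _ (finlen_mx H (@sub_full _ _ _))).2.
  - exact: sub_full.
  - exact: sub_full.
  - by move=> v _; exact: in_fullsub.
  - by move=> v _ h; apply/mksubP.
have [L1 eL1] : exists L1, C 0%N *m L = L1 *m E i.+1 by apply: texE.
(* If L1 were zero modulo m, then x times a row of L, being X W C L = X W L1 E by the Koszul
   property, would be a product of three matrices over m. *)
have L1m : L1 \notin mmx _ _.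
  apply: contra Lm => L1m; apply: mmx_rows => k; rewrite rowE.
  apply: (mmx_of_x0 H); have [W eW] := kC 0%N isT (delta_mx 0 k).
  rewrite scalemxAl eW -!mulmxA eL1 !mulmxA -(mulmxA X).
  have [D ->] := mmx_mm H (genrow_m H) (mmx_mull W L1m).
  exact: (mmx_mulxr H).
have CL1 : C 1%N *m L1 *m E i.+1 = 0.
  by rewrite -mulmxA -eL1 mulmxA resC.1 mul0mx.
have [||||K2 [h1 h2 h3]] := IH b E _ _ L1 _ _ (resolution_shift resC) _ _ CL1 L1m.
- by move=> t ti; apply: texE; lia.
- by [].
- by move=> j; apply: hC.
- by move=> j ji; apply: kC; lia.
pose K1 := pull (C 1%N) K2.
have hK0 := pullL _ _ _ _ _ _ _ _ K1 (hE _) eL1 h1.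
have K0n := fullL _ _ _ _ hK0 Lm.
have K1n : (0 < len K1 fullsub)%N.
  apply: nfull => hf; apply: K0n => v; apply: pull_full => //; exact: kC.
exists K1; split=> //.
have := @colength_pull _ _ _ (C 0%N) (C 1%N) K2 (hC _) (hC _) (resC.2 0%N).
rewrite -/K1 => h4; have h5 : (3 * len K1 fullsub <= e * len K1 fullsub)%N.
  by rewrite leq_mul2r (sg_e H) orbT.
(* From 3 q_1 <= q_0 + q_2 and q_2 + (i + 1) <= q_1 + b 0 follows 2 q_1 + (i + 1) <= q_0 + b 0, and
   q_1 >= 1 supplies the extra unit. *)
have {h4 h5} := leq_trans h5 h4; move: h3 K1n; rewrite -/K1; lia.
Qed.

(** The pullback contains m R^(n 0), so q_0 <= n 0; with q_1 > 0, [colength_growth] would force i <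
    n 0 + b 0. *)
Lemma mmx_of_annihilated i (b : nat -> nat) (E : forall t, 'M[R]_(b t, b t.+1)) (n : nat -> nat)
    (C : forall j, 'M[R]_(n j.+1, n j)) (L : 'M[R]_(n 0%N, b i)) :
  (0 < i)%N -> (n 0 + b 0 <= i)%N ->
  (forall t, (t < i)%N -> forall p (V : 'M_(p, b t.+1)), V *m E t.+1 = 0 ->
     exists W, V = W *m E t) ->
  (forall t, E t \in mmx _ _) ->
  resolution C -> (forall j, C j \in mmx _ _) ->
  (forall j, (j < i)%N -> koszul (C j)) ->
  C 0%N *m L *m E i = 0 -> L \in mmx _ _.
Proof.
move=> i0 ni texE hE resC hC kC CLE; apply/negPn/negP => Lm.
have [K1 [_ h1 h2]] := colength_growth i0 texE hE resC hC kC CLE Lm.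
have : (len (pull (C 0%N) K1) fullsub <= len (mmx 1 (n 0%N)) fullsub)%N.
  rewrite [leqRHS](@lenD _ _ _ (pull (C 0%N) K1)) ?leq_addl //.
  - by apply: (finlen_mx H); exact: sub_full.
  - exact: mmx_pull.
  - exact: sub_full.
have := len_mmx H 1 (n 0%N); lia.
Qed.

End Colengths.

(** * Minimal resolutions are eventually linear *)

Lemma dependent_choice (T : nat -> Type) (P0 : T 0%N -> Prop)
    (S : forall i, T i -> T i.+1 -> Prop) :
  (exists x, P0 x) -> (forall i x, exists y, S i x y) ->
  exists f : forall i, T i, P0 (f 0%N) /\ forall i, S i (f i) (f i.+1).
Proof.
move=> [x0 Px0] h.
pose f := nat_rect T x0 (fun i x => projT1 (cid (h i x))).
by exists f; split=> // i; exact: projT2 (cid (h i (f i))).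
Qed.

Lemma sub_span_sub (R : comNzRingType) (V : lmodType R) (G : V -> Prop)
    (S : submodClosed V) :
  (forall v, G v -> v \in S) -> {subset Defs.sub_span G <= S}.
Proof.
move=> h v /asboolP[s [sG ->]]; rewrite big_seq rpred_sum // => p /sG/h ?.
by rewrite rpredZ.
Qed.

Section MinimalResolutions.
Variables (R : comNzRingType) (m : submodClosed R^o) (e : nat).
Variables (xs xd : 'I_e -> R) (x : R).
Hypothesis H : short_gorenstein m xs xd x.

Local Notation mmx := (mmx m).
Local Notation X := (genrow xs).
Local Notation koszul := (koszul xs x).

(** The rows of C form a largest family in K independent modulo m K; that they generate K is
    Nakayama's lemma, made elementary by m^3 = 0. *)
Lemma minimal_generators n (K : submodClosed 'rV[R]_n) :
  exists n' (C : 'M[R]_(n', n)),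
    (forall v, v \in K <-> exists w, v = w *m C) /\
    (forall w : 'rV_n', w *m C = 0 -> w \in mmx 1 n').
Proof.
pose V : lmodType R := 'rV[R]_n.
pose G (z : V) := exists (a : R) (y : V), [/\ a \in m, y \in K & z = a *: y].
pose mK : submodClosed V := Defs.sub_span G.
have mKK : {subset mK <= K}.
  by apply: sub_span_sub => _ [a [y [am yK ->]]]; rewrite rpredZ.
have mKg a y : a \in m -> y \in K -> a *: y \in mK.
  by move=> am yK; apply: mem_sub_span; exists a, y.
pose indep t := exists C : 'M[R]_(t, n), (forall i, row i C \in K) /\
  forall w : 'rV_t, w *m C \in mK -> w \in mmx 1 t.
have mulK t (C : 'M[R]_(t, n)) (w : 'rV_t) :
    (forall i, row i C \in K) -> w *m C \in K.
  by move=> h; rewrite mulmx_sum_row rpred_sum // => i _; rewrite rpredZ.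
have bnd t : indep t -> (t <= len mK K)%N.
  move=> [C [CK Ci]]; have [_ h] := lenP (finlen_mx H mKK); apply: h.
  (* Adjoining the rows of C to m K one at a time gives a strict chain of length t inside K. *)
  pose P i (v : V) := exists w : 'rV[R]_t,
    (forall j : 'I_t, (i <= j)%N -> w ord0 j = 0) /\ v - w *m C \in mK.
  have hP i : submod_prop (P i).
    split=> [|a u v [w [w0 hw]] [w' [w0' hw']]].
      by exists 0; split=> [j _|]; rewrite ?mxE // mul0mx subr0 rpred0.
    exists (a *: w + w'); split=> [j ij|].
      by rewrite !mxE w0 ?w0' // mulr0 addr0.
    rewrite mulmxDl -scalemxAl opprD addrACA -scalerBr.
    by rewrite rpredD ?rpredZ.
  exists (fun i => mksub (hP i)); split=> i it.
    split=> v; last move=> /mksubP[w [_ hw]].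
      move=> vK; apply/mksubP; exists 0.
      by split=> [j _|]; rewrite ?mxE // mul0mx subr0.
    by rewrite -[v](subrK (w *m C)) rpredD ?mulK ?mKK.
  split.
    move=> v /mksubP[w [w0 hw]]; apply/mksubP; exists w; split=> // j ij.
    by apply: w0; exact: ltnW.
  pose k := Ordinal it; exists (row k C).
    apply/mksubP; exists (delta_mx 0 k); split=> [j ij|].
      by rewrite mxE eqxx /=; case: eqP => // kj; rewrite kj ltnn in ij.
    by rewrite rowE subrr rpred0.
  apply/negP => /mksubP[w [w0]]; rewrite rowE -mulmxBl => /Ci/mmxP/(_ ord0 k).
  by rewrite !mxE !eqxx w0 // subr0 (negPf (sg_proper H)).
have ex : exists t, `[< indep t >].
  exists 0%N; apply/asboolP; exists 0; split=> [[]//|w _].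
  by apply/mmxP => i [].
have bnd' t : `[< indep t >] -> (t <= len mK K)%N by move/asboolP/bnd.
case: (ex_maxnP ex bnd') => n' /asboolP[C [CK Ci]] mx; exists n', C.
(* An element of K outside im C + m K could be added as a new row, against the maximality of n'. *)
have KC y : y \in K -> exists w, y - w *m C \in mK.
  move=> yK; apply: contrapT => nex.
  suff /asboolP/mx : indep n'.+1 by rewrite ltnn.
  exists (col_mx y C); split=> [i|].
    have h (k : 'I_(1 + n')) : row k (col_mx y C) \in K.
      rewrite -[k]splitK; case: (fintype.split k) => j /=.
        by rewrite rowKu row_id.
      by rewrite rowKd.
    exact: h i.
  suff h (w : 'rV_(1 + n')) : w *m col_mx y C \in mK -> w \in mmx _ _ by exact: h.
  rewrite -[w]hsubmxK mul_row_col.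
  set a := lsubmx _; set w' := rsubmx _ => h.
  have aE : a *m y = a ord0 ord0 *: y.
    by rewrite {1}[a]mx11_scalar mul_scalar_mx.
  have [am|/(sg_unit H)[s sa]] := boolP (a ord0 ord0 \in m); last first.
    case: nex; exists (- s *: w').
    have -> : y - (- s *: w') *m C = s *: (a *m y + w' *m C).
      by rewrite aE scalerDr scalerA sa scale1r -scalemxAl scaleNr opprK.
    by rewrite rpredZ.
  have /Ci wm : w' *m C \in mK.
    have := submod_subr h (mKg _ _ am yK).
    by rewrite aE addrAC subrr add0r.
  apply/mmxP => i j; rewrite !ord1 -[j]splitK.
  case: (fintype.split j) => k /=; first by rewrite row_mxEl !ord1.
  by rewrite row_mxEr; move/mmxP: wm; apply.
pose L : submodClosed V := imsub (mulrlin 1 C) fullsub.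
have LC w : w *m C \in L by apply/mksubP; exists w; rewrite ?in_fullsub.
(* Since K lies in im C + m K and m^3 K = 0, the submodule L contains m^2 K, then m K, then K. *)
have mm a b y : a \in m -> b \in m -> y \in K -> (a * b) *: y \in L.
  move=> am bm /KC[w hw]; rewrite -[y](subrK (w *m C)) scalerDr.
  rewrite -!scalerA rpredD //; last by rewrite !rpredZ.
  suff -> : a *: (b *: (y - w *m C)) = 0 by rewrite rpred0.
  have h1 : {subset mK <= ker (scalelin V (a * b))}.
    apply: sub_span_sub => _ [c [z [cm zK ->]]]; apply/kerP.
    by rewrite mklinE scalerA -mulrA (sg_mul3 H) // scale0r.
  by rewrite scalerA; apply/(kerP (scalelin V (a * b)))/h1.
have m1 a y : a \in m -> y \in K -> a *: y \in L.
  move=> am /KC[w hw]; rewrite -[y](subrK (w *m C)) scalerDr.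
  rewrite rpredD //; last by rewrite rpredZ.
  suff h1 : {subset mK <= presub (scalelin V a) L} by have /mksubP := h1 _ hw.
  apply: sub_span_sub => _ [c [z [cm zK ->]]]; apply/mksubP.
  by rewrite mklinE scalerA mm.
split=> [v|w wC].
  split=> [vK|[w ->]]; last exact: mulK.
  suff : v \in L by move=> /mksubP[w _ ->]; exists w.
  have [w hw] := KC _ vK; rewrite -[v](subrK (w *m C)) rpredD //.
  suff h1 : {subset mK <= L} by apply: h1.
  by apply: sub_span_sub => _ [c [z [cm zK ->]]]; apply: m1.
by apply: Ci; rewrite wC rpred0.
Qed.

(** [P] carries the link between the starting submodule and the module to be resolved. Its ambient
    free module is not chosen minimally, so [C 0] may have unit entries. *)
Lemma minimal_resolution (P : forall n, submodClosed 'rV[R]_n -> Prop) :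
  (exists n K, @P n K) ->
  exists (n : nat -> nat) (C : forall j, 'M[R]_(n j.+1, n j)) K,
    [/\ @P (n 0%N) K, forall v, v \in K <-> exists w, v = w *m C 0%N,
        resolution C & forall j, C j.+1 \in mmx _ _].
Proof.
move=> [g [K PK]].
pose T (_ : nat) := {n & submodClosed 'rV[R]_n}.
pose S i (s : T i) (s' : T i.+1) := exists C : 'M[R]_(projT1 s', projT1 s),
  [/\ forall v, v \in projT2 s <-> exists w, v = w *m C,
      forall w, w \in projT2 s' <-> w *m C = 0 &
      forall w : 'rV_(projT1 s'), w *m C = 0 -> w \in mmx _ _].
have [||f [P0 hf]] := @dependent_choice T (fun s => P _ (projT2 s)) S.
- by exists (existT _ g K).
- move=> i [n K']; have [n' [C [h1 h2]]] := minimal_generators K'.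
  exists (existT _ n' (ker (mulrlin 1 C))); exists C; split=> //= w.
  by split=> [/kerP|wC]; [|apply/kerP].
pose n j := projT1 (f j).
pose C j : 'M[R]_(n j.+1, n j) := projT1 (cid (hf j)).
have hC j : [/\ forall v, v \in projT2 (f j) <-> exists w, v = w *m C j,
   forall w, w \in projT2 (f j.+1) <-> w *m C j = 0 &
   forall w : 'rV_(n j.+1), w *m C j = 0 -> w \in mmx _ _] := projT2 (cid (hf j)).
have CC j : C j.+1 *m C j = 0.
  apply/row_matrixP => i; rewrite row_mul row0; have [_ h _] := hC j.
  by apply/h; have [h1 _ _] := hC j.+1; apply/h1; exists (delta_mx 0 i); rewrite rowE.
exists n, C, (projT2 (f 0%N)); split=> //.
- by have [] := hC 0%N.
- split=> // j v vC; have [h1 _ _] := hC j.+1; apply/h1.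
  by have [_ h2 _] := hC j; apply/h2.
- move=> j; apply: mmx_rows => i; have [_ _ h] := hC j; apply: h.
  by rewrite -row_mul CC row0.
Qed.

(** This is exactness of Hom(D, R). A matrix w separating V from the image satisfies w D_t = 0,
    hence is B D_(t+1), and then pairs to zero with V. *)
Lemma resolution_tr b D : @resolution R b D -> forall t p (V : 'M_(p, b t.+1)),
  V *m (D t.+1)^T = 0 -> exists W, V = W *m (D t)^T.
Proof.
move=> resD t p V VD.
pose S : submodClosed 'M[R]_(p, b t.+1) := imsub (mulrlin p (D t)^T) fullsub.
suff /mksubP[W _ ->] : V \in S by exists W.
apply/negPn/negP => /(sg_sep H)[w wS]; case/eqP.
have : w *m D t = 0.
  apply: trform_eq0 => B; have -> : w *m D t = w *m ((D t)^T)^T by rewrite trmxK.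
  rewrite -trformMr.
  by apply: wS; apply/mksubP; exists B; rewrite ?in_fullsub.
move=> /(resolution_mx resD)[B ->].
rewrite trform_sym trformMr VD.
by rewrite trform0r.
Qed.

(* If [x u] is not in [m * im D], a functional [l] separates them; then
   [l *m D^T] lies in the socle. *)
Lemma nkoszul_functional n n' (D : 'M[R]_(n', n)) : ~ koszul D ->
  exists l : 'rV[R]_n, l \notin mmx 1 n /\ exists u, l *m D^T = x *: u.
Proof.
move=> /existsNP[u nu].
pose S : submodClosed 'rV[R]_n := imsub (mulrlin 1 D) (imsub (mullin n' X) fullsub).
have [|l lS lu] := @sg_sep _ _ _ _ _ _ H 1 n S (x *: u).
  apply/negP => /mksubP[_ /mksubP[W _ ->] eu]; apply: nu; exists W.
  by rewrite eu.
exists l; split.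
  by apply: contra lu => lm; rewrite trform_scale (mmx_x0 H lm) trform0r.
apply: (killed_xs H) => c.
have h : X^T *m (l *m D^T) = 0.
  apply: trform_eq0 => W; rewrite -trformMl -trformMr.
  apply: lS; apply/mksubP; exists (X *m W) => //.
  by apply/mksubP; exists W; rewrite ?in_fullsub.
apply/rowP => j; have /matrixP/(_ c j) := h.
by rewrite !mxE big_ord1 !mxE.
Qed.

Section ResidueField.
Variables (n : nat -> nat) (C : forall j, 'M[R]_(n j.+1, n j)).
Hypothesis resC : resolution C.
Hypothesis n0 : n 0%N = 1%N.
Hypothesis imC0 : forall v, v \in mmx 1 (n 0%N) <-> exists w, v = w *m C 0%N.
Hypothesis hC : forall j, C j \in mmx _ _.

(** If [D i] is not Koszul, a functional l, nonzero modulo m, satisfies l (D i)^T = x u. Since [C 0]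
    has entries in m it kills x u, so [mmx_of_annihilated] applies to l, with n 0 = 1. *)
Lemma koszul_of_residue b D i : @resolution R b D -> (forall j, D j \in mmx _ _) ->
  (0 < i)%N -> (b 0%N < i)%N -> (forall j, (j < i)%N -> koszul (C j)) ->
  koszul (D i).
Proof.
move=> resD hD i0 bi kC; apply: contrapT => /nkoszul_functional[l [lm [u lu]]].
have k : 'I_(n 0%N) by rewrite n0; exact: ord0.
pose L : 'M[R]_(n 0%N, b i) := delta_mx k 0 *m l.
have Lm : L \in mmx _ _.
  apply: (@mmx_of_annihilated _ _ _ _ _ _ H i b (fun t => (D t)^T) n C L) => //.
  - by rewrite n0.
  - by move=> t _; apply: resolution_tr.
  - by move=> t; rewrite mmx_tr.
  rewrite -mulmxA -(mulmxA _ l) lu -scalemxAr -scalemxAr.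
  by rewrite scalemxAl (mmx_x0 H) ?mul0mx.
case/negP: lm; apply/mmxP => i' j; have /mmxP/(_ k j) := Lm.
by rewrite !mxE big_ord1 mxE !eqxx mul1r !ord1.
Qed.

Lemma lift_xs c : exists W : 'M[R]_(n 0%N, n 1%N), W *m C 0%N = (xs c)%:M.
Proof.
have ex i : exists w, row i ((xs c)%:M : 'M[R]_(n 0%N)) = w *m C 0%N.
  apply/imC0; apply/mmxP => a b; rewrite !mxE.
  by case: eqP => _; rewrite ?mulr1n ?(sg_xs H) ?mem_ideal0.
exists (\matrix_i projT1 (cid (ex i))).
by apply/row_matrixP => i; rewrite row_mul rowK -(projT2 (cid (ex i))).
Qed.

Lemma koszul_residue0 : koszul (C 0%N).
Proof.
move=> u; pose c := ord_c0 H.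
have [w hw] : exists w, xd c *: u = w *m C 0%N.
  by apply/imC0; apply: mmx_scale (sg_xd H _).
exists (delta_mx c 0 *m w).
rewrite -!mulmxA -hw mulmxA -colE -scalemxAr.
apply/rowP => j; rewrite !mxE big_ord1 !mxE mulrA [xd c * _]mulrC.
by rewrite -x_prod.
Qed.

(** With D = C, [koszul_of_residue] needs an index above 1, so index 1 is done by hand: a functional
    l that is socle-valued on ker (C 0) is shown to take values in m on lifts of the [xs c], which
    span R^(n 1) modulo m. *)
Lemma koszul_residue1 : koszul (C 1%N).
Proof.
apply: contrapT => /nkoszul_functional[l [/negP lm [u lu]]]; apply: lm.
have kerC v : v *m C 0%N = 0 -> v \in mmx 1 (n 1%N).
  by move=> /resC.2[w ->]; rewrite mmx_mull.
have vl p (v : 'M_(p, n 1%N)) : v *m C 0%N = 0 -> exists u', v *m l^T = x *: u'.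
  move=> /(resolution_mx resC)[B ->]; exists (B *m u^T).
  rewrite -mulmxA -[C 1%N]trmxK -trmx_mul lu.
  by rewrite linearZ /= scalemxAr.
pose W c := projT1 (cid (lift_xs c)).
have hW c : W c *m C 0%N = (xs c)%:M := projT2 (cid (lift_xs c)).
have Wl c : W c *m l^T \in mmx _ _.
  (* For d different from c, xd d W c lies over xd d xs c = 0, so l sends it into R x. Multiplying
     by xs d gives x (W c l^T) = 0. *)
  have [d cd] : exists d : 'I_e, d != c.
    have e1 : (1 < e)%N by have := sg_e H; lia.
    have [/eqP ec|] := boolP (c == ord_c0 H); last by rewrite eq_sym; exists (ord_c0 H).
    by exists (Ordinal e1); rewrite ec.
  have [|u' eu] := vl _ (xd d *: W c).
    rewrite -scalemxAl hW scale_scalar_mx mulrC (sg_dual H).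
    by rewrite eq_sym (negPf cd) mul0r; apply/matrixP => i j; rewrite !mxE mul0rn.
  apply: (mmx_of_x0 H).
  have -> : x = xs d * xd d by rewrite (sg_dual H) eqxx mul1r.
  by rewrite -scalerA scalemxAl eu scalerA (sg_mx H) ?scale0r ?(sg_xs H).
suff h w : w *m l^T \in mmx 1 1.
  apply/mmxP => i j; rewrite ord1.
  have /mmxP/(_ ord0 ord0) := h (delta_mx 0 j).
  by rewrite -rowE !mxE.
have wm : w *m C 0%N \in mmx 1 (n 0%N) by rewrite mmx_mull.
have [A [t eA]] := mmx_gen H wm.
pose c := ord_c0 H.
(* [w1] has the same image as w under [C 0]; its last term accounts for the socle part x t, because
   x = xs c xd c. *)
pose w1 := \sum_d row d A *m W d + (xd c *: t) *m W c.
have ww : (w - w1) *m C 0%N = 0.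
  rewrite mulmxBl eA mulmxDl -[(_ *m W c) *m _]mulmxA hW mul_mx_scalar.
  rewrite scalerA -x_prod genrowE mulmx_suml.
  have -> : \sum_d row d A *m W d *m C 0%N = \sum_d xs d *: row d A.
    by apply: eq_bigr => d _; rewrite -mulmxA hW mul_mx_scalar.
  by rewrite subrr.
rewrite -[w](subrK w1) mulmxDl rpredD //; first by rewrite mmx_mulr ?kerC.
rewrite mulmxDl rpredD //; last by rewrite -mulmxA mmx_mull.
by rewrite mulmx_suml rpred_sum // => d _; rewrite -mulmxA mmx_mull.
Qed.

Lemma koszul_residue j : koszul (C j).
Proof.
elim/ltn_ind: j => -[|[|j]] IH.
- exact: koszul_residue0.
- exact: koszul_residue1.
(* Here C plays the role of D as well, with first rank 1 < j. *)
- by apply: koszul_of_residue => //; rewrite n0.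
Qed.

End ResidueField.

Lemma koszul_eventually b D i : @resolution R b D -> (forall j, D j \in mmx _ _) ->
  (b 0%N < i)%N -> koszul (D i).
Proof.
move=> resD hD bi.
have [|n [C [K [[n0 hK] imC resC hC]]]] := @minimal_resolution
    (fun n K => n = 1%N /\ forall v, v \in K <-> v \in mmx 1 n).
  by exists 1%N, (mmx 1 1).
have imC0 v : v \in mmx 1 (n 0%N) <-> exists w, v = w *m C 0%N.
  by rewrite -hK.
have hC' j : C j \in mmx _ _.
  case: j => // ; apply: mmx_rows => k.
  by rewrite rowE; apply/imC0; exists (delta_mx 0 k).
apply: (@koszul_of_residue n C resC n0 hC' b D i resD hD) => //.
  exact: leq_ltn_trans bi.
by move=> j _; apply: koszul_residue.
Qed.

Section Betti.
Variables (b : nat -> nat) (D : forall j, 'M[R]_(b j.+1, b j)).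
Hypothesis resD : resolution D.
Hypothesis hD : forall j, D j \in mmx _ _.

Definition xmx p q : submodClosed 'M[R]_(p, q) :=
  imsub (scalelin 'M[R]_(p, q) x) fullsub.

Lemma xmxP p q (A : 'M[R]_(p, q)) : reflect (exists B, A = x *: B) (A \in xmx p q).
Proof.
apply: (iffP (mksubP _ _)) => [[B _ ->]|[B ->]]; first by exists B.
by exists B; rewrite ?in_fullsub.
Qed.

Lemma xmx_mmx p q : {subset xmx p q <= mmx p q}.
Proof. by move=> _ /xmxP[B ->]; apply: mmx_scale (sg_x H). Qed.

Lemma len_xmx p q : len zerosub (xmx p q) = (p * q)%N.
Proof.
rewrite -(len_mmx H p q); apply/esym.
apply: (len_iso (f := scalelin 'M[R]_(p, q) x)).
- exact: sub_full.
- by move=> _ /mksubP ->; rewrite rpred0.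
- by move=> v _; apply/xmxP; exists v.
- move=> v _; apply/idP/idP => [/mksubP|/(mmx_x0 H) h]; last exact/mksubP.
  exact: (mmx_of_x0 H).
- by move=> _ /xmxP[B ->]; exists B; rewrite ?in_fullsub // subrr rpred0.
Qed.

(** With F = R^(b (i+1)), m F / x F has length e b (i+1). The image of D (i+1) lies between: modulo
    x F it is (R/m)^(b (i+2)), and m F modulo it is carried by [D i] onto x R^(b i), of length b
    i. *)
Lemma betti_recursion i : koszul (D i) -> koszul (D i.+1) ->
  (e * b i.+1 = b i.+2 + b i)%N.
Proof.
move=> k0 k1.
pose I : submodClosed 'rV[R]_(b i.+1) := imsub (mulrlin 1 (D i.+1)) fullsub.
have xI : {subset xmx 1 (b i.+1) <= I}.
  by move=> _ /xmxP[u ->]; have [W ->] := k1 u; apply/mksubP; exists (X *m W); rewrite ?in_fullsub.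
have Im : {subset I <= mmx 1 (b i.+1)}.
  by move=> _ /mksubP[w _ ->]; rewrite mklinE mmx_mull.
have -> : (e * b i.+1)%N = len (xmx 1 (b i.+1)) (mmx 1 (b i.+1)).
  rewrite -(len_mmx H); apply: (len_iso (f := mullin (b i.+1) X)).
  - exact: sub_full.
  - exact: xmx_mmx.
  - by move=> v _; rewrite mmx_mulr ?(genrow_m H).
  - move=> W _; apply/xmxP/idP => [[u eu]|Wm]; last exact: (mmx_mm H (genrow_m H) Wm).
    apply: mmx_rows => d; apply: (mmx_of_x0 H).
    by rewrite -(xd_genrow H) eu scalerA (sg_mx H) ?scale0r ?(sg_xd H).
  - move=> v /(mmx_gen H)[W [t ->]]; exists W; first exact: in_fullsub.
    by apply/xmxP; exists (- t); rewrite opprD addNKr scalerN.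
rewrite (lenD (finlen_mx H (@xmx_mmx _ _)) xI Im).
congr (_ + _)%N.
  rewrite -[RHS]mul1n -(len_mmx H); apply/esym.
  apply: (len_iso (f := mulrlin 1 (D i.+1))) => //.
  - exact: sub_full.
  - by move=> v _; apply/mem_imsub/in_fullsub.
  (* If w D (i+1) = x u, the Koszul property provides X W with the same image, and the difference is
     a boundary, hence over m. *)
  - move=> w _; apply/xmxP/idP => [[u eu]|wm]; last exact: (mmx_mm H wm (hD _)).
    have [W eW] := k1 u; have : (w - X *m W) *m D i.+1 = 0.
      by rewrite mulmxBl -eW -eu subrr.
    move=> /resD.2[w' ew]; rewrite -[w](subrK (X *m W)) rpredD //.
      by rewrite ew mmx_mull.
    by rewrite mmx_mulr ?(genrow_m H).
  - move=> _ /mksubP[w _ ->]; exists w; first exact: in_fullsub.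
    by rewrite subrr rpred0.
rewrite -[RHS]mul1n -(len_xmx 1 (b i)); apply: (len_iso (f := mulrlin 1 (D i))) => //.
- by move=> _ /mksubP ->; rewrite rpred0.
- by move=> v vm; apply/xmxP; exact: (mmx_mm H vm (hD _)).
- move=> v _; apply/mksubP/mksubP => [/resD.2[w ->]|[w _ ->]].
    by exists w; rewrite ?in_fullsub.
  by rewrite !mklinE -mulmxA resD.1 mulmx0.
- move=> _ /xmxP[u ->]; have [W eW] := k0 u; exists (X *m W).
    by rewrite mmx_mulr ?(genrow_m H).
  by rewrite eW subrr rpred0.
Qed.

End Betti.

End MinimalResolutions.

(** * Tor of two resolutions in matrix form *)

Section TorMatrices.
Variable R : comNzRingType.

Definition iml p q n (P : 'M[R]_(n, p)) : submodClosed 'M[R]_(n, q) :=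
  imsub (mullin q P) fullsub.

Definition imr p q n (Q : 'M[R]_(q, n)) : submodClosed 'M[R]_(p, n) :=
  imsub (mulrlin p Q) fullsub.

Lemma imlP p q n (P : 'M[R]_(n, p)) (B : 'M_(n, q)) :
  reflect (exists A, B = P *m A) (B \in iml q P).
Proof.
by apply: (iffP (mksubP _ _)) => [[A _ ->]|[A ->]]; exists A; rewrite ?in_fullsub.
Qed.

Lemma imrP p q n (Q : 'M[R]_(q, n)) (B : 'M_(p, n)) :
  reflect (exists A, B = A *m Q) (B \in imr p Q).
Proof.
by apply: (iffP (mksubP _ _)) => [[A _ ->]|[A ->]]; exists A; rewrite ?in_fullsub.
Qed.

Variables (b : nat -> nat) (D : forall i, 'M[R]_(b i.+1, b i)).
Variables (n : nat -> nat) (C : forall j, 'M[R]_(n j.+1, n j)).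

(* The boundaries and cycles of degree [i] of the complex
   [R^(b i) (x) coker (C j)], pulled back to [R^(b i) (x) R^(n j)]. *)
Definition torB i j : submodClosed 'M[R]_(b i, n j) :=
  addsub (iml (n j) (D i)^T) (imr (b i) (C j)).

Definition torZ i j : submodClosed 'M[R]_(b i, n j) :=
  match i return submodClosed 'M[R]_(b i, n j) with
  | 0%N => fullsub
  | i'.+1 => presub (mullin (n j) (D i')^T) (imr (b i') (C j))
  end.

Definition torlen i := len (torB i 0) (torZ i 0).

Lemma torBP i j A :
  reflect (exists B F, A = (D i)^T *m B + F *m C j) (A \in torB i j).
Proof.
apply: (iffP (mksubP _ _)) => [[_ [_ [/imlP[B ->] /imrP[F ->] ->]]]|].
  by exists B, F.
move=> [B [F ->]]; exists ((D i)^T *m B), (F *m C j); split=> //.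
  by apply/imlP; exists B.
by apply/imrP; exists F.
Qed.

Lemma torZP i j A :
  reflect (exists F, (D i)^T *m A = F *m C j) (A \in torZ i.+1 j).
Proof.
by apply: (iffP (mksubP _ _)) => [/imrP|h]; last apply/imrP.
Qed.

Hypothesis resD : resolution D.

Lemma resolution_col i q (A : 'M_(b i.+1, q)) :
  (D i)^T *m A = 0 -> exists B, A = (D i.+1)^T *m B.
Proof.
move=> /(congr1 trmx); rewrite trmx_mul trmxK trmx0 => /(resolution_mx resD)[B eB].
by exists B^T; rewrite -trmx_mul -eB trmxK.
Qed.

Lemma resolution_col0 i q (B : 'M_(b i.+2, q)) :
  (D i)^T *m ((D i.+1)^T *m B) = 0.
Proof. by rewrite mulmxA -trmx_mul resD.1 trmx0 mul0mx. Qed.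

Lemma torBZ i j : {subset torB i j <= torZ i j}.
Proof.
case: i => [|i] A; first by move=> _; exact: in_fullsub.
move=> /torBP[B [F ->]]; apply/torZP; exists ((D i)^T *m F).
by rewrite mulmxDr resolution_col0 add0r mulmxA.
Qed.

(** [midZ] / [midB] is im (D i)^T meeting im (C j), modulo (D i)^T * C j. Multiplication by (D i)^T
    maps Tor at (i + 1, j) onto it, and multiplication by C j maps Tor at (i, j + 1) onto it when i
    > 0; this is dimension shifting without a double complex. *)
Definition midB i j : submodClosed 'M[R]_(b i, n j) :=
  imsub (mullin (n j) (D i)^T) (imr (b i.+1) (C j)).

Definition midZ i j : submodClosed 'M[R]_(b i, n j) :=
  capsub (iml (n j) (D i)^T) (imr (b i) (C j)).

Lemma midBP i j A :
  reflect (exists F, A = (D i)^T *m F *m C j) (A \in midB i j).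
Proof.
apply: (iffP (mksubP _ _)) => [[_ /imrP[F ->] ->]|[F ->]].
  by exists F; rewrite -mulmxA.
by exists (F *m C j); [apply/imrP; exists F | rewrite -mulmxA].
Qed.

Lemma midZP i j A : reflect ((exists B, A = (D i)^T *m B) /\ exists F, A = F *m C j)
  (A \in midZ i j).
Proof.
by apply: (iffP (mksubP _ _)) => -[h h']; split; try exact/imlP; exact/imrP.
Qed.

Lemma midBZ i j : {subset midB i j <= midZ i j}.
Proof.
move=> _ /midBP[F ->]; apply/midZP; split; last by exists ((D i)^T *m F).
by exists (F *m C j); rewrite mulmxA.
Qed.

Hypothesis resC : resolution C.

Lemma len_tor_mid i j :
  len (torB i.+1 j) (torZ i.+1 j) = len (midB i j) (midZ i j).
Proof.
apply: (len_iso (f := mullin (n j) (D i)^T)).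
- exact: torBZ.
- exact: midBZ.
- move=> A /torZP[F eF]; apply/midZP; split; first by exists A.
  by exists F.
- move=> A _; apply/midBP/torBP => [[F eF]|[B [F ->]]]; last first.
    by exists F; rewrite [LHS]mulmxDr resolution_col0 add0r mulmxA.
  have : (D i)^T *m (A - F *m C j) = 0 by rewrite mulmxBr mulmxA -eF subrr.
  by move=> /resolution_col[B eB]; exists B, F; rewrite -eB subrK.
- move=> _ /midZP[[B ->] [F eF]]; exists B; first by apply/torZP; exists F.
  by rewrite subrr rpred0.
Qed.

Lemma len_tor_mid_shift i j :
  len (torB i.+1 j.+1) (torZ i.+1 j.+1) = len (midB i.+1 j) (midZ i.+1 j).
Proof.
apply: (len_iso (f := mulrlin (b i.+1) (C j))).
- exact: torBZ.
- exact: midBZ.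
- move=> A /torZP[F eF]; apply/midZP; split; last by exists A.
  by apply: resolution_col; rewrite mulmxA eF -mulmxA resC.1 mulmx0.
- move=> A _; apply/midBP/torBP => [[F eF]|[B [F ->]]]; last first.
    by exists B; rewrite [LHS]mulmxDl -[F *m _ *m _]mulmxA resC.1 mulmx0 addr0.
  have : (A - (D i.+1)^T *m F) *m C j = 0 by rewrite mulmxBl -eF subrr.
  move=> /(resolution_mx resC)[B eB]; exists F, B.
  by rewrite -eB subrKC.
- move=> _ /midZP[[B ->] [F eF]]; exists F; last by rewrite eF subrr rpred0.
  apply/torZP; apply: (resolution_mx resC).
  by rewrite -mulmxA -eF resolution_col0.
Qed.

Lemma len_mid_shift i j k :
  len (midB (i + k) j) (midZ (i + k) j) = len (midB i (j + k)) (midZ i (j + k)).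
Proof.
elim: k i j => [|k IH] i j; first by rewrite !addn0.
by rewrite addnS -len_tor_mid_shift len_tor_mid IH addnS addSn.
Qed.

End TorMatrices.

Section TorCount.
Variables (R : comNzRingType) (m : submodClosed R^o) (e : nat).
Variables (xs xd : 'I_e -> R) (x : R).
Hypothesis H : short_gorenstein m xs xd x.

Local Notation mmx := (mmx m).
Local Notation X := (genrow xs).
Local Notation koszul := (koszul xs x).

Section Dimension.
Variables (b : nat -> nat) (D : forall i, 'M[R]_(b i.+1, b i)).
Hypothesis resD : resolution D.
Hypothesis hD : forall j, D j \in mmx _ _.

(** A matrix w separating x B from all (D i)^T A C 0 would satisfy D i w (C 0)^T = 0; its transpose
    then lies over m, so w pairs to zero with x B. *)
Lemma socle_in_product n C : @resolution R n C -> (forall j, C j \in mmx _ _) ->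
  (forall j, koszul (C j)) -> forall i, (0 < i)%N -> (n 0%N + b 0%N <= i)%N ->
  forall B, exists A, x *: B = (D i)^T *m A *m C 0%N.
Proof.
move=> resC hC kC i i0 ni B.
apply/midBP; apply/negPn/negP => /(sg_sep H)[w wS]; rewrite trform_scale.
suff wm : w \in mmx _ _ by rewrite (mmx_x0 H wm) trform0r eqxx.
rewrite -mmx_tr.
apply: (@mmx_of_annihilated _ _ _ _ _ _ H i b (fun t => (D t)^T) n C w^T) => //.
- by move=> t _; apply: resolution_tr H _ _ resD _.
- by move=> t; rewrite mmx_tr.
apply: trmx_inj; rewrite trmx0 !trmx_mul !trmxK mulmxA.
apply: trform_eq0 => A; rewrite -[D i]trmxK -trformMr -trformMl.
by apply: wS; apply/midBP; exists A; rewrite mulmxA.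
Qed.

Section Count.
Variables (n : nat -> nat) (C : forall j, 'M[R]_(n j.+1, n j)).
Hypothesis resC : resolution C.
Variable j : nat.
Hypothesis hCj : C j \in mmx _ _.
Hypothesis hCj1 : C j.+1 \in mmx _ _.
Variable i : nat.
Hypothesis full : forall B, exists A, x *: B = (D i)^T *m A *m C j.
Hypothesis full1 : forall B, exists A, x *: B = (D i.+1)^T *m A *m C j.

(** The boundaries are all matrices over m: A C j = x G is also (D (i+1))^T F C j, so A and (D
    (i+1))^T F differ by a matrix with rows in im C (j+1). The cycles are the kernel of A -> (D i)^T
    A C j, whose image is the whole socle. *)
Lemma len_tor_stable :
  (len (torB D C i.+1 j.+1) (torZ D C i.+1 j.+1) + b i * n j = b i.+1 * n j.+1)%N.
Proof.
have TE : torB D C i.+1 j.+1 =i mmx (b i.+1) (n j.+1).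
  move=> A; apply/torBP/idP => [[B [F ->]]|Am].
    by rewrite rpredD ?(mmx_mull F) ?mmx_mulr ?mmx_tr.
  have [G eG] := mmx_mm H Am hCj; have [F eF] := full1 G.
  have : (A - (D i.+1)^T *m F) *m C j = 0 by rewrite mulmxBl eG eF subrr.
  by move=> /(resolution_mx resC)[B eB]; exists F, B; rewrite -eB subrKC.
have TZ := @torBZ _ _ D _ C resD i.+1 j.+1.
have mZ : {subset mmx _ _ <= torZ D C i.+1 j.+1} by move=> A; rewrite -TE; apply: TZ.
rewrite (len_ext TZ TE (fun=> erefl)) -(len_mmx H (b i.+1) (n j.+1)).
rewrite [RHS](lenD (finlen_mx H (@sub_full _ _ _)) mZ (@sub_full _ _ _)).
congr (_ + _)%N; rewrite -(len_xmx H); apply/esym.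
have lf : linear (fun A : 'M[R]_(b i.+1, n j.+1) => (D i)^T *m A *m C j).
  by move=> a A B; rewrite mulmxDr mulmxDl -scalemxAr -scalemxAl.
apply: (len_iso (f := mklin lf)).
- exact: sub_full.
- by move=> _ /mksubP ->; rewrite rpred0.
- move=> A _; apply/xmxP; apply: (mmx_mm H) => //.
  by rewrite mmx_mulr // mmx_tr.
- move=> A _; apply/mksubP/torZP => [/(resolution_mx resC)//|[F eF]].
  by rewrite mklinE eF -mulmxA resC.1 mulmx0.
- move=> _ /xmxP[B ->]; have [A ->] := full B.
  by exists A; rewrite ?in_fullsub // subrr rpred0.
Qed.

End Count.

Lemma tor_recursion n C : @resolution R n C -> (forall j, C j.+1 \in mmx _ _) ->
  exists K, forall k, (K <= k)%N ->
  (e * torlen D C k.+1 = torlen D C k.+2 + torlen D C k)%N.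
Proof.
(* [C 0] may fail to be over m, so [koszul_eventually] is applied to the resolution shifted by one,
   which requires n 1 < k - 1. *)
move=> resC hC; pose c := (n 1%N).+2.
have kC k : (c <= k)%N -> koszul (C k).
  by case: k => // k ck; apply: (koszul_eventually H (resolution_shift resC)).
have hC0 k : (0 < k)%N -> C k \in mmx _ _ by case: k => // k _; exact: hC.
have resC' : @resolution R (fun j => n (j + c)) (fun j => C (j + c)).
  by split=> j; [exact: resC.1 | exact: resC.2].
have full i : (n c + b 0%N < i)%N ->
    forall B : 'M_(b i, n c), exists A, x *: B = (D i)^T *m A *m C c.
  move=> ci; apply: (socle_in_product resC') => //; last exact: ltnW.
  - by move=> j; apply: (hC0 (j + c)%N); rewrite /c; lia.
  - by move=> j; apply: kC; exact: leq_addl.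
  - exact: leq_ltn_trans ci.
pose l := torlen D C.
(* Degree i + c + 2 is moved from position (i + c + 2, 0) to (i + 1, c + 1), where the stable count
   holds. *)
have lE i : (n c + b 0%N < i)%N ->
    (l (i + c).+2 + b i * n c = b i.+1 * n c.+1)%N.
  move=> ci; rewrite -(len_tor_stable resC (hC c.-1) (hC c) (full i ci)) //.
    by rewrite (len_tor_mid_shift resD resC) -(len_mid_shift resD resC _ 0) -len_tor_mid.
  by apply: full; exact: ltnW.
exists (n c + b 0%N + c).+3 => k Kk; rewrite -/l.
pose i := (k - c.+2)%N.
have -> : k = (i + c).+2 by rewrite /i; lia.
have ci : (n c + b 0%N < i)%N by rewrite /i; lia.
have h0 := lE i ci; have h1 := lE i.+1 (leqW ci).
have h2 := lE i.+2 (leqW (leqW ci)).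
have kD t : (i <= t)%N -> koszul (D t).
  by move=> it; apply: (koszul_eventually H resD hD); lia.
have r0 := betti_recursion H resD hD (kD i (leqnn i)) (kD i.+1 (leqnSn i)).
have r1 := betti_recursion H resD hD (kD i.+1 (leqnSn i)) (kD i.+2 (leqW (leqnSn i))).
move: h1 h2; rewrite !addSn => h1 h2.
(* c is fixed, so the lengths are a combination of two shifts of b with the constant coefficients n
   (c+1) and - n c; the recursion for b is therefore inherited. *)
have := congr1 (muln^~ (n c)) r0; have := congr1 (muln^~ (n c.+1)) r1.
move: (congr1 (muln e) h1); rewrite !mulnDr !mulnDl -!mulnA.
move: h0 h2; lia.
Qed.

End Dimension.
End TorCount.

(** * Comparison with the standard resolution *)

Section Projective.
Variable R : comNzRingType.

Definition projective (P : lmodType R) :=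
  forall (S T : lmodType R) (g : {linear S -> T}) (f : {linear P -> T}),
    (forall x, exists y, g y = f x) ->
    exists h : {linear P -> S}, forall x, g (h x) = f x.

Lemma free_mod_ext (K : choiceType) (V : lmodType R)
    (f g : {linear free_mod R K -> V}) :
  (forall k, f (basis_elt R k) = g (basis_elt R k)) -> f =1 g.
Proof.
move=> h x; have -> : x = \sum_(k <- msupp x) x@_k *: basis_elt R k.
  rewrite {1}[x]monalgE; apply: eq_bigr => k _.
  by apply/malgP => k'; rewrite mcoeffZ !mcoeffU mulrnAr mulr1.
by rewrite !linear_sum; apply: eq_bigr => k _; rewrite !linearZZ h.
Qed.

Lemma projective_free (K : choiceType) : projective (free_mod R K).
Proof.
move=> S T g f h.
pose y k := projT1 (cid (h (basis_elt R k))).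
have yP k : g (y k) = f (basis_elt R k) := projT2 (cid (h (basis_elt R k))).
exists (free_lift y : {linear free_mod R K -> S}).
apply: (@free_mod_ext K T (g \o free_lift y : {linear _ -> _}) f) => k /=.
by rewrite free_lift_basis.
Qed.

Lemma row_lin_sum n (V : lmodType R) (f : {linear 'rV[R]_n -> V}) v :
  f v = \sum_j v 0 j *: f (delta_mx 0 j).
Proof.
rewrite {1}[v]row_sum_delta linear_sum.
by apply: eq_bigr => j _; rewrite linearZZ.
Qed.

Fact rowlift_subproof n (V : lmodType R) (y : 'I_n -> V) :
  linear (fun v : 'rV[R]_n => \sum_j v 0 j *: y j).
Proof.
move=> a u v; rewrite scaler_sumr -big_split; apply: eq_bigr => j _ /=.
by rewrite !mxE scalerDl scalerA.
Qed.
Definition rowlift n (V : lmodType R) (y : 'I_n -> V) := mklin (rowlift_subproof y).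

Lemma rowlift_delta n (V : lmodType R) (y : 'I_n -> V) k :
  rowlift y (delta_mx 0 k) = y k.
Proof.
rewrite mklinE (bigD1 k) //= mxE !eqxx scale1r big1 ?addr0 // => j /negPf jk.
by rewrite mxE eqxx jk scale0r.
Qed.

Lemma projective_row n : projective 'rV[R]_n.
Proof.
move=> S T g f h.
pose y (k : 'I_n) := projT1 (cid (h (delta_mx 0 k))).
have yP k : g (y k) = f (delta_mx 0 k) := projT2 (cid (h (delta_mx 0 k))).
exists (rowlift y) => x.
rewrite [RHS]row_lin_sum mklinE linear_sum; apply: eq_bigr => k _.
by rewrite linearZZ yP.
Qed.

Fact sublin_subproof (U V : lmodType R) (f g : {linear U -> V}) :
  linear (fun x => f x - g x).
Proof. by move=> a x y; rewrite (linearP f) (linearP g) scalerBr opprD addrACA. Qed.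
Definition sublin (U V : lmodType R) (f g : {linear U -> V}) :=
  mklin (sublin_subproof f g).

Lemma sublinE (U V : lmodType R) (f g : {linear U -> V}) x :
  sublin f g x = f x - g x.
Proof. by []. Qed.

(** Index 0 is the resolved module and [d 0] the augmentation, so that lifts and homotopies start
    from given data in one uniform recursion. *)
Definition acyclic (X : nat -> lmodType R) (d : forall j, {linear X j.+1 -> X j}) :=
  (forall y, exists x, d 0%N x = y) /\
  (forall j x, d j x = 0 <-> exists y, d j.+1 y = x).

Section Comparison.
Variables (X Y : nat -> lmodType R).
Variables (d : forall j, {linear X j.+1 -> X j}) (d' : forall j, {linear Y j.+1 -> Y j}).
Hypothesis projX : forall j, projective (X j.+1).
Hypothesis acX : acyclic d.
Hypothesis acY : acyclic d'.

Lemma chain_map (a : {linear X 0%N -> Y 0%N}) :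
  exists u : forall j, {linear X j -> Y j},
    (forall x, u 0%N x = a x) /\ forall j x, d' j (u j.+1 x) = u j (d j x).
Proof.
(* The recursion must carry the solvability of the next lifting problem along with the map. *)
pose T j := {u : {linear X j -> Y j} | forall x, exists y, d' j y = u (d j x)}.
have [||f [f0 fS]] := @dependent_choice T (fun u => forall x, sval u x = a x)
    (fun j u v => forall x, d' j (sval v x) = sval u (d j x)).
- have h x : exists y, d' 0%N y = a (d 0%N x) by apply: acY.1.
  by exists (exist _ a h).
- move=> j [u hu].
  have [v hv] := projX (g := d' j) (f := u \o d j : {linear _ -> _}) hu.
  have h x : exists y, d' j.+1 y = v (d j.+1 x).
    apply/acY.2; rewrite hv /=; have /acX.2 -> : exists y, d j.+1 y = d j.+1 x.
      by exists x.
    by rewrite linear0.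
  by exists (exist _ v h).
by exists (fun j => sval (f j)).
Qed.

Lemma null_homotopy (w : forall j, {linear X j -> X j}) :
  (forall x, w 0%N x = 0) -> (forall j x, d j (w j.+1 x) = w j (d j x)) ->
  exists h : forall j, {linear X j -> X j.+1},
    (forall x, h 0%N x = 0) /\
    forall j x, w j.+1 x = d j.+1 (h j.+1 x) + h j (d j x).
Proof.
move=> w0 wd.
(* This invariant makes w - h d land in the cycles, so that projectivity yields the next
   homotopy. *)
pose T j := {h : {linear X j -> X j.+1} |
  forall x, d j (h (d j x)) = w j (d j x)}.
have [||f [f0 fS]] := @dependent_choice T (fun h => forall x, sval h x = 0)
    (fun j h h' => forall x, w j.+1 x = d j.+1 (sval h' x) + sval h (d j x)).
- have h x : d 0%N ((\0 : {linear X 0%N -> X 1%N}) (d 0%N x)) = w 0%N (d 0%N x).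
    by rewrite w0 /= linear0.
  by exists (exist _ (\0 : {linear X 0%N -> X 1%N}) h).
- move=> j [h hh].
  have [|h' hh'] := projX (g := d j.+1)
      (f := sublin (w j.+1) (h \o d j : {linear _ -> _})).
    by move=> x; apply/acX.2; rewrite sublinE linearB /= wd hh subrr.
  have k x : d j.+1 (h' (d j.+1 x)) = w j.+1 (d j.+1 x).
    rewrite hh' sublinE /=; have /acX.2 -> : exists y, d j.+1 y = d j.+1 x by exists x.
    by rewrite linear0 subr0.
  by exists (exist _ h' k) => x; rewrite /= hh' sublinE subrK.
by exists (fun j => sval (f j)).
Qed.

End Comparison.

Lemma comparison (X Y : nat -> lmodType R)
    (d : forall j, {linear X j.+1 -> X j}) (d' : forall j, {linear Y j.+1 -> Y j})
    (a : {linear X 0%N -> Y 0%N}) (a' : {linear Y 0%N -> X 0%N}) :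
  (forall j, projective (X j.+1)) -> (forall j, projective (Y j.+1)) ->
  acyclic d -> acyclic d' -> cancel a a' -> cancel a' a ->
  exists (u : forall j, {linear X j -> Y j}) (v : forall j, {linear Y j -> X j})
    (h : forall j, {linear X j -> X j.+1}) (h' : forall j, {linear Y j -> Y j.+1}),
    [/\ (forall j x, d' j (u j.+1 x) = u j (d j x)) /\
        (forall j x, d j (v j.+1 x) = v j (d' j x)),
        forall x, h 0%N x = 0, forall x, h' 0%N x = 0,
        forall j x, x - v j.+1 (u j.+1 x) = d j.+1 (h j.+1 x) + h j (d j x) &
        forall j x, x - u j.+1 (v j.+1 x) = d' j.+1 (h' j.+1 x) + h' j (d' j x)].
Proof.
move=> pX pY acX acY aK a'K.
have [u [u0 ud]] := chain_map pX acX acY a.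
have [v [v0 vd]] := chain_map pY acY acX a'.
have [||h [h0 hd]] := null_homotopy pX acX
    (w := fun j => sublin (idfun : {linear X j -> X j}) (v j \o u j : {linear _ -> _})).
- by move=> x; rewrite sublinE /= u0 v0 aK subrr.
- by move=> j x; rewrite [in RHS]sublinE sublinE linearB /= vd ud.
have [||h' [h'0 hd']] := null_homotopy pY acY
    (w := fun j => sublin (idfun : {linear Y j -> Y j}) (u j \o v j : {linear _ -> _})).
- by move=> x; rewrite sublinE /= v0 u0 a'K subrr.
- by move=> j x; rewrite [in RHS]sublinE sublinE linearB /= ud vd.
by exists u, v, h, h'.
Qed.

End Projective.

Section StandardResolution.
Variables (R : comNzRingType) (M : lmodType R).

Definition aug (P : nat -> lmodType R) j : lmodType R :=
  if j is i.+1 then P i else M.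

Definition aug_d (P : nat -> lmodType R) (eps : {linear P 0%N -> M})
    (d : forall i, {linear P i.+1 -> P i}) j : {linear aug P j.+1 -> aug P j} :=
  match j return {linear aug P j.+1 -> aug P j} with
  | 0%N => eps
  | i.+1 => d i
  end.

Lemma acyclic_res : acyclic (aug_d (res_aug M) (@res_d R M)).
Proof.
split; first exact: free_cover_surj.
by case=> [|j] x; [exact: res_exact0 | exact: res_exact].
Qed.

Variables (b : nat -> nat) (D : forall i, 'M[R]_(b i.+1, b i)).
Variable eps : {linear 'rV[R]_(b 0%N) -> M}.
Hypothesis eps_surj : forall y, exists v, eps v = y.
Hypothesis eps_ker : forall v, eps v = 0 <-> exists w, v = w *m D 0%N.
Hypothesis resD : resolution D.

Lemma acyclic_resolution :
  acyclic (aug_d (P := fun i => 'rV[R]_(b i)) eps (fun i => mulrlin 1 (D i))).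
Proof.
split=> // -[|j] v.
  change (eps v = 0 <-> exists w : 'rV_(b 1%N), w *m D 0%N = v).
  by rewrite eps_ker; split=> -[w ew]; exists w.
change (v *m D j = 0 <-> exists w : 'rV_(b j.+2), w *m D j.+1 = v).
split=> [/resD.2[w ->]|[w <-]]; first by exists w.
by rewrite -mulmxA resD.1 mulmx0.
Qed.

Lemma res_comparison :
  exists (u : forall i, {linear res M i -> 'rV[R]_(b i)})
    (v : forall i, {linear 'rV[R]_(b i) -> res M i})
    (h : forall i, {linear res M i -> res M i.+1})
    (h' : forall i, 'M[R]_(b i, b i.+1)),
  [/\ (forall i s, u i (res_d M i s) = u i.+1 s *m D i) /\
      (forall i r, res_d M i (v i.+1 r) = v i (r *m D i)),
      forall s, s - v 0%N (u 0%N s) = res_d M 0 (h 0%N s),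
      forall i s, s - v i.+1 (u i.+1 s) =
        res_d M i.+1 (h i.+1 s) + h i (res_d M i s),
      forall r, r - u 0%N (v 0%N r) = r *m h' 0%N *m D 0%N &
      forall i r, r - u i.+1 (v i.+1 r) =
        r *m h' i.+1 *m D i.+1 + r *m D i *m h' i].
Proof.
have [||u [v [h [h' [[ud vd] h0 h'0 hd hd']]]]] :=
  @comparison R (aug (res M)) (aug (fun i => 'rV[R]_(b i))) _ _
    (idfun : {linear M -> M}) (idfun : {linear M -> M}) _ _ acyclic_res
    acyclic_resolution (fun=> erefl) (fun=> erefl).
- by move=> j; apply: projective_free.
- by move=> j; apply: projective_row.
exists (fun i => u i.+1), (fun i => v i.+1), (fun i => h i.+1),
  (fun i => lin1_mx (h' i.+1)).
split=> [|s|i s|r|i r].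
- by split=> i s; [rewrite -[LHS](ud i.+1) | rewrite [LHS](vd i.+1)].
- by rewrite [LHS](hd 0%N) [X in _ + X]h0 addr0.
- exact: (hd i.+1).
- by rewrite [LHS](hd' 0%N) [X in _ + X]h'0 addr0 mul_rV_lin1.
- by rewrite [LHS](hd' i.+1) !mul_rV_lin1.
Qed.

End StandardResolution.

Section TensorLift.
Variables (R : comNzRingType) (U V W : lmodType R).

Lemma tensor_ext (f g : {linear tensor U V -> W}) :
  (forall x y, f (tens x y) = g (tens x y)) -> f =1 g.
Proof.
move=> h t; rewrite -[t]qreprK.
apply: (@free_mod_ext _ _ _ (f \o qpi _ : {linear _ -> _})
  (g \o qpi _ : {linear _ -> _})) => -[x y] /=.
exact: h.
Qed.

Lemma tensor_lift (f : U -> V -> W) :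
  (forall y, linear (f^~ y)) -> (forall x, linear (f x)) ->
  exists g : {linear tensor U V -> W}, forall x y, g (tens x y) = f x y.
Proof.
move=> fl fr; pose F : {linear free_mod R (U * V)%type -> W} :=
  free_lift (fun p : U * V => f p.1 p.2).
have Fb x y : F (basis_elt R (x, y)) = f x y by rewrite /F /= free_lift_basis.
have fDl x x' y : f (x + x') y = f x y + f x' y.
  by have := fl y 1 x x'; rewrite !scale1r.
have fDr x y y' : f x (y + y') = f x y + f x y'.
  by have := fr x 1 y y'; rewrite !scale1r.
have f0l y : f 0 y = 0 by apply: (addrI (f 0 y)); rewrite -fDl !addr0.
have f0r x : f x 0 = 0 by apply: (addrI (f x 0)); rewrite -fDr !addr0.
have fZl a x y : f (a *: x) y = a *: f x y.
  by have := fl y a x 0; rewrite !addr0 f0l addr0.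
have fZr a x y : f x (a *: y) = a *: f x y.
  by have := fr x a y 0; rewrite !addr0 f0r addr0.
have Frel : {subset Defs.sub_span (@bilinear_relation R U V) <= ker F}.
  apply: sub_span_sub => _ [x x' y|x y y'|a x y|a x y]; apply/kerP.
  - by rewrite 2!linearB !Fb fDl addrAC addrK subrr.
  - by rewrite 2!linearB !Fb fDr addrAC addrK subrr.
  - by rewrite linearB linearZZ !Fb fZl subrr.
  - by rewrite linearB linearZZ !Fb fZr subrr.
have gpi z : F (qrepr (qpi (Defs.sub_span (@bilinear_relation R U V)) z)) = F z.
  apply/eqP; rewrite -subr_eq0 -linearB; apply/eqP/kerP/Frel/qpiP.
  exact: qreprK.
have lg : linear (fun t : tensor U V => F (qrepr t)).
  move=> a s t; rewrite -[s]qreprK -[t]qreprK -linearP !gpi.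
  exact: linearP.
by exists (mklin lg) => x y; rewrite mklinE gpi Fb.
Qed.

End TensorLift.

Definition tensor_lin (R : comNzRingType) (U U' V : lmodType R)
  (f : {linear U -> U'}) : {linear tensor U V -> tensor U' V} :=
  tensor_map (V := V) f.

Lemma tensor_lin_tens (R : comNzRingType) (U U' V : lmodType R)
  (f : {linear U -> U'}) x (y : V) : tensor_lin V f (tens x y) = tens (f x) y.
Proof. exact: tensor_map_tens. Qed.

Section MatrixAction.
Variables (R : comNzRingType) (N : lmodType R).

Fact mxact_subproof p q (A : 'M[R]_(p, q)) :
  linear (fun (w : 'I_p -> N) (j : 'I_q) => \sum_k A k j *: w k).
Proof.
move=> a v w; apply/funext => j; rewrite !fctE scaler_sumr -big_split.
apply: eq_bigr => k _ /=.
by rewrite scalerDr !scalerA mulrC.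
Qed.
(** This is A tensored with N, with R^p (x) N written as the functions from 'I_p to N. *)
Definition mxact p q (A : 'M[R]_(p, q)) : {linear ('I_p -> N) -> ('I_q -> N)} :=
  mklin (@mxact_subproof p q A).

Lemma mxactE p q (A : 'M[R]_(p, q)) w j : mxact A w j = \sum_k A k j *: w k.
Proof. by []. Qed.

Lemma mxactM p q r (A : 'M[R]_(p, q)) (B : 'M[R]_(q, r)) w :
  mxact (A *m B) w = mxact B (mxact A w).
Proof.
apply/funext => j; rewrite !mxactE.
under eq_bigr => k _ do rewrite mxE scaler_suml.
rewrite exchange_big; apply: eq_bigr => l _; rewrite mxactE scaler_sumr.
by apply: eq_bigr => k _; rewrite scalerA mulrC.
Qed.

Lemma mxact1 p w : mxact (1%:M : 'M[R]_p) w = w.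
Proof.
apply/funext => j; rewrite mxactE (bigD1 j) //= mxE eqxx scale1r big1 ?addr0 //.
by move=> k /negPf kj; rewrite mxE kj scale0r.
Qed.

Lemma mxactD p q (A B : 'M[R]_(p, q)) w : mxact (A + B) w = mxact A w + mxact B w.
Proof.
apply/funext => j; rewrite !fctE !mxactE -big_split; apply: eq_bigr => k _.
by rewrite mxE scalerDl.
Qed.

End MatrixAction.

Section TorComparison.
Variables (R : comNzRingType) (M N : lmodType R).
Variables (b : nat -> nat) (D : forall i, 'M[R]_(b i.+1, b i)).
Variable eps : {linear 'rV[R]_(b 0%N) -> M}.
Hypothesis eps_surj : forall y, exists v, eps v = y.
Hypothesis eps_ker : forall v, eps v = 0 <-> exists w, v = w *m D 0%N.
Hypothesis resD : resolution D.

Variables (n : nat -> nat) (C : forall j, 'M[R]_(n j.+1, n j)).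
Variable p : {linear 'rV[R]_(n 0%N) -> N}.
Hypothesis p_surj : forall y, exists v, p v = y.
Hypothesis p_ker : forall v, p v = 0 <-> exists w, v = w *m C 0%N.

(** The comparison maps u and v tensored with N become [th] and [B], inverse up to homotopy; [ka]
    presents N^(b k) as matrices modulo im (C 0). The composite [B] after [ka] induces the
    isomorphism on homology. *)
Lemma Tor_length i l :
  has_length (Tor M N i) l <-> rlen (torB D C i 0) (torZ D C i 0) l.
Proof.
have [u [v [h [h' [[ud vd] hd0 hd hd'0 hd']]]]] :=
  res_comparison eps_surj eps_ker resD.
pose Ni k : lmodType R := 'I_(b k) -> N.
have [th thE] : exists th : forall k, {linear tensor (res M k) N -> Ni k},
    forall k s y, th k (tens s y) = (fun j => u k s 0 j *: y).
  have ex k : exists g : {linear tensor (res M k) N -> Ni k},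
      forall s y, g (tens s y) = (fun j => u k s 0 j *: y).
    apply: tensor_lift => [y a s s'|s a y y']; apply/funext => j; rewrite !fctE.
      by rewrite linearP !mxE scalerDl scalerA.
    by rewrite scalerDr !scalerA mulrC.
  exists (fun k => projT1 (cid (ex k))) => k; exact: projT2 (cid (ex k)).
have lB k : linear (fun w : Ni k => \sum_j tens (v k (delta_mx 0 j)) (w j)).
  move=> a w w'; rewrite scaler_sumr -big_split; apply: eq_bigr => j _ /=.
  by rewrite !fctE tensDr tensZr.
pose B k : {linear Ni k -> tensor (res M k) N} := mklin (lB k).
pose T k : {linear tensor (res M k.+1) N -> tensor (res M k) N} :=
  tensor_map (V := N) (res_d M k).
have Tt k s y : T k (tens s y) = tens (res_d M k s) y by exact: tensor_map_tens.
have tens_suml k (U : lmodType R) (f : 'I_k -> U) (y : N) :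
    tens (\sum_j f j) y = \sum_j tens (f j) y.
  elim/big_ind2: _ => [|x1 s1 x2 s2 <- <-|//]; last by rewrite tensDl.
  by apply: (addrI (tens 0 y)); rewrite -tensDl !addr0.
have vB k r y : tens (v k r) y = B k (fun j => r 0 j *: y).
  rewrite row_lin_sum tens_suml mklinE; apply: eq_bigr => j _.
  by rewrite tensZl tensZr.
have TB k w : T k (B k.+1 w) = B k (mxact N (D k) w).
  rewrite [B k.+1 w]mklinE linear_sum.
  transitivity (\sum_j B k (fun j' => D k j j' *: w j)).
    apply: eq_bigr => j _; rewrite Tt vd vB; congr (B k _).
    by apply/funext => j'; rewrite -rowE mxE.
  rewrite -linear_sum; congr (B k _); apply/funext => j.
  by rewrite fct_sumE mxactE.
have thT k z : th k (T k z) = mxact N (D k) (th k.+1 z).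
  apply: (@tensor_ext _ _ _ _ (th k \o T k : {linear _ -> _})
    (mxact N (D k) \o th k.+1 : {linear _ -> _})) => s y /=.
  rewrite Tt !thE; apply/funext => j.
  rewrite ud mxE scaler_suml; apply: eq_bigr => k' _.
  by rewrite scalerA mulrC.
have Bth k z : B k (th k z) = tensor_lin N (v k \o u k : {linear _ -> _}) z.
  apply: (@tensor_ext _ _ _ _ (B k \o th k : {linear _ -> _})) => s y /=.
  by rewrite thE tensor_lin_tens vB.
have tensB (U : lmodType R) (s s' : U) (y : N) : tens s y - tens s' y = tens (s - s') y.
  by rewrite -scaleN1r -tensZl -tensDl scaleN1r.
(* The homotopies show that both composites of [th] and [B] are the identity modulo boundaries, on
   everything in degree 0 and on cycles in higher degrees. *)
have hB0 z : exists z', z - B 0%N (th 0%N z) = T 0%N z'.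
  exists (tensor_lin N (h 0%N) z); rewrite Bth.
  apply: (@tensor_ext _ _ _ _
    (sublin idfun (tensor_lin N (v 0%N \o u 0%N : {linear _ -> _})))
    (T 0%N \o tensor_lin N (h 0%N) : {linear _ -> _})) => s y.
  by rewrite sublinE tensor_lin_tens [in RHS]/= tensor_lin_tens Tt -hd0 tensB.
have hBS k z : T k z = 0 -> exists z', z - B k.+1 (th k.+1 z) = T k.+1 z'.
  move=> Tz; exists (tensor_lin N (h k.+1) z); rewrite Bth.
  apply/eqP; rewrite -subr_eq0; apply/eqP.
  rewrite -[RHS](linear0 (tensor_lin N (h k))) -Tz.
  apply: (@tensor_ext _ _ _ _
    (sublin (sublin idfun (tensor_lin N (v k.+1 \o u k.+1 : {linear _ -> _})))
            (T k.+1 \o tensor_lin N (h k.+1) : {linear _ -> _}))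
    (tensor_lin N (h k) \o T k : {linear _ -> _})) => s y.
  change (tens s y - tensor_lin N (v k.+1 \o u k.+1 : {linear _ -> _}) (tens s y)
    - T k.+1 (tensor_lin N (h k.+1) (tens s y))
    = tensor_lin N (h k) (T k (tens s y))).
  by rewrite !(tensor_lin_tens, Tt) !tensB /= hd addrAC subrr add0r.
have thB k w : th k (B k w) = mxact N (lin1_mx (u k \o v k)) w.
  rewrite [B k w]mklinE linear_sum; apply/funext => j.
  rewrite fct_sumE mxactE; apply: eq_bigr => j' _.
  by rewrite thE mxE.
have dB0 w : exists w', w - th 0%N (B 0%N w) = mxact N (D 0%N) w'.
  exists (mxact N (h' 0%N) w).
  have e1 : 1%:M = h' 0%N *m D 0%N + lin1_mx (u 0%N \o v 0%N).
    apply/row_matrixP => j; rewrite !rowE mulmx1 mulmxDr mul_rV_lin1 mulmxA /=.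
    by rewrite -hd'0 subrK.
  by rewrite -{1}[w]mxact1 e1 mxactD mxactM thB addrK.
have dBS k w : mxact N (D k) w = 0 ->
    exists w', w - th k.+1 (B k.+1 w) = mxact N (D k.+1) w'.
  move=> Dw; exists (mxact N (h' k.+1) w).
  have e1 : 1%:M = h' k.+1 *m D k.+1 + D k *m h' k + lin1_mx (u k.+1 \o v k.+1).
    apply/row_matrixP => j; rewrite !rowE mulmx1 !mulmxDr mul_rV_lin1 !mulmxA /=.
    by rewrite -hd' subrK.
  rewrite -{1}[w]mxact1 e1 !mxactD !mxactM thB addrK Dw.
  by rewrite (linear0 (mxact N (h' k))) addr0.
have lk k : linear (fun (A : 'M[R]_(b k, n 0%N)) (j : 'I_(b k)) => p (row j A)).
  by move=> a A A'; apply/funext => j; rewrite !fctE !linearP.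
pose ka k : {linear 'M[R]_(b k, n 0%N) -> Ni k} := mklin (lk k).
have kaD k A : ka k ((D k)^T *m A) = mxact N (D k) (ka k.+1 A).
  apply/funext => j; rewrite mklinE row_mul mulmx_sum_row linear_sum mxactE.
  by apply: eq_bigr => j' _; rewrite linearZZ !mxE mklinE.
have kaK k A : ka k A = 0 <-> exists F, A = F *m C 0%N.
  split=> [/funeqP kA|[F ->]]; last first.
    by apply/funext => j; rewrite mklinE row_mul; apply/p_ker; exists (row j F).
  have ex j : exists w, row j A = w *m C 0%N by apply/p_ker; exact: kA j.
  exists (\matrix_j projT1 (cid (ex j))).
  by apply/row_matrixP => j; rewrite row_mul rowK -(projT2 (cid (ex j))).
have ka_surj k w : exists A, ka k A = w.
  pose r j := projT1 (cid (p_surj (w j))).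
  exists (\matrix_j r j); apply/funext => j; rewrite mklinE rowK.
  exact: projT2 (cid (p_surj (w j))).
(* S' and Z are the cycles of the tensor complex and of N^(b i); abstracting them treats degree 0,
   where all elements are cycles, together with the others. *)
have main (S' : submodClosed (tensor (res M i) N)) (Z : Ni i -> Prop) :
    {subset im (T i) <= S'} ->
    (forall z, z \in S' -> exists z', z - B i (th i z) = T i z') ->
    (forall z, z \in S' -> Z (th i z)) ->
    (forall w, Z w -> B i w \in S') ->
    (forall w, Z w -> exists w', w - th i (B i w) = mxact N (D i) w') ->
    (forall A, A \in torZ D C i 0 <-> Z (ka i A)) ->
    has_length (subquot S' (im (T i))) l <-> rlen (torB D C i 0) (torZ D C i 0) l.
  move=> TS c1 c2 c3 c4 c5; rewrite -(has_length_subquot _ TS); apply: iff_sym.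
  apply: (rlen_iso (f := B i \o ka i : {linear _ -> _})) => //.
  - exact: torBZ.
  - by move=> A /c5; apply: c3.
  - move=> A /c5 ZA; apply/imP/torBP => [[z Tz]|[G [F ->]]]; last first.
      have e1 : ka i ((D i)^T *m G + F *m C 0%N) = ka i ((D i)^T *m G).
        by rewrite linearD (proj2 (kaK i (F *m C 0%N))) ?addr0 //; exists F.
      by exists (B i.+1 (ka i.+1 G)); rewrite TB -kaD -e1.
    have {}Tz : T i z = B i (ka i A) by [].
    have [w' ew'] := c4 _ ZA.
    have [G eG] := ka_surj i.+1 (th i.+1 z + w').
    exists G; suff [F eF] : exists F, A - (D i)^T *m G = F *m C 0%N.
      by exists F; rewrite -eF subrKC.
    apply/kaK; rewrite linearB kaD eG linearD -thT Tz -ew'.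
    by rewrite subrKC subrr.
  - move=> z zS; have [A eA] := ka_surj i (th i z).
    exists A; first by apply/c5; rewrite eA; apply: c2.
    have [z' ez'] := c1 z zS; apply/imP; exists (- z').
    by rewrite linearN -ez' opprB -eA.
move: main; case: i => [|i] main.
  apply: (main (ker \0) (fun=> True)) => //.
  - by move=> z _; apply/kerP.
  - by move=> w _; apply/kerP.
  - by move=> A; split=> // _; exact: in_fullsub.
apply: (main (ker (T i)) (fun w => mxact N (D i) w = 0)) => //.
- move=> _ /imP[z <-]; apply/kerP.
  apply: (@tensor_ext _ _ _ _ (T i \o T i.+1 : {linear _ -> _}) \0) => s y.
  change (T i (T i.+1 (tens s y)) = 0).
  rewrite !Tt (_ : res_d M i (res_d M i.+1 s) = 0).
    by apply: (addrI (tens 0 y)); rewrite -tensDl !addr0.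
  by apply/res_exact; exists s.
- by move=> z /kerP; apply: hBS.
- by move=> z /kerP Tz; rewrite -thT Tz linear0.
- by move=> w Dw; apply/kerP; rewrite TB Dw linear0.
- by move=> w; apply: dBS.
- by move=> A; rewrite -kaD kaK; split=> [/torZP|h0]; last apply/torZP.
Qed.

End TorComparison.

(** * Ext and duality *)

Section HomModule.
Variables (R : comNzRingType) (U V : lmodType R).

Definition hom_fun (h : Defs.Hom U V) : U -> V := submod_val _ h.

Fact hom_fun_linear (h : Defs.Hom U V) : linear (hom_fun h).
Proof. by have /asboolP := submod_valP h. Qed.

Definition hom_lin (h : Defs.Hom U V) : {linear U -> V} := mklin (hom_fun_linear h).

Lemma hom_mk_subproof (f : {linear U -> V}) : (f : U -> V) \in @homp R U V.
Proof. by apply/asboolP => a x y; rewrite linearP. Qed.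

Definition hom_mk (f : {linear U -> V}) : Defs.Hom U V := submod_mk (hom_mk_subproof f).

Lemma hom_mkE f x : hom_lin (hom_mk f) x = f x.
Proof. by []. Qed.

Lemma hom_ext (h h' : Defs.Hom U V) : (forall x, hom_lin h x = hom_lin h' x) -> h = h'.
Proof. by move=> e; apply: submod_val_inj; apply/funext. Qed.

Lemma hom_linP (a : R) (h h' : Defs.Hom U V) x :
  hom_lin (a *: h + h') x = a *: hom_lin h x + hom_lin h' x.
Proof. by []. Qed.

Lemma hom_lin0 x : hom_lin (0 : Defs.Hom U V) x = 0.
Proof. by []. Qed.

End HomModule.

Section ExtComparison.
Variables (R : comNzRingType) (M N : lmodType R).
Variables (b : nat -> nat) (D : forall i, 'M[R]_(b i.+1, b i)).
Variable eps : {linear 'rV[R]_(b 0%N) -> M}.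
Hypothesis eps_surj : forall y, exists v, eps v = y.
Hypothesis eps_ker : forall v, eps v = 0 <-> exists w, v = w *m D 0%N.
Hypothesis resD : resolution D.

Variables (n : nat -> nat) (C : forall j, 'M[R]_(n j.+1, n j)).
Variable iota : {linear N -> 'rV[R]_(n 0%N)}.
Hypothesis iota_inj : injective iota.
Hypothesis iota_im : forall v, (exists y, iota y = v) <-> v *m (C 0%N)^T = 0.

Fact cokernel_prop p : submod_prop (fun A : 'M[R]_(p, n 0%N) => A *m (C 0%N)^T = 0).
Proof.
split=> [|a A B hA hB]; first by rewrite mul0mx.
by rewrite mulmxDl -scalemxAl hA hB scaler0 addr0.
Qed.

(* The matrices whose rows lie in the submodule [N] of [R^(n 0)]. *)
Definition rowsN p := mksub (@cokernel_prop p).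

Definition extB i : submodClosed 'M[R]_(b i, n 0%N) :=
  match i return submodClosed 'M[R]_(b i, n 0%N) with
  | 0%N => zerosub
  | i'.+1 => imsub (mullin (n 0%N) (D i')) (rowsN (b i'))
  end.

Definition extZ i : submodClosed 'M[R]_(b i, n 0%N) :=
  capsub (rowsN (b i)) (ker (mullin (n 0%N) (D i))).

Lemma extBZ i : {subset extB i <= extZ i}.
Proof.
case: i => [|i] A; first by move=> /mksubP ->; rewrite rpred0.
move=> /mksubP[Y /mksubP YC ->]; apply/mksubP; split.
  by apply/mksubP; rewrite mullinE -mulmxA YC mulmx0.
by apply/kerP; rewrite !mullinE mulmxA resD.1 mul0mx.
Qed.

(** Hom(R^(b k), N) is the module of matrices with rows in N. [Psi] restricts a map along v, [back]
    composes with u, and the homotopies make them inverse on cohomology. *)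
Lemma Ext_length i l : rlen (extB i) (extZ i) l -> has_length (Ext M N i) l.
Proof.
have [u [v [h [h' [[ud vd] hd0 hd hd'0 hd']]]]] :=
  res_comparison eps_surj eps_ker resD.
pose E k : {linear Defs.Hom (res M k) N -> Defs.Hom (res M k.+1) N} :=
  hom_map (V := N) (res_d M k).
have EE k g s : hom_lin (E k g) s = hom_lin g (res_d M k s) by [].
have lP k : linear (fun g : Defs.Hom (res M k) N =>
    \matrix_(j < b k) iota (hom_lin g (v k (delta_mx 0 j))) : 'M[R]_(b k, n 0%N)).
  by move=> a g g'; apply/matrixP => j j'; rewrite !mxE hom_linP linearP !mxE.
pose Psi k : {linear Defs.Hom (res M k) N -> 'M[R]_(b k, n 0%N)} := mklin (lP k).
have PsiE k g r : iota (hom_lin g (v k r)) = r *m Psi k g.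
  rewrite [LHS](row_lin_sum (iota \o hom_lin g \o v k : {linear _ -> _})) /=.
  by rewrite mulmx_sum_row; apply: eq_bigr => j _; rewrite rowK.
have PsiN k g : Psi k g \in rowsN (b k).
  apply/mksubP/row_matrixP => j; rewrite row_mul row0 rowE -PsiE.
  by apply/iota_im; exists (hom_lin g (v k (delta_mx 0 j))).
have PsiD k g : Psi k.+1 (E k g) = D k *m Psi k g.
  apply/row_matrixP => j; rewrite rowE -(PsiE k.+1 (E k g)) EE vd PsiE.
  by rewrite rowE mulmxA.
have back k A : A \in rowsN (b k) ->
    exists g : Defs.Hom (res M k) N, forall s, iota (hom_lin g s) = u k s *m A.
  move=> /mksubP AC.
  have ex j : exists y, iota y = row j A by apply/iota_im; rewrite -row_mul AC row0.
  exists (hom_mk (rowlift (fun j => projT1 (cid (ex j))) \o u k : {linear _ -> _})).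
  move=> s; rewrite hom_mkE /= mulmx_sum_row linear_sum; apply: eq_bigr => j _.
  by rewrite linearZZ (projT2 (cid (ex j))).
have main (T : submodClosed (Defs.Hom (res M i) N)) :
    {subset T <= ker (E i)} ->
    (forall g, g \in ker (E i) -> (Psi i g \in extB i) = (g \in T)) ->
    (forall g A, A \in extZ i -> (forall s, iota (hom_lin g s) = u i s *m A) ->
        Psi i g - A \in extB i) ->
    rlen (extB i) (extZ i) l -> has_length (subquot (ker (E i)) T) l.
  move=> TS c1 c2; rewrite -(has_length_subquot _ TS).
  apply: (proj2 (rlen_iso (f := Psi i) TS (@extBZ i) _ _ _ _)) => //.
  - move=> g /kerP Eg; apply/mksubP; split; first exact: PsiN.
    by have := PsiD i g; rewrite Eg linear0 => /esym ?; apply/kerP.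
  - move=> A hA; have /mksubP[AN /kerP] := hA; rewrite mullinE => DA; have [g hg] := back _ _ AN.
    exists g; last exact: c2.
    apply/kerP/hom_ext => s; apply: iota_inj; rewrite EE hg ud hom_lin0 linear0.
    by rewrite -mulmxA DA mulmx0.
move: main; case: i => [|i] main.
  apply: (main (im \0)).
  - by move=> g /imP[g' <-]; apply/kerP; exact: linear0.
  - move=> g /kerP Eg; apply/idP/idP => [/mksubP Pg|/imP[g' eg]]; last first.
      have -> : g = 0 by rewrite -eg.
      by rewrite linear0 rpred0.
    suff -> : g = 0 by exact: rpred0.
    apply: hom_ext => s; apply: iota_inj; rewrite hom_lin0 linear0.
    have -> : s = v 0%N (u 0%N s) + res_d M 0 (h 0%N s) by rewrite -hd0 subrKC.
    by rewrite linearD -EE Eg hom_lin0 addr0 PsiE Pg mulmx0.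
  - move=> g A /mksubP[_ /kerP]; rewrite mullinE => DA hg; apply/mksubP/row_matrixP => j.
    rewrite linearB /= rowE -PsiE hg rowE -mulmxBl.
    rewrite -opprB mulNmx hd'0 -[_ *m D 0%N *m A]mulmxA DA mulmx0 oppr0.
    by rewrite row0.
apply: (main (im (E i))).
- move=> _ /imP[g <-]; apply/kerP/hom_ext => s; rewrite !EE hom_lin0.
  rewrite (_ : res_d M i (res_d M i.+1 s) = 0) ?linear0 //.
  by apply/res_exact; exists s.
- move=> g /kerP Eg; apply/mksubP/imP => [[Y YN Pg]|[g' <-]]; last first.
    by exists (Psi i g'); [exact: PsiN | rewrite mullinE PsiD].
  have [g1 hg1] := back _ _ YN.
  (* On a cocycle g the homotopy gives g - g v u = g h d, whence the correction by g composed with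
     h. *)
  exists (g1 + hom_mk (hom_lin g \o h i : {linear _ -> _})); apply: hom_ext => s.
  rewrite EE -[g1]scale1r hom_linP scale1r hom_mkE.
  have -> : hom_lin g s =
      hom_lin g (v i.+1 (u i.+1 s)) + hom_lin g (h i (res_d M i s)).
    rewrite -[in LHS](subrK (v i.+1 (u i.+1 s)) s) hd !(linearD (hom_lin g)).
    by rewrite -(EE _ g) Eg hom_lin0 add0r addrC.
  congr (_ + _); apply: iota_inj.
  by rewrite hg1 PsiE ud Pg mullinE mulmxA.
- move=> g A /mksubP[/mksubP AN /kerP]; rewrite mullinE => DA hg.
  apply/mksubP; exists (- (h' i *m A)); first by apply/mksubP; rewrite mulNmx -mulmxA AN mulmx0 oppr0.
  rewrite mullinE mulmxN; apply/row_matrixP => j.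
  rewrite linearB linearN /= rowE -PsiE hg !rowE -mulmxBl -opprB mulNmx hd'.
  by rewrite mulmxDl -[_ *m D i.+1 *m A]mulmxA DA mulmx0 add0r !mulmxA.
Qed.

End ExtComparison.

(** * Trace duality between Tor and Ext *)

Section Duality.
Variables (R : comNzRingType) (m : submodClosed R^o) (e : nat).
Variables (xs xd : 'I_e -> R) (x : R).
Hypothesis H : short_gorenstein m xs xd x.

Fact perp_prop p q (S : submodClosed 'M[R]_(p, q)) :
  submod_prop (fun w : 'M[R]_(p, q) => forall s, s \in S -> trform s w = 0).
Proof.
split=> [s _|a u v hu hv s sS]; first exact: trform0r.
by rewrite trform_linr hu // hv // mulr0 addr0.
Qed.
Definition perp p q (S : submodClosed 'M[R]_(p, q)) := mksub (perp_prop S).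

Lemma perpK p q (S : submodClosed 'M[R]_(p, q)) : perp (perp S) =i S.
Proof.
move=> v; apply/mksubP/idP => [h|vS w /mksubP h]; last by rewrite trform_sym h.
apply/negPn/negP => /(sg_sep H)[w wS]; rewrite trform_sym h ?eqxx //.
exact/mksubP.
Qed.

Lemma perp_strict p q (S T : submodClosed 'M[R]_(p, q)) :
  strict_sub S T -> strict_sub (perp T) (perp S).
Proof.
move=> [ST [v vT vS]]; split.
  by move=> w /mksubP h; apply/mksubP => s /ST/h.
have [w wS vw] := sg_sep H vS; exists w; first exact/mksubP.
by apply/negP => /mksubP/(_ v vT) vw0; rewrite vw0 eqxx in vw.
Qed.

Lemma perp_sub p q (S T : submodClosed 'M[R]_(p, q)) :
  {subset S <= T} -> {subset perp T <= perp S}.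
Proof. by move=> ST w /mksubP h; apply/mksubP => s /ST/h. Qed.

Lemma rchain_perp p q (T S : submodClosed 'M[R]_(p, q)) k :
  rchain T S k -> rchain (perp S) (perp T) k.
Proof.
move=> [c [ch cs]]; exists (fun i => perp (c (k - i)%N)); split=> i ik.
  have [h1 h2] := ch (k - i)%N (leq_subr _ _).
  by split; apply: perp_sub.
apply: perp_strict; have -> : (k - i = (k - i.+1).+1)%N by lia.
by apply: cs; lia.
Qed.

Lemma rlen_perp p q (T S : submodClosed 'M[R]_(p, q)) k :
  rlen T S k -> rlen (perp S) (perp T) k.
Proof.
move=> [c bnd]; split; first exact: rchain_perp.
move=> l /rchain_perp cl; apply: bnd; apply: rchain_widen cl => v.
  by rewrite perpK.
by rewrite perpK.
Qed.

Variables (b : nat -> nat) (D : forall i, 'M[R]_(b i.+1, b i)).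
Variables (n : nat -> nat) (C : forall j, 'M[R]_(n j.+1, n j)).

Lemma perp_imr p : perp (imr p (C 0%N)) =i rowsN C p.
Proof.
move=> Y; apply/mksubP/mksubP => [h|YC _ /imrP[F ->]].
  apply: trform_eq0 => B; rewrite -trformMr; apply: h; apply/imrP; by exists B.
by rewrite trformMr YC trform0r.
Qed.

Lemma perp_torB i : perp (torB D C i 0) =i extZ D C i.
Proof.
move=> A; apply/mksubP/mksubP => [h|[/mksubP AC /kerP]]; last rewrite mullinE => DA.
  split.
    rewrite -perp_imr; apply/mksubP => s sC; apply: h; exact: addsubr.
  apply/kerP; apply: trform_eq0 => B; rewrite -[D i]trmxK mullinE -trformMl.
  by apply: h; apply: addsubl; apply/imlP; exists B.
move=> _ /torBP[B [F ->]]; rewrite -[_ *m B]scale1r trform_linl trformMl trmxK.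
by rewrite trformMr DA AC !trform0r mulr0 addr0.
Qed.

Lemma perp_extB i : perp (extB D C i) =i torZ D C i 0.
Proof.
case: i => [|i] A.
  rewrite in_fullsub; apply/mksubP => _ /mksubP ->.
  by rewrite trform_sym trform0r.
apply/mksubP/mksubP => [h|].
  rewrite -perpK; apply/mksubP => Y; rewrite perp_imr => YN.
  rewrite mullinE -trformMl; apply: h; exact: mem_imsub.
move=> /imrP[F eF] _ /mksubP[Y /mksubP YC ->].
by rewrite mullinE trformMl [_ *m A]eF -{1}[C 0%N]trmxK -trformMr YC trform_sym trform0r.
Qed.

(** Under the trace form, cycles on either side are the annihilators of boundaries on the other, and
    taking annihilators reverses chains. *)
Lemma rlen_tor_ext i l : rlen (torB D C i 0) (torZ D C i 0) l ->
  rlen (extB D C i) (extZ D C i) l.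
Proof.
move=> /rlen_perp [c bnd].
have e1 : perp (torZ D C i 0) =i extB D C i.
  move=> A; rewrite -(perpK (extB D C i)).
  by apply/mksubP/mksubP => h s hs; apply: h; rewrite ?perp_extB // -perp_extB.
split; first by apply: rchain_widen c => v; rewrite ?e1 // perp_torB.
by move=> k ck; apply: bnd; apply: rchain_widen ck => v; rewrite ?e1 // perp_torB.
Qed.

Lemma fg_cover (V : lmodType R) : fg_module V ->
  exists g (p : {linear 'rV[R]_g -> V}), forall y, exists v, p v = y.
Proof.
move=> [s gs]; pose p : {linear 'rV[R]_(size s) -> V} := rowlift (tnth (in_tuple s)).
exists (size s), p => y; have /asboolP[l [ls ->]] := gs y.
suff : \sum_(q <- l) q.1 *: q.2 \in im p by move=> /imP.
rewrite big_seq rpred_sum // => q /ls qs; rewrite rpredZ //; apply/imP.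
have /tnthP[k ->] : q.2 \in in_tuple s by [].
by exists (delta_mx 0 k); rewrite [p _]rowlift_delta.
Qed.

(** For a presentation p of V, the double annihilator gives ker p = {v | v B^T = 0}, where the rows
    of B generate the annihilator of ker p. So v -> v B^T identifies V with a submodule of R^t,
    which is again an annihilator by [perpK]. *)
Lemma fg_embedding (V : lmodType R) : fg_module V ->
  exists g (K : submodClosed 'rV[R]_g) (iota : {linear V -> 'rV[R]_g}),
    injective iota /\ forall v, (exists y, iota y = v) <-> v \in perp K.
Proof.
move=> /fg_cover[g [p ps]].
have [t [B [hB _]]] := minimal_generators H (perp (ker p)).
have pB v : p v = 0 <-> v *m B^T = 0.
  have -> : p v = 0 <-> v \in ker p by split=> [?|/kerP//]; exact/kerP.
  rewrite -perpK; split=> [/mksubP h|vB].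
    apply: trform_eq0 => w; rewrite -trformMr; apply: h; apply/hB.
    by exists w.
  by apply/mksubP => _ /hB[w ->]; rewrite trformMr vB trform0r.
pose q y := projT1 (cid (ps y)); have pq y : p (q y) = y := projT2 (cid (ps y)).
have eqB v y : p v = y -> v *m B^T = q y *m B^T.
  move=> e1; apply/eqP; rewrite -subr_eq0 -mulmxBl; apply/eqP/pB.
  by rewrite linearB pq e1 subrr.
have lq : linear (fun y => q y *m B^T).
  move=> a y z; rewrite scalemxAl -mulmxDl; apply/esym/eqB.
  by rewrite linearP !pq.
exists t, (perp (imr 1 B^T)), (mklin lq); split=> [y z|v].
  rewrite !mklinE => /eqP; rewrite -subr_eq0 -mulmxBl => /eqP/pB.
  by rewrite linearB !pq => /eqP; rewrite subr_eq0 => /eqP.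
rewrite perpK; split=> [[y <-]|/imrP[w ->]]; first by apply/imrP; exists (q y).
by exists (p w); rewrite mklinE -(eqB w).
Qed.

End Duality.

(** * From recursions to polynomials, and the conclusion *)

Lemma zseries_recursion (e : nat) (l : nat -> nat) K :
  (forall k, (K <= k)%N -> (e * l k.+1 = l k.+2 + l k)%N) ->
  exists p : {poly int},
    zseries_mul (zseries_of_poly (1 - e%:R *: 'X + 'X^2)) (fun i => (l i)%:Z)
    =1 zseries_of_poly p.
Proof.
move=> rec; set f := zseries_mul _ _.
(* From degree K + 2 on, the coefficient of the product is l (k+2) - e l (k+1) + l k, which the
   recursion makes zero. *)
exists (\poly_(i < K.+2) f i) => k; rewrite /zseries_of_poly coef_poly.
case: ltnP => // Kk; have [k' ek] : exists k', k = k'.+2 by exists k.-2; lia.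
rewrite {k}ek in Kk *; have h : (e * l k'.+1 = l k'.+2 + l k')%N by apply: rec; lia.
rewrite /f /zseries_mul /zseries_of_poly !big_ord_recl big1 => [|i _]; last first.
  by rewrite !(coefD, coefN, coefZ, coef1, coefX, coefXn) /= mulr0 subr0 addr0 mul0r.
rewrite !(coefD, coefN, coefZ, coef1, coefX, coefXn) /=.
rewrite /bump /= !subSS !subn0 natz; move: h; nia.
Qed.

(** [D 0] may have unit entries, so the recursion is taken from the shifted resolution. Its lengths
    are those of D one degree higher, except in degree 0, where all matrices count as cycles. *)
Lemma tor_recursion_shift (R : comNzRingType) (m : submodClosed R^o) (e : nat)
    (xs xd : 'I_e -> R) (x : R) b D n C :
  short_gorenstein m xs xd x ->
  @resolution R b D -> (forall j, D j.+1 \in mmx m _ _) ->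
  @resolution R n C -> (forall j, C j.+1 \in mmx m _ _) ->
  exists K, forall k, (K <= k)%N ->
  (e * torlen D C k.+1 = torlen D C k.+2 + torlen D C k)%N.
Proof.
move=> H resD hD resC hC.
have [K hK] := tor_recursion H (resolution_shift resD) hD resC hC.
exists K.+2 => -[|[|k]] // Kk.
exact: (hK k.+1 (leqW Kk)).
Qed.

Theorem corollary3p2 (R : comNzRingType) (m : submodClosed R^o) (e : nat)
  (M N : lmodType R)
  (noethR : noetherian R) (localR : local_ring m) (gorR : gorenstein R)
  (m3_eq0 : ideal_mul m (ideal_mul m m) =i pred1 0)
  (m2_neq0 : ~ (ideal_mul m m =i pred1 0))
  (rank_e : residue_rank m (subquot m (ideal_mul m m)) e)
  (e_gt2 : (2 < e)%N)
  (fgM : fg_module M) (fgN : fg_module N) :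
  (exists l : nat -> nat,
     (forall i, has_length (Ext M N i) (l i)) /\
     exists p : {poly int},
       zseries_mul (zseries_of_poly (1 - e%:R *: 'X + 'X^2)) (fun i => (l i)%:Z)
       =1 zseries_of_poly p)
  /\
  (exists l : nat -> nat,
     (forall i, has_length (Tor M N i) (l i)) /\
     exists p : {poly int},
       zseries_mul (zseries_of_poly (1 - e%:R *: 'X + 'X^2)) (fun i => (l i)%:Z)
       =1 zseries_of_poly p).
Proof.
have [xs [xd [x H]]] := short_gorensteinP localR gorR m3_eq0 m2_neq0 rank_e e_gt2.
pose covers (V : lmodType R) n (K : submodClosed 'rV[R]_n) :=
  exists p : {linear 'rV[R]_n -> V},
    (forall y, exists v, p v = y) /\ forall v, p v = 0 <-> v \in K.
have cover (V : lmodType R) : fg_module V -> exists n K, @covers V n K.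
  move=> /fg_cover[n [p ps]]; exists n, (ker p), p; split=> // v.
  by split=> [h|/kerP//]; apply/kerP.
have [b [D [K [[eps [epsS epsK]] imD resD hD]]]] :=
  minimal_resolution H (cover M fgM).
have epsK' v : eps v = 0 <-> exists w, v = w *m D 0%N by rewrite epsK.
have rlenH n (C : forall j, 'M[R]_(n j.+1, n j)) i :
    rlen (torB D C i 0) (torZ D C i 0) (torlen D C i).
  by apply: lenP; apply: (finlen_mx H); exact: torBZ.
split.
  (* Here C resolves R^(n 0) / K', whose dual is [perp K'], a copy of N; so [torlen D C] counts Tor
     of M with Hom(N, R). *)
  have [n [C [K' [[iota [iotaI iotaE]] imC resC hC]]]] :=
    minimal_resolution H (P := fun n K => exists iota : {linear N -> 'rV[R]_n},
      injective iota /\ forall v, (exists y, iota y = v) <-> v \in perp K)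
      (fg_embedding H fgN).
  exists (torlen D C); split.
    move=> i; apply: (Ext_length epsS epsK' resD iotaI (C := C)); last first.
      exact: (rlen_tor_ext H).
    move=> v; rewrite iotaE; split=> [/mksubP h|vC].
      apply: trform_eq0 => w; rewrite -trformMr; apply: h.
      by apply/imC; exists w.
    by apply/mksubP => _ /imC[w ->]; rewrite trformMr vC trform0r.
  have [L hL] := tor_recursion_shift H resD hD resC hC.
  exact: zseries_recursion hL.
have [n [C [K' [[p [pS pK]] imC resC hC]]]] := minimal_resolution H (cover N fgN).
have pK' v : p v = 0 <-> exists w, v = w *m C 0%N by rewrite pK.
exists (torlen D C); split.
  by move=> i; apply/(Tor_length epsS epsK' resD pS pK').
have [L hL] := tor_recursion_shift H resD hD resC hC.
exact: zseries_recursion hL.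
Qed.
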